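(* For all integers $n,m\ge 1$, the formal series $$D_n^{(m)}(z;q,t)=\sum_{\lambda\subseteq m\delta_n}\ \sum_{T\in \mathrm{SSYT}((\lambda+(1^n))/\lambda)} t^{|m\delta_n/\lambda|}\,q^{\mathrm{dinv}_m(T)}\,z^T$$ is a symmetric function in $z=z_1,z_2,\ldots$, and it is Schur positive (its coefficients on the Schur basis lie in $\mathbb{N}[q,t]$). In fact, for each partition $\lambda\subseteq m\delta_n$ the individual term $$D_n^{(m),\lambda}(z;q)=\sum_{T\in \mathrm{SSYT}((\lambda+(1^n))/\lambda)} q^{\mathrm{dinv}_m(T)}\,z^T$$ is symmetric in $z$ and Schur positive.
   Context: $\mathbb{N}=\{0,1,2,\ldots\}$. A partition $\lambda$ is identified with its diagram $\{(i,j)\in\mathbb{N}\times\mathbb{N}:0\le j<\lambda_{i+1}\}$ ($i$ indexes rows, $j$ columns). $\delta_n=(n-1,\ldots,1,0)$ and $m\delta_n=(m(n-1),\ldots,m,0)$; $|m\delta_n/\lambda|=m\binom n2-|\lambda|$. For $\lambda\subseteq m\delta_n$, $(\lambda+(1^n))/\lambda$ is the skew shape consisting of the cells $(i,\lambda_{i+1})$, $0\le i\le n-1$. For a (skew) shape $\nu$, $\mathrm{SSYT}(\nu)$ is the set of $T:\nu\to\{1<2<\cdots\}$ weakly increasing (in $j$) along rows and strictly increasing (in $i$) along columns; $z^T=\prod_{x\in\nu}z_{T(x)}$. For a cell $x=(i,j)$ put $d_m(x)=mi+j$. Let $T\in\mathrm{SSYT}((\lambda+(1^n))/\lambda)$.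 A pair of entries $T(x)=a$, $T(y)=b$ with $a<b$, $x=(i,j)$, $y=(i',j')$, contributes: (i) if $j>j'$, $\max(0,m-|d_m(y)-d_m(x)|)$ d-inversions; (ii) if $j<j'$, $\max(0,m-|d_m(y)-d_m(x)-1|)$ d-inversions; (and $0$ if $j=j'$). Define a total order on cells by $x<_d y$ if $d_m(x)>d_m(y)$, or $d_m(x)=d_m(y)$ and $j<j'$. A pair of equal entries $T(x)=T(y)$ contributes the same number of d-inversions as would a pair of unequal entries $T(x)=a$, $T(y)=b$ with $x<_d y$ and $a<b$. $\mathrm{dinv}_m(T)$ is the total number of d-inversions contributed by all pairs of entries of $T$. *)

(* Defs.v *)
From mathcomp Require Import all_boot all_order all_algebra.
From mathcomp Require Import finmap monalg.

Set Implicit Arguments.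
Unset Strict Implicit.
Unset Printing Implicit Defensive.

Import GRing.Theory.

Local Open Scope ring_scope.

(* Formal power series over R in infinitely many variables, as coefficient
   functions.  The variables are z_1, z_2, ..., but letters and variables are
   numbered from 0: the letter k : nat stands for k + 1, and ucm k is the
   monomial z_(k+1). *)
Definition fseries (R : Type) : Type := {cmonom nat} -> R.

(* Bounded degree and invariance under permutations of the variables: the
   premise on a and b says that substituting z_(s i) for each z_i turns z^b
   into z^a. *)
Definition symmetric_function (R : nzRingType) (F : fseries R) : Prop :=
  (exists d : nat, forall a : {cmonom nat}, F a <> 0 -> (mdeg a <= d)%N) /\
  (forall (s : nat -> nat) (a b : {cmonom nat}),
     bijective s -> (forall i : nat, b i = a (s i)) -> F b = F a).

(* Cells are pairs (row, column), both numbered from 0. *)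
Definition cell : choiceType := (nat * nat)%type.

(* Weakly decreasing sequences; trailing zeros are allowed, as in
   m delta_n = (m (n - 1), ..., m, 0). *)
Definition is_partition (s : seq nat) : bool := sorted geq s.

Definition diagram (s : seq nat) : {fset cell} :=
  [fset x in [seq (i, j) | i <- iota 0 (size s), j <- iota 0 (nth 0%N s i)]]%fset.

(* Partitions in normal form (positive parts only), used to index the Schur
   basis without repetition. *)
Definition intpart : choiceType :=
  {s : seq nat | is_partition s && (0%N \notin s)}.

Definition ssyt (nu : {fset cell}) (T : nu -> nat) : bool :=
  [forall x : nu, forall y : nu,
     [&& ((val x).1 == (val y).1) && ((val x).2 < (val y).2)%N ==>
           (T x <= T y)%N
       & ((val x).2 == (val y).2) && ((val x).1 < (val y).1)%N ==>
           (T x < T y)%N]].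

Definition tab_monomial (nu : {fset cell}) (T : nu -> nat) : {cmonom nat} :=
  \big[mmul/mone]_(x : nu) ucm (T x).

(* The series \sum_(T in SSYT(nu)) w(T) z^T.  Its coefficient at z^a is a finite
   sum, because the tableaux with z^T = z^a only use letters from finsupp a. *)
Definition ssyt_series (R : nzRingType) (nu : {fset cell})
    (w : (nu -> nat) -> R) : fseries R :=
  fun a => \sum_(T : {ffun nu -> finsupp a}
      | ssyt (fun x => val (T x)) && (tab_monomial (fun x => val (T x)) == a))
    w (fun x => val (T x)).

Definition schur (R : nzRingType) (mu : intpart) : fseries R :=
  @ssyt_series R (diagram (val mu)) (fun=> 1).

(* The coefficients of F on the Schur basis exist and lie in P. *)
Definition schur_coefs_in (R : nzRingType) (P : R -> Prop) (F : fseries R) : Prop :=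
  exists2 c : {fsfun intpart -> R with 0},
    forall mu : intpart, P (c mu)
  & forall a : {cmonom nat}, F a = \sum_(mu <- finsupp c) c mu * schur R mu a.

Definition Nq (p : {poly int}) : Prop := forall i, 0 <= p`_i.

(* {poly {poly int}} is Z[q, t], with t the outer variable. *)
Definition Nqt (p : {poly {poly int}}) : Prop := forall i, Nq p`_i.

Definition mdelta (m n : nat) : seq nat :=
  [seq (m * (n - i.+1))%N | i <- iota 0 n].

(* The skew shape (s + (1^n)) / s. *)
Definition vstrip (n : nat) (s : seq nat) : {fset cell} :=
  [fset x in [seq (i, nth 0%N s i) | i <- iota 0 n]]%fset.

Definition dstat (m : nat) (x : cell) : nat := (m * x.1 + x.2)%N.

(* The d-inversions of a pair of entries T(x) < T(y).  The subtractions
   from m truncate at 0; those inside absolute values are in int. *)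
Definition dinv_pair (m : nat) (x y : cell) : nat :=
  if (y.2 < x.2)%N then (m - absz ((dstat m y)%:Z - (dstat m x)%:Z)%R)%N
  else if (x.2 < y.2)%N then
    (m - absz ((dstat m y)%:Z - (dstat m x)%:Z - 1)%R)%N
  else 0%N.

Definition dlt (m : nat) (x y : cell) : bool :=
  (dstat m y < dstat m x)%N || (dstat m x == dstat m y) && (x.2 < y.2)%N.

(* Each unordered pair of distinct cells is counted once: from the smaller to the
   larger entry, or along dlt when the entries are equal. *)
Definition dinv (m : nat) (nu : {fset cell}) (T : nu -> nat) : nat :=
  (\sum_(x : nu) \sum_(y : nu
      | (T x < T y) || (T x == T y) && dlt m (val x) (val y))
    dinv_pair m (val x) (val y))%N.

Definition Dterm (m n : nat) (s : seq nat) : fseries {poly int} :=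
  @ssyt_series {poly int} (vstrip n s) (fun T => 'X^(dinv m T)).

(* The index l runs over the partitions contained in m delta_n, padded with
   zeros to length n; their parts are at most m (n - 1).  Here 'X is t and
   'X%:P is q. *)
Definition Dseries (m n : nat) : fseries {poly {poly int}} :=
  fun a => \sum_(l : n.-tuple 'I_(m * n.-1).+1
      | is_partition (map val l) &&
        (diagram (map val l) `<=` diagram (mdelta m n))%fset)
    @ssyt_series {poly {poly int}} (vstrip n (map val l))
      (fun T => 'X^(m * 'C(n, 2) - sumn (map val l)) * 'X%:P ^+ dinv m T) a.

(* Main.v *)
From HB Require Import structures.
Require Import Defs.
From mathcomp Require Import all_boot all_order all_algebra.
From mathcomp Require Import all_fingroup all_solvable all_field all_character.
From mathcomp Require Import mpoly.
From mathcomp Require Import ring lra zify.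
From Stdlib Require Import ClassicalEpsilon.

Set Implicit Arguments.
Unset Strict Implicit.
Unset Printing Implicit Defensive.
Import GRing.Theory Num.Theory.
Local Open Scope ring_scope.

(** Fix the shape and list the cells of its vertical strip in the order opposite
    to [dlt]; they become the positions 0, ..., n-1 and a tableau becomes a word.
    For p < q the pair of positions contributes to [dinv] a constant, plus one
    exactly when q < h p and the letter at p is smaller than the letter at q,
    where h is the height function of a Dyck path.  So dinv is a constant plus the
    number of inversions of the word along the edges of a graph (the Dyck graph of
    h).  Cells of one column give some marked pairs (p, h p) along which the word
    has to increase strictly, and moving any set of marked pairs inside the path
    leaves a Dyck path ([ssyt_strict], [dinv_ninv], [hess_dyck]).

    Words counted by inversions are dimensions.  For a graph on the positions, a
    spline is a family of polynomials in x_0, ..., x_(n-1) indexed by words, whose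
    values at w and at w with the letters i and j exchanged agree on the hyperplane
    x_i = x_j for every edge ij.  The leading value of a spline at w is a multiple
    of the product of the differences x_i - x_j over the inversions of w, which
    bounds the dimension of the splines of degree d by a sum over words
    ([dim_spline_space_le]).  For Dyck graphs the bound is attained
    ([dyck_tight]): both sides satisfy the same three term relation between
    graphs that differ by two edges at a pair of twin vertices ([dim_modular],
    [inv_dim_modular]), which reduces all Dyck graphs to those with h i <= i + 2,
    where a triangular family of splines is explicit ([base_flow_up]).  Triangular
    families chosen inside the marked graphs then show that the words with d
    inversions that are strict on the marks count the dimension, in degree d, of
    the splines modulo those of the graphs with one more marked edge and modulo
    multiples of the variables ([dim_marked_space]).

    When the words are all permutations, the symmetric group acts on this quotient,
    and the splines fixed by the stabilizer of a word u are the splines on the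
    words that rearrange u.  Hence there is one character of the symmetric group
    for each d whose restriction to the stabilizer of u contains the trivial
    character as often as there are strict rearrangements of u with d inversions
    ([word_character]).  The coefficient of a monomial is thus a function of the
    stabilizer of any word with that content, so the series is symmetric.

    Finally Young's rule: inducing the trivial character of the stabilizer of u
    gives the sum over the partitions la of n of K(la, u) s_la with s_la
    irreducible ([schur_basis]).  The inner products of the induced characters
    count the matrices of natural numbers with given margins ([gram]), the
    commutation of adding and removing horizontal strips ([local_rule]) turns this
    count into a sum of products of Kostka numbers ([kostka_pairing]), and the
    Kostka numbers are unitriangular.  By Frobenius reciprocity the coefficients of
    the series are combinations of Kostka numbers with multiplicities as
    coefficients ([character_kostka]), and Kostka numbers are the coefficients of
    Schur functions ([schur_kostka]). *)

(** * Polynomials and the hyperplanes x_i = x_j *)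

Section Rename.
Variables (n : nat) (F : fieldType).
Local Notation P := {mpoly F[n]}.

Definition rename (r : 'I_n -> 'I_n) (p : P) : P := p \mPo [tuple 'X_(r i) | i < n].

Fact rename_is_zmod_morphism r : zmod_morphism (rename r).
Proof. exact: comp_mpoly_is_additive. Qed.
HB.instance Definition _ r := GRing.isZmodMorphism.Build P P (rename r) (rename_is_zmod_morphism r).
Fact rename_is_monoid_morphism r : monoid_morphism (rename r).
Proof. by case: (comp_mpoly_is_multiplicative [tuple 'X_(r i) | i < n] : multiplicative (rename r)). Qed.
HB.instance Definition _ r := GRing.isMonoidMorphism.Build P P (rename r) (rename_is_monoid_morphism r).
Fact rename_is_scalable r : scalable (rename r).
Proof. exact: comp_mpoly_is_linear. Qed.
HB.instance Definition _ r := GRing.isScalable.Build F P P *:%R (rename r) (rename_is_scalable r).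

Lemma renameX r i : rename r 'X_i = 'X_(r i).
Proof. by rewrite /rename comp_mpolyXU -tnth_nth tnth_mktuple. Qed.

Lemma renameC r c : rename r c%:MP = c%:MP.
Proof. exact: comp_mpolyC. Qed.

(** Ring generators suffice for the identities below, all of which are between
    ring morphisms or stable under sums and products. *)
Lemma mpoly_ring_ind (Q : P -> Prop) :
    (forall c, Q c%:MP) -> (forall i, Q 'X_i) ->
    (forall p q, Q p -> Q q -> Q (p + q)) ->
    (forall p q, Q p -> Q q -> Q (p * q)) -> forall p, Q p.
Proof.
move=> QC QX QD QM p.
have QE : Q 0 by rewrite -mpolyC0.
have Q1 : Q 1 by rewrite -mpolyC1.
 rewrite [p]mpolyE; apply: (big_ind Q QE (QD)) => m _.
rewrite -mul_mpolyC; apply: (QM _ _ (QC _)).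
rewrite mpolyXE_id; apply: (big_ind Q Q1 (QM)) => i _.
by elim: (m i) => [|k IH]; rewrite ?expr0 // exprS; apply: (QM).
Qed.

Lemma rename_comp r r' p : rename r (rename r' p) = rename (r \o r') p.
Proof.
elim/mpoly_ring_ind: p => [c|i|p q IHp IHq|p q IHp IHq].
- by rewrite !renameC.
- by rewrite !renameX.
- by rewrite !rmorphD /= IHp IHq.
- by rewrite !rmorphM /= IHp IHq.
Qed.

Lemma eq_rename r r' p : r =1 r' -> rename r p = rename r' p.
Proof.
move=> e; elim/mpoly_ring_ind: p => [c|i|p q IHp IHq|p q IHp IHq].
- by rewrite !renameC.
- by rewrite !renameX e.
- by rewrite !rmorphD /= IHp IHq.
- by rewrite !rmorphM /= IHp IHq.
Qed.

Lemma rename_id r p : r =1 id -> rename r p = p.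
Proof.
move=> e; elim/mpoly_ring_ind: p => [c|i|p q IHp IHq|p q IHp IHq].
- by rewrite renameC.
- by rewrite renameX e.
- by rewrite rmorphD /= IHp IHq.
- by rewrite rmorphM /= IHp IHq.
Qed.

Lemma dhomog_rename d r p : p \is d.-homog -> rename r p \is d.-homog.
Proof.
move=> /dhomogP hp; rewrite /rename comp_mpolyE big_seq.
apply: rpred_sum => m /hp /= dm; apply: rpredZ.
have -> : d = (\sum_(i < n) m i)%N by rewrite -dm mdegE.
elim/big_ind2: _ => [|e p1 f q1|i _]; first exact: dhomog1.
  by move=> ? ?; rewrite dhomogM.
have hX : ('X_(r i) : P) \is 1.-homog by rewrite dhomogX /= mdeg1.
by rewrite tnth_mktuple; have := dhomogMn (m i) hX; rewrite mul1n.
Qed.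

Definition glue (i j k : 'I_n) := if k == i then j else k.
(** The restriction to the hyperplane x_i = x_j, read as the polynomial in which
    x_j replaces x_i. *)
Definition on_diag i j : P -> P := rename (glue i j).
HB.instance Definition _ i j := GRing.RMorphism.on (on_diag i j).
HB.instance Definition _ i j := GRing.Linear.on (on_diag i j).

Lemma on_diagD i j p q : on_diag i j (p + q) = on_diag i j p + on_diag i j q.
Proof. exact: rmorphD. Qed.
Lemma on_diagB i j p q : on_diag i j (p - q) = on_diag i j p - on_diag i j q.
Proof. exact: rmorphB. Qed.
Lemma on_diagM i j p q : on_diag i j (p * q) = on_diag i j p * on_diag i j q.
Proof. exact: rmorphM. Qed.

Definition xdiff (i j : 'I_n) : P := 'X_i - 'X_j.

Lemma on_diagX i j k : on_diag i j 'X_k = 'X_(glue i j k).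
Proof. exact: renameX. Qed.

Lemma mpolyXU_inj (i j : 'I_n) : ('X_i == 'X_j :> P) = (i == j).
Proof.
apply/eqP/eqP=> [/mpolyP /(_ U_(i)%MM)|-> //].
rewrite !mcoeffX eqxx; case: eqP => [/mnmP/(_ i)|_ /eqP]; last by rewrite oner_eq0.
by rewrite !mnm1E eqxx; case: eqP => [->|].
Qed.

Lemma xdiff_neq0 i j : i != j -> xdiff i j != 0.
Proof. by rewrite subr_eq0 mpolyXU_inj. Qed.

Lemma dhomog_xdiff i j : xdiff i j \is 1.-homog.
Proof. by rewrite rpredB // dhomogX /= mdeg1. Qed.

Lemma on_diag_xdiff i j : on_diag i j (xdiff i j) = 0.
Proof.
by rewrite rmorphB /= !on_diagX /glue eqxx if_same subrr.
Qed.

Lemma on_diag_div i j p : exists q, p - on_diag i j p = xdiff i j * q.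
Proof.
elim/mpoly_ring_ind: p => [c|k|p q [a ea] [b eb]|p q [a ea] [b eb]].
- by exists 0; rewrite /on_diag renameC subrr mulr0.
- rewrite on_diagX /glue; case: eqVneq => [->|_]; first by exists 1; rewrite mulr1.
  by exists 0; rewrite subrr mulr0.
- by exists (a + b); rewrite rmorphD mulrDr -ea -eb /=; ring.
- exists (a * q + on_diag i j p * b); rewrite rmorphM mulrDr mulrA -ea.
  rewrite mulrCA -eb /=; ring.
Qed.

Lemma on_diag_eq0P i j p : on_diag i j p = 0 <-> exists q, p = xdiff i j * q.
Proof.
split=> [e|[q ->]]; last by rewrite rmorphM /= on_diag_xdiff mul0r.
by have [q eq] := on_diag_div i j p; exists q; rewrite -eq e subr0.
Qed.

Lemma on_diag_xdiff_neq0 i j k l :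
  k != l -> (k, l) != (i, j) -> (k, l) != (j, i) -> on_diag i j (xdiff k l) != 0.
Proof.
move=> kl n1 n2; rewrite rmorphB /= !on_diagX subr_eq0 mpolyXU_inj /glue.
move: kl n1 n2; rewrite !xpair_eqE.
case: (eqVneq k i) => [->|ki]; case: (eqVneq l i) => [->|li] //=; rewrite ?eqxx //=.
- by rewrite eq_sym.
- by rewrite andbT.
Qed.

Lemma on_diag_swap i j p q : on_diag i j p = on_diag i j q <-> on_diag j i p = on_diag j i q.
Proof.
suff imp a b : on_diag a b p = on_diag a b q -> on_diag b a p = on_diag b a q by split; apply: imp.
move=> e; apply/eqP; rewrite -subr_eq0 -rmorphB; apply/eqP/on_diag_eq0P.
have [|r er] := (on_diag_eq0P a b (p - q)).1; first by rewrite rmorphB /= e subrr.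
by exists (- r); rewrite er /xdiff; ring.
Qed.

Lemma on_diag_rename_tperm i j p : on_diag i j (rename (tperm i j) p) = on_diag i j p.
Proof.
rewrite /on_diag rename_comp; apply: eq_rename => k /=; rewrite /glue.
by case: tpermP => [->|->|]; rewrite ?eqxx //; case: eqVneq.
Qed.

Lemma rename_on_diag (s : {perm 'I_n}) i j p : rename s (on_diag i j p) = on_diag (s i) (s j) (rename s p).
Proof.
rewrite /on_diag !rename_comp; apply: eq_rename => k /=; rewrite /glue.
by rewrite (inj_eq perm_inj); case: ifP.
Qed.

Lemma rename_xdiff (s : 'I_n -> 'I_n) i j : rename s (xdiff i j) = xdiff (s i) (s j).
Proof. by rewrite rmorphB /= !renameX. Qed.

(** The differences are primes, pairwise not associated because the pairs are
    increasing and distinct; so the product divides p as soon as each factor does. *)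
Lemma prod_xdiff_dvd (s : seq ('I_n * 'I_n)) p :
    uniq s -> (forall x, x \in s -> (x.1 < x.2)%N) ->
    (forall x, x \in s -> on_diag x.1 x.2 p = 0) ->
  exists q, p = (\prod_(x <- s) xdiff x.1 x.2) * q.
Proof.
elim: s => [|x s IH] /=; first by exists p; rewrite big_nil mul1r.
case/andP=> xs us lts evs.
have lts' y : y \in s -> (y.1 < y.2)%N by move=> ys; apply: lts; rewrite inE ys orbT.
have evs' y : y \in s -> on_diag y.1 y.2 p = 0 by move=> ys; apply: evs; rewrite inE ys orbT.
have [q e] := IH us lts' evs'.
have := evs x (mem_head _ _); rewrite e rmorphM /= => /eqP.
rewrite mulf_eq0 rmorph_prod prodf_seq_eq0 /= => /orP[/hasP[y ys /=]|/eqP /on_diag_eq0P[r ->]].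
  have lx := lts x (mem_head _ _).
  have ly := lts' y ys.
  suff /negPf -> : on_diag x.1 x.2 (xdiff y.1 y.2) != 0 by [].
  apply: on_diag_xdiff_neq0; first by rewrite neq_ltn ly.
    apply: contraNneq xs => exy; suff <- : y = x by [].
    by case: x y exy {ys lx ly lts evs lts' evs'} => ? ? [? ?] [-> ->].
  by apply/eqP=> -[e1 e2]; have := ltn_trans lx; rewrite -e1 => /(_ _ ly); rewrite e2 ltnn.
by exists r; rewrite big_cons; ring.
Qed.

Lemma dhomog_prod_xdiff (s : seq ('I_n * 'I_n)) :
  \prod_(x <- s) xdiff x.1 x.2 \is (size s).-homog.
Proof.
elim: s => [|x s IH]; first by rewrite big_nil; apply: dhomog1.
by rewrite big_cons; apply: (@dhomogM _ _ _ 1 _ (size s)) => //; apply: dhomog_xdiff.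
Qed.

Lemma pihomogM e d (p q : P) :
  p \is e.-homog -> pihomog mdeg (e + d) (p * q) = p * pihomog mdeg d q.
Proof.
move=> hp; pose k := maxn (msize q) d.+1.
have e1 := @pihomog_partitionE _ _ mdeg k q (leq_maxl _ _).
rewrite {1}e1 mulr_sumr raddf_sum /=.
have lt : (d < k)%N by rewrite leq_maxr.
rewrite (bigD1 (Ordinal lt)) //= [X in _ + X]big1 ?addr0.
  by rewrite pihomog_dE // dhomogM // pihomogP.
move=> i; rewrite -val_eqE /= => ni.
rewrite (pihomog_ne0 (d := (e + i)%N)) //; first by lia.
by rewrite dhomogM // pihomogP.
Qed.

(** The homogeneous part of degree e + d of p * q is p times that of degree d of
    q, and p may be cancelled. *)
Lemma dhomog_quotient e d (p q : P) :
  p != 0 -> p \is e.-homog -> p * q \is (e + d).-homog -> q \is d.-homog.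
Proof.
move=> p0 hp hpq; have := pihomog_dE hpq; rewrite pihomogM // => /(mulfI p0) <-.
exact: pihomogP.
Qed.

Lemma dhomog_quotient0 e d (p q : P) :
  p != 0 -> p \is e.-homog -> (d < e)%N -> p * q \is d.-homog -> q = 0.
Proof.
move=> p0 hp lt hpq; rewrite (@pihomog_partitionE _ _ mdeg _ q (leqnn _)).
apply: big1 => k _; apply: (mulfI p0); rewrite mulr0 -(pihomogM _ _ hp).
by rewrite (pihomog_ne0 (d := d)) //; lia.
Qed.

End Rename.

(** * Subspaces and leading values *)

Section LinearAlgebra.
Variable K : fieldType.

(** Classically, every linear condition on a finite dimensional space cuts out a
    subspace: a subspace inside the condition of maximal dimension exhausts it. *)
Lemma exists_vspace (V : vectType K) (S : V -> Prop) :
    S 0 -> (forall a u v, S u -> S v -> S (a *: u + v)) ->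
  exists X : {vspace V}, forall v, v \in X <-> S v.
Proof.
move=> S0 SD; suff ext k (X : {vspace V}) : (dim V - \dim X <= k)%N ->
    (forall v, v \in X -> S v) -> exists X : {vspace V}, forall v, v \in X <-> S v.
  by apply: (ext (dim V) 0%VS) => [|v]; [lia | rewrite memv0 => /eqP ->].
elim: k X => [|k IH] X le XS; case: (classic (forall v, S v -> v \in X)) => [h|].
- by exists X => v; split; [apply: XS | apply: h].
- move=> nh; case: nh => v _; have : (X <= {:V})%VS := subvf X.
  move=> sub; suff -> : X = {:V}%VS by rewrite memvf.
  by apply/eqP; rewrite eqEdim sub dimvf /=; lia.
- by exists X => v; split; [apply: XS | apply: h].
(* some vector of S lies outside of X: enlarge X by it *)
move=> nh; have [v nv] := not_all_ex_not _ _ nh; have [Sv /negP vX] := imply_to_and _ _ nv.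
apply: (IH (X + <[v]>)%VS).
  suff : (\dim X < \dim (X + <[v]>))%N by move: le; lia.
  rewrite (ltn_leqif (dimv_leqif_sup (addvSl _ _))) subv_add subvv /=.
  by rewrite -memvE.
move=> w /memv_addP[x xX [y /vlineP[c ->] ->]].
by rewrite addrC; apply: SD => //; apply: XS.
Qed.

Definition vspace_of (V : vectType K) (S : V -> Prop)
    (S0 : S 0) (SD : forall a u v, S u -> S v -> S (a *: u + v)) : {vspace V} :=
  proj1_sig (constructive_indefinite_description _ (exists_vspace S0 SD)).

Lemma vspace_ofP (V : vectType K) (S : V -> Prop) S0 SD v :
  v \in @vspace_of V S S0 SD <-> S v.
Proof.
exact: (proj2_sig (constructive_indefinite_description _ (exists_vspace S0 SD))).
Qed.

Lemma dim_le_map (V W : vectType K) (X : {vspace V}) (Y : {vspace W}) (g : V -> W) :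
    linear g -> (forall v, v \in X -> g v \in Y) ->
    (forall v, v \in X -> g v = 0 -> v = 0) -> (\dim X <= \dim Y)%N.
Proof.
move=> gl gX g0.
pose gL : {linear V -> W} := HB.pack g (GRing.isLinear.Build K V W *:%R g gl).
rewrite -(@limg_dim_eq _ _ _ (linfun gL)).
  by apply: dimvS; apply/subvP => w /memv_imgP[v vX ->]; rewrite lfunE; apply: gX.
apply/eqP; rewrite -subv0; apply/subvP => v; rewrite memv_cap memv_ker lfunE memv0.
by case/andP=> vX /eqP/(g0 _ vX) ->.
Qed.

Lemma dim_eq_map (V W : vectType K) (X : {vspace V}) (Y : {vspace W}) (g : V -> W) :
    linear g -> (forall v, v \in X -> g v \in Y) ->
    (forall v, v \in X -> g v = 0 -> v = 0) ->
    (forall w, w \in Y -> exists2 v, v \in X & g v = w) -> \dim X = \dim Y.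
Proof.
move=> gl gX g0 gs; apply/eqP; rewrite eqn_leq (dim_le_map gl) //=.
pose gL : {linear V -> W} := HB.pack g (GRing.isLinear.Build K V W *:%R g gl).
suff -> : Y = (linfun gL @: X)%VS by rewrite -(limg_ker_dim (linfun gL) X) leq_addl.
apply/vspaceP => w; apply/idP/memv_imgP => [/gs[v vX <-]|[v vX ->]].
  by exists v; rewrite ?lfunE.
by rewrite lfunE; apply: gX.
Qed.

Section Leading.
Variables (T : finType) (W : vectType K) (moment : T -> nat).
Local Notation V := {ffun T -> W}.

Definition scan := sort (relpre moment leq) (enum T).
(** Indices are scanned by increasing [moment]; ties are broken arbitrarily, but
    strictly smaller moments always come before. *)
Definition before t' t := (index t' scan < index t scan)%N.

Lemma mem_scan t : t \in scan.
Proof. by rewrite mem_sort mem_enum. Qed.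

Lemma before_of_lt t' t : (moment t' < moment t)%N -> before t' t.
Proof.
move=> lt; rewrite /before ltnNge; apply: contraL lt => le; rewrite -leqNgt.
have tr : transitive (relpre moment leq) by move=> ? ? ?; apply: leq_trans.
have st : sorted (relpre moment leq) scan by apply: sort_sorted => ? ?; apply: leq_total.
apply: (sorted_leq_index tr _ st) => //; rewrite ?mem_scan //.
by move=> ?; apply: leqnn.
Qed.

Definition eval_at t : 'Hom(V, W) := linfun (fun f : V => f t).

Lemma eval_atE t f : eval_at t f = f t.
Proof.
have h : linear (fun f : V => f t) by move=> a u v; rewrite !ffunE.
pose gL : {linear V -> W} := HB.pack (fun f : V => f t) (GRing.isLinear.Build K V W *:%R _ h).
by have := lfunE gL f.
Qed.

Definition lead_space (X : {vspace V}) t : {vspace W} :=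
  (eval_at t @: (X :&: \bigcap_(t' | before t' t) lker (eval_at t')))%VS.

Lemma memv_bigcap (I : finType) (Q : pred I) (Xs : I -> {vspace V}) v :
  (v \in \bigcap_(i | Q i) Xs i)%VS = [forall (i | Q i), v \in Xs i].
Proof.
rewrite memvE; apply/subv_bigcapP/forall_inP => h i Qi.
  by rewrite memvE h.
by rewrite -memvE h.
Qed.

Lemma lead_spaceP (X : {vspace V}) t p :
  reflect (exists f : V, [/\ f \in X, forall t', before t' t -> f t' = 0 & f t = p])
          (p \in lead_space X t).
Proof.
apply: (iffP memv_imgP) => [[f]|[f [fX f0 <-]]].
  rewrite memv_cap memv_bigcap => /andP[fX /forall_inP f0] ->.
  by exists f; rewrite eval_atE; split=> // t' /f0; rewrite memv_ker eval_atE => /eqP.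
exists f; rewrite ?eval_atE // memv_cap fX memv_bigcap; apply/forall_inP => t' lt.
by rewrite memv_ker eval_atE f0.
Qed.

(** The subspaces of the families vanishing on the first j indices form a
    filtration whose successive quotients are the spaces of leading values. *)
Lemma dim_lead_space X : (\dim X = \sum_t \dim (lead_space X t))%N.
Proof.
pose Kj j := (X :&: \bigcap_(t | (index t scan < j)%N) lker (eval_at t))%VS.
have us : uniq scan by rewrite sort_uniq enum_uniq.
have step j : (j <= size scan)%N ->
   (\dim X = \dim (Kj j) + \sum_(t <- take j scan) \dim (lead_space X t))%N.
  elim: j => [|j IH] lt.
    rewrite take0 big_nil addn0 /Kj big_pred0 ?capvf //.
  rewrite IH ?(ltnW lt) //; have t0 : T by case: scan lt.
  rewrite (take_nth t0 lt) -cats1 big_cat big_seq1 /=.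
  set t := nth t0 scan j; have it : index t scan = j by rewrite index_uniq.
  rewrite -(limg_ker_dim (eval_at t) (Kj j)) [in RHS]addnCA [in LHS]addnAC -addnA addnC -addnA.
  congr (_ + _)%N; rewrite addnC; congr (_ + _)%N; last first.
    by rewrite /lead_space /Kj; congr (\dim (_ @: (_ :&: _)%VS)); apply: eq_bigl => t'; rewrite /before it.
  congr (\dim _); apply/vspaceP => f; rewrite !memv_cap !memv_bigcap -andbA; congr (_ && _).
  apply/andP/forall_inP => [[/forall_inP h ht] t'|h].
    rewrite ltnS leq_eqVlt => /orP[/eqP e|]; last exact: h.
    suff -> : t' = t by [].
    by rewrite -(nth_index t0 (mem_scan t')) e.
  split; last by apply: h; rewrite it.
  by apply/forall_inP => t' lt'; apply: h; apply: ltnW.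
have K0 : Kj (size scan) = 0%VS.
  apply/eqP; rewrite -subv0; apply/subvP => f; rewrite memv_cap memv_bigcap memv0.
  case/andP=> _ /forall_inP h; apply/eqP/ffunP => t; rewrite ffunE.
  by have := h t; rewrite index_mem mem_scan memv_ker eval_atE => /(_ isT)/eqP.
rewrite (step (size scan)) // K0 dimv0 add0n take_size.
by rewrite (perm_big (enum T)) ?big_enum //=; apply/permPl/perm_sort.
Qed.

Lemma before_ind (Q : T -> Prop) :
  (forall t, (forall t', before t' t -> Q t') -> Q t) -> forall t, Q t.
Proof.
move=> h t; have [k] := ubnP (index t scan); elim: k t => // k IH t lt.
by apply: h => t' lt'; apply: IH; apply: leq_trans lt' _.
Qed.

Lemma before_total t t' : [\/ before t' t, t' = t | before t t'].
Proof.
rewrite /before; case: (ltngtP (index t' scan) (index t scan)) => [|_|e];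
  [by constructor 1 | by constructor 3 | constructor 2].
by rewrite -(nth_index t (mem_scan t')) e nth_index ?mem_scan.
Qed.
End Leading.
End LinearAlgebra.

(** * Splines on a graph and their inversion bound *)

Section Splines.
Variables (n' : nat) (F : fieldType).
Local Notation n := n'.+1.
Local Notation P := {mpoly F[n]}.
Local Notation H d := (dhomog n F d).
Variables (T : finType) (wd : T -> 'I_n -> nat) (sw : 'I_n -> 'I_n -> T -> T).
Hypothesis wd_inj : forall t t', wd t =1 wd t' -> t = t'.
Hypothesis wd_sw : forall i j t p, wd (sw i j t) p = wd t (tperm i j p).
Local Notation U d := {ffun T -> H d}.

(** With all permutations as words and a Dyck graph, these congruences describe
    the equivariant cohomology of a regular semisimple Hessenberg variety. *)
Definition spline (e : rel 'I_n) (f : T -> P) :=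
  forall i j t, e i j -> on_diag i j (f t) = on_diag i j (f (sw i j t)).

Lemma hom_inj d (p q : H d) : p = q :> P -> p = q.
Proof. exact: val_inj. Qed.

Lemma hom0 d : (0 : H d) = 0 :> P.
Proof. by []. Qed.

Definition pval d (f : U d) t : P := f t.

Lemma pvalP d (f g : U d) : pval f =1 pval g -> f = g.
Proof. by move=> h; apply/ffunP => t; apply: val_inj; apply: h. Qed.

Lemma pval_lin d a (f g : U d) t : pval (a *: f + g) t = a *: pval f t + pval g t.
Proof. by rewrite /pval !ffunE linearP. Qed.

Lemma pval0 d t : pval (0 : U d) t = 0.
Proof. by rewrite /pval ffunE linear0. Qed.

Lemma pval_homog d (f : U d) t : pval f t \is d.-homog.
Proof. exact: dhomog_is_dhomog. Qed.

Definition family_of d (g : T -> P) (hg : forall t, g t \is d.-homog) : U d :=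
  [ffun t => DHomog (hg t)].

Lemma pval_family_of d g hg t : pval (@family_of d g hg) t = g t.
Proof. by rewrite /pval ffunE. Qed.

Lemma spline0 e : spline e (fun=> 0).
Proof. by []. Qed.

Lemma spline_lin e (a b : P) f g : spline e f -> spline e g ->
  spline e (fun t => a * f t + b * g t).
Proof. by move=> hf hg i j t h; rewrite !on_diagD !on_diagM (hf _ _ t h) (hg _ _ t h). Qed.

Lemma splineM e (a : P) f : spline e f -> spline e (fun t => a * f t).
Proof. by move=> hf i j t h; rewrite !on_diagM (hf _ _ t h). Qed.

Lemma eq_spline e f g : f =1 g -> spline e f -> spline e g.
Proof. by move=> h hf i j t eij; rewrite -!h hf. Qed.

Lemma sub_spline (e e' : rel 'I_n) f : (forall i j, e' i j -> e i j) -> spline e f -> spline e' f.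
Proof. by move=> s hf i j t /s; apply: hf. Qed.

Fact spline_space0 e d : spline e (pval (0 : U d)).
Proof. by apply: eq_spline (@spline0 e) => t; rewrite pval0. Qed.

Fact spline_spaceD e d a (f g : U d) : spline e (pval f) -> spline e (pval g) -> spline e (pval (a *: f + g)).
Proof.
move=> hf hg; apply: eq_spline (spline_lin a%:MP 1 hf hg) => t.
by rewrite pval_lin mul1r mul_mpolyC.
Qed.

Definition spline_space e d : {vspace U d} := vspace_of (@spline_space0 e d) (@spline_spaceD e d).

Lemma spline_spaceP e d (f : U d) : f \in spline_space e d <-> spline e (pval f).
Proof. exact: vspace_ofP. Qed.

(** This statistic drops when an inversion is undone, whatever the two positions
    are, so that it orders the words compatibly with all graphs at once. *)
Definition moment t := (\sum_(p < n) p * wd t p)%N.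

Lemma moment_swap (i j : 'I_n) t : (i < j)%N -> (wd t i < wd t j)%N -> (moment (sw i j t) < moment t)%N.
Proof.
move=> ij wij; have ji : j != i by rewrite neq_ltn ij orbT.
have kE (f : 'I_n -> nat) : (\sum_(p < n) p * f p =
    i * f i + (j * f j + \sum_(p < n | (p != i) && (p != j)) p * f p))%N.
  by rewrite (bigD1 i) //= (bigD1 j).
rewrite /moment !kE !wd_sw tpermL tpermR.
have -> : (\sum_(p < n | (p != i) && (p != j)) p * wd (sw i j t) p =
           \sum_(p < n | (p != i) && (p != j)) p * wd t p)%N.
  by apply: eq_bigr => p /andP[pi pj]; rewrite wd_sw tpermD // eq_sym.
by nia.
Qed.

Definition inversions (e : rel 'I_n) t := [seq x : 'I_n * 'I_n <- enum {:'I_n * 'I_n} |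
  [&& (x.1 < x.2)%N, e x.1 x.2 & (wd t x.1 < wd t x.2)%N]].
Definition ninv e t := size (inversions e t).
Definition inv_prod e t : P := \prod_(x <- inversions e t) xdiff F x.1 x.2.

Lemma inv_prod_homog e t : inv_prod e t \is (ninv e t).-homog.
Proof. exact: dhomog_prod_xdiff. Qed.

Lemma inv_prod_neq0 e t : inv_prod e t != 0.
Proof.
rewrite prodf_seq_neq0; apply/allP => x; rewrite mem_filter => /andP[/andP[lt _] _].
by rewrite xdiff_neq0 // neq_ltn lt.
Qed.

Local Notation bef := (before moment).

(** Undoing an inversion of t leads to an earlier word, where f vanishes; so f t
    vanishes on the hyperplane of every inversion of t. *)
Lemma spline_lead e f t : spline e f -> (forall t', bef t' t -> f t' = 0) ->
  exists q, f t = inv_prod e t * q.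
Proof.
move=> hf f0; apply: prod_xdiff_dvd; first by rewrite filter_uniq // enum_uniq.
  by move=> x; rewrite mem_filter => /andP[/andP[]].
move=> x; rewrite mem_filter => /andP[/and3P[lt ex wx] _].
rewrite hf // f0 ?rmorph0 //; apply: before_of_lt; exact: moment_swap.
Qed.

Definition dim_homog d := \dim {:H d}.
(** The dimension of the degree d multiples of [inv_prod e t]. *)
Definition inv_dim e d t := if (ninv e t <= d)%N then dim_homog (d - ninv e t) else 0%N.

Fact inv_prod_mul0 e d t : exists q : P, (0 : H d) = inv_prod e t * q :> P.
Proof. by exists 0; rewrite mulr0 linear0. Qed.
Fact inv_prod_mulD e d t a (u v : H d) : (exists q : P, u = inv_prod e t * q :> P) ->
  (exists q : P, v = inv_prod e t * q :> P) -> exists q : P, (a *: u + v) = inv_prod e t * q :> P.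
Proof.
by move=> [q eq] [r er]; exists (a *: q + r); rewrite linearP /= eq er mulrDr scalerAr.
Qed.
Definition inv_prod_mul e d t : {vspace H d} := vspace_of (@inv_prod_mul0 e d t) (@inv_prod_mulD e d t).

Lemma dim_inv_prod_mul e d t : \dim (inv_prod_mul e d t) = inv_dim e d t.
Proof.
rewrite /inv_dim; case: leqP => [le|lt].
  have hm (q : H (d - ninv e t)) : inv_prod e t * q \is d.-homog.
    rewrite -[in X in X.-homog](subnKC le); apply: dhomogM; first exact: inv_prod_homog.
    exact: dhomog_is_dhomog.
  apply/esym; apply: (@dim_eq_map _ _ _ _ _ (fun q => DHomog (hm q))).
  - move=> a p q; apply: hom_inj.
    change (inv_prod e t * (a *: (p : P) + q) = a *: (inv_prod e t * p) + inv_prod e t * q).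
    by rewrite mulrDr scalerAr.
  - by move=> p _; apply/vspace_ofP; exists p.
  - move=> p _ /(congr1 val) /= /eqP; rewrite mulf_eq0 (negPf (inv_prod_neq0 e t)) /=.
    by move=> /eqP h; apply: hom_inj; rewrite h.
  move=> p /vspace_ofP[q eq].
  have hq : q \is (d - ninv e t).-homog.
    apply: (dhomog_quotient (inv_prod_neq0 e t) (inv_prod_homog e t)).
    by rewrite -eq subnKC // dhomog_is_dhomog.
  by exists (DHomog hq); rewrite ?memvf //; apply: val_inj.
apply/eqP; rewrite dimv_eq0 -subv0; apply/subvP => p /vspace_ofP[q eq].
rewrite memv0; apply/eqP/hom_inj; rewrite hom0 eq.
rewrite (@dhomog_quotient0 _ _ _ _ (inv_prod e t) q (inv_prod_neq0 e t) (inv_prod_homog e t) lt) ?mulr0 //.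
by rewrite -eq dhomog_is_dhomog.
Qed.

Lemma lead_space_sub e d t : (lead_space moment (spline_space e d) t <= inv_prod_mul e d t)%VS.
Proof.
apply/subvP => p /lead_spaceP[f [/spline_spaceP hf f0 <-]]; apply/vspace_ofP.
by apply: (spline_lead hf) => t' lt; rewrite /pval f0 // linear0.
Qed.

Definition tight e := forall d, \dim (spline_space e d) = (\sum_t inv_dim e d t)%N.

Lemma dim_spline_space_le e d : (\dim (spline_space e d) <= \sum_t inv_dim e d t)%N.
Proof.
rewrite (dim_lead_space moment); apply: leq_sum => t _; rewrite -dim_inv_prod_mul.
exact: dimvS (lead_space_sub e d t).
Qed.

(** A spline with the smallest leading value at t that the inversions allow. *)
Definition flow_up e t (f : T -> P) := [/\ spline e f, forall t', bef t' t -> f t' = 0,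
  f t = inv_prod e t & forall t', f t' \is (ninv e t).-homog].

(** If the sums agree then every space of leading values is as large as
    possible, and it contains [inv_prod e t] in degree [ninv e t]. *)
Lemma tight_flow_up e : tight e -> forall t, exists f, flow_up e t f.
Proof.
move=> te t; have := te (ninv e t); rewrite (dim_lead_space moment) => /eqP.
have le t' : true -> (\dim (lead_space moment (spline_space e (ninv e t)) t') <= inv_dim e (ninv e t) t'
     ?= iff (\dim (lead_space moment (spline_space e (ninv e t)) t') == inv_dim e (ninv e t) t'))%N.
  by move=> _; split=> //; rewrite -dim_inv_prod_mul; apply: dimvS (lead_space_sub e _ t').
rewrite (leqif_sum le) => /forall_inP /(_ t isT); rewrite -dim_inv_prod_mul => dimE.
have eqV : lead_space moment (spline_space e (ninv e t)) t = inv_prod_mul e (ninv e t) t.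
  by apply/eqP; rewrite eqEdim lead_space_sub (eqP dimE) leqnn.
have : DHomog (inv_prod_homog e t) \in inv_prod_mul e (ninv e t) t.
  by apply/vspace_ofP; exists 1; rewrite mulr1.
rewrite -eqV => /lead_spaceP[f [/spline_spaceP hf f0 ft]]; exists (pval f); split=> //.
- by move=> t' lt; rewrite /pval f0 // linear0.
- by rewrite /pval ft.
- exact: pval_homog.
Qed.

(** Multiplying the flow up family of t by homogeneous polynomials realizes all
    multiples of [inv_prod e t] as leading values. *)
Lemma flow_up_tight e : (forall t, exists f, flow_up e t f) -> tight e.
Proof.
move=> hf d; rewrite (dim_lead_space moment); apply: eq_bigr => t _; rewrite -dim_inv_prod_mul.
congr (\dim _); apply/eqP; rewrite eqEsubv lead_space_sub /=; apply/subvP => p /vspace_ofP[q eq].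
have [f [sf f0 ft hh]] := hf t.
have [le|lt] := leqP (ninv e t) d; last first.
  suff -> : p = 0 by rewrite mem0v.
  apply: hom_inj; rewrite hom0 eq.
  rewrite (@dhomog_quotient0 _ _ _ _ (inv_prod e t) q (inv_prod_neq0 e t) (inv_prod_homog e t) lt) ?mulr0 //.
  by rewrite -eq dhomog_is_dhomog.
have hq : q \is (d - ninv e t).-homog.
  apply: (dhomog_quotient (inv_prod_neq0 e t) (inv_prod_homog e t)).
  by rewrite -eq subnKC // dhomog_is_dhomog.
have hg t' : q * f t' \is d.-homog by rewrite -[in X in X.-homog](subnK le) dhomogM.
apply/lead_spaceP; exists (family_of hg); split.
- apply/spline_spaceP; apply: eq_spline (splineM q sf) => t'; rewrite pval_family_of //.
- by move=> t' lt; apply: hom_inj; rewrite ffunE /= f0 // mulr0.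
- by apply: hom_inj; rewrite ffunE /= ft eq mulrC.
Qed.

(** * The modular relation for splines *)

Section Modular.
Variables (u v : 'I_n).
Hypothesis uv : u != v.
Local Notation tau := (tperm u v).
Local Notation alpha := (xdiff F u v).

(** The transposition of u and v acting on the words and on the variables at the
    same time. *)
Definition swap_act (f : T -> P) t := rename tau (f (sw u v t)).

Lemma swapK t : sw u v (sw u v t) = t.
Proof. by apply: wd_inj => p; rewrite !wd_sw tpermK. Qed.

Lemma swapC i j t : sw i j t = sw j i t.
Proof. by apply: wd_inj => p; rewrite !wd_sw tpermC. Qed.

Lemma swap_conj p q t : sw (tau p) (tau q) (sw u v t) = sw u v (sw p q t).
Proof.
apply: wd_inj => x; rewrite !wd_sw; congr (wd t _).
by rewrite -[in LHS](tpermK u v x) -tpermJ permJ tpermK.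
Qed.

Lemma swap_act_alpha (f : T -> P) t : rename tau (alpha * f t) = - (alpha * rename tau (f t)).
Proof. by rewrite rmorphM /= rename_xdiff tpermL tpermR /xdiff; ring. Qed.

Lemma swap_actK f : swap_act (swap_act f) =1 f.
Proof.
move=> t; rewrite /swap_act swapK rename_comp rename_id // => x /=; exact: tpermK.
Qed.

Lemma swap_act_cond f p q : (forall t, on_diag p q (f t) = on_diag p q (f (sw p q t))) ->
  forall t, on_diag (tau p) (tau q) (swap_act f t) =
            on_diag (tau p) (tau q) (swap_act f (sw (tau p) (tau q) t)).
Proof.
move=> h t; rewrite /swap_act -!rename_on_diag; congr (rename _ _); rewrite h; congr (on_diag _ _ (f _)).
by rewrite -swap_conj !tpermK.
Qed.

Definition stable (e : rel 'I_n) :=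
  [/\ ssrbool.symmetric e, e u v & forall p q, e (tau p) (tau q) = e p q].

Lemma swap_act_spline e f : stable e -> spline e f -> spline e (swap_act f).
Proof.
move=> [_ _ st] hf p q t epq.
have := @swap_act_cond f (tau p) (tau q) _ t; rewrite !tpermK; apply=> t'.
by apply: hf; rewrite st.
Qed.

(** Because uv is an edge, f and its transform agree on x_u = x_v.  The quotient
    h of their difference by x_u - x_v inherits the conditions of f, since
    x_u - x_v does not vanish on the other hyperplanes. *)
Lemma swap_act_quotient e f : stable e -> spline e f ->
  exists h, [/\ spline e h, swap_act h =1 h & forall t, f t - swap_act f t = alpha * h t].
Proof.
move=> st hf; have [sy euv _] := st; have hs := swap_act_spline st hf.
have /fin_all_exists[h hE] t : exists q, f t - swap_act f t = alpha * q.
  by apply/on_diag_eq0P; rewrite on_diagB /swap_act on_diag_rename_tperm hf // subrr.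
have a0 : alpha != 0 by rewrite xdiff_neq0.
have hinv : swap_act h =1 h.
  move=> t; apply: (mulfI a0); apply: oppr_inj; rewrite {1}/swap_act -swap_act_alpha -hE -hE.
  by rewrite rmorphB /= -[rename _ (swap_act f _)]/(swap_act (swap_act f) t) swap_actK opprB.
exists h; split=> // p q t epq.
have [e1|ne1] := eqVneq (u, v) (p, q).
  case: e1 => <- <-; rewrite -[in LHS](hinv t) /swap_act on_diag_rename_tperm //.
have [e2|ne2] := eqVneq (u, v) (q, p).
  case: e2 => <- <-; apply/on_diag_swap; rewrite [sw v u t]swapC.
  by rewrite -[in LHS](hinv t) /swap_act on_diag_rename_tperm.
apply: (mulfI (on_diag_xdiff_neq0 F uv ne1 ne2)).
by rewrite -!on_diagM -!hE !on_diagB (hf _ _ t epq) (hs _ _ t epq).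
Qed.

Fact swap_act_homog d (f : U d) t : swap_act (pval f) t \is d.-homog.
Proof. by apply: dhomog_rename; apply: pval_homog. Qed.
Fact antisym_homog d (f : U d) t : pval f t - swap_act (pval f) t \is d.-homog.
Proof. by apply: rpredB; [apply: pval_homog | apply: swap_act_homog]. Qed.
Definition antisymU d (f : U d) : U d := family_of (antisym_homog f).
Lemma pval_antisym d (f : U d) t : pval (antisymU f) t = pval f t - swap_act (pval f) t.
Proof. by rewrite pval_family_of. Qed.

Fact antisym_linear d : linear (@antisymU d).
Proof.
move=> a f g; apply: pvalP => t; rewrite pval_lin !pval_antisym /swap_act !pval_lin linearP /= scalerBr.
ring.
Qed.
HB.instance Definition _ d := GRing.isLinear.Build F (U d) (U d) *:%R (@antisymU d) (@antisym_linear d).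
Definition antisym d : 'End(U d) := linfun (@antisymU d).

Lemma antisymE d (f : U d) t : pval (antisym d f) t = pval f t - swap_act (pval f) t.
Proof. by rewrite lfunE /= pval_antisym. Qed.

Lemma ker_antisymP d (f : U d) : reflect (swap_act (pval f) =1 pval f) (f \in lker (antisym d)).
Proof.
rewrite memv_ker; apply: (iffP eqP) => [h t|h].
  have := antisymE f t; rewrite h pval0 => /esym/eqP; rewrite subr_eq0 => /eqP ->.
  by [].
by apply: pvalP => t; rewrite antisymE pval0 h subrr.
Qed.

Definition dim_sym e d := \dim (spline_space e d :&: lker (antisym d)).
Definition dim_antisym e d := \dim (antisym d @: spline_space e d).

Lemma dim_sym_antisym e d : \dim (spline_space e d) = (dim_sym e d + dim_antisym e d)%N.
Proof. by rewrite -(limg_ker_dim (antisym d)). Qed.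

Variable i : 'I_n.
Hypotheses (iu : i != u) (iv : i != v).
Local Notation y := (xdiff F u i).

(** Multiplication by x_u - x_i provides a preimage of (x_u - x_v) f under the
    antisymmetrization, for f invariant. *)
Lemma swap_act_y f t : swap_act f =1 f -> y * f t - swap_act (fun t => y * f t) t = alpha * f t.
Proof.
move=> h; rewrite /swap_act rmorphM /= rename_xdiff tpermL tpermD 1?eq_sym //.
by rewrite -[rename _ (f _)]/(swap_act f t) h /xdiff; ring.
Qed.

Lemma mul_homog1 d (a : P) (f : U d) t : a \is 1.-homog -> a * pval f t \is d.+1.-homog.
Proof. by move=> ha; rewrite -[d.+1]add1n dhomogM // pval_homog. Qed.

(** For a stable graph the antisymmetrized splines are exactly x_u - x_v times the
    invariant splines of one degree less. *)
Lemma dim_antisymS e d : stable e -> dim_antisym e d.+1 = dim_sym e d.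
Proof.
move=> st; apply/esym.
have hm (f : U d) t : alpha * pval f t \is d.+1.-homog by apply: mul_homog1; apply: dhomog_xdiff.
have hy (f : U d) t : y * pval f t \is d.+1.-homog by apply: mul_homog1; apply: dhomog_xdiff.
have a0 : alpha != 0 by rewrite xdiff_neq0.
apply: (@dim_eq_map _ _ _ _ _ (fun f => family_of (hm f))).
- move=> a f g; apply: pvalP => t.
  have -> := pval_lin a (family_of (hm f)) (family_of (hm g)) t.
  rewrite (pval_family_of (hm (a *: f + g))) (pval_family_of (hm f)) (pval_family_of (hm g)).
  have -> : pval (a *: f + g) t = a *: pval f t + pval g t by exact: pval_lin.
  by rewrite mulrDr scalerAr.
- move=> f; rewrite memv_cap => /andP[/spline_spaceP hf /ker_antisymP hs].
  apply/memv_imgP; exists (family_of (hy f)).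
    by apply/spline_spaceP; apply: eq_spline (splineM y hf) => t; rewrite pval_family_of.
  apply: pvalP => t; rewrite antisymE !pval_family_of -(swap_act_y _ hs); congr (_ - _).
  by rewrite /swap_act pval_family_of.
- move=> f _ h; apply: pvalP => t; apply: (mulfI a0); rewrite pval0 mulr0.
  by rewrite -(pval_family_of (hm f)) h pval0.
move=> g /memv_imgP[f /spline_spaceP /(swap_act_quotient st)[h [sh hi hE]] ->].
have hh t : h t \is d.-homog.
  apply: (dhomog_quotient a0 (dhomog_xdiff F u v)).
  by rewrite -hE add1n -antisymE; apply: pval_homog.
exists (family_of hh); last by apply: pvalP => t; rewrite antisymE hE !pval_family_of.
rewrite memv_cap; apply/andP; split.
  by apply/spline_spaceP; apply: eq_spline sh => t; rewrite pval_family_of.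
by apply/ker_antisymP => t; rewrite pval_family_of -[RHS]hi /swap_act pval_family_of.
Qed.

Lemma dim_antisym0 e : stable e -> dim_antisym e 0 = 0%N.
Proof.
move=> st; apply/eqP; rewrite dimv_eq0 -subv0; apply/subvP => g.
move=> /memv_imgP[f /spline_spaceP /(swap_act_quotient st)[h [sh hi hE]] ->].
rewrite memv0; apply/eqP/pvalP => t; rewrite antisymE hE pval0.
have a0 : alpha != 0 by rewrite xdiff_neq0.
have hh : alpha * h t \is 0.-homog by rewrite -hE -antisymE pval_homog.
by rewrite (dhomog_quotient0 a0 (dhomog_xdiff F u v) _ hh) ?mulr0.
Qed.

Variables (e0 e1 e2 : rel 'I_n).
Hypotheses (st0 : stable e0) (st2 : stable e2) (sy1 : ssrbool.symmetric e1).
Hypothesis e01 : forall p q, e1 p q = e0 p q || ((p, q) == (u, i)) || ((p, q) == (i, u)).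
Hypothesis e12 : forall p q, e2 p q = e1 p q || ((p, q) == (v, i)) || ((p, q) == (i, v)).

Lemma sub01 f : spline e1 f -> spline e0 f.
Proof. by apply: sub_spline => p q h; rewrite e01 h. Qed.
Lemma sub12 f : spline e2 f -> spline e1 f.
Proof. by apply: sub_spline => p q h; rewrite e12 h. Qed.

(** An invariant family that satisfies the condition on ui also satisfies its
    transform, the condition on vi. *)
Lemma dim_sym12 d : dim_sym e1 d = dim_sym e2 d.
Proof.
rewrite /dim_sym; congr (\dim _); apply/vspaceP => f; rewrite !memv_cap.
case: ker_antisymP => [hs|]; rewrite ?andbF // !andbT.
apply/idP/idP => /spline_spaceP hf; apply/spline_spaceP; last exact: sub12.
have hui : e1 u i by rewrite e01 eqxx orbT.
have hc p q : e1 p q -> forall t, on_diag (tau p) (tau q) (pval f t) =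
            on_diag (tau p) (tau q) (pval f (sw (tau p) (tau q) t)).
  by move=> e1pq t; rewrite -!hs; apply: swap_act_cond => t'; apply: hf.
move=> p q t; rewrite e12 => /orP[/orP[|]|]; first exact: hf.
  by case/eqP => -> ->; have := hc _ _ hui t; rewrite tpermL tpermD // eq_sym.
case/eqP => -> ->; rewrite sy1 in hui; have := hc _ _ hui t.
by rewrite tpermL tpermD // eq_sym.
Qed.

(** The antisymmetrization of a spline for e0 is x_u - x_v times an invariant h,
    which is also the antisymmetrization of (x_u - x_i) h; the factor x_u - x_i
    makes this family a spline for e1. *)
Lemma dim_antisym01 d : dim_antisym e1 d = dim_antisym e0 d.
Proof.
apply/eqP; rewrite eqn_leq; apply/andP; split.
  apply/dimvS/limgS/subvP => f /spline_spaceP hf; apply/spline_spaceP; exact: sub01.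
case: d => [|d]; first by rewrite dim_antisym0.
apply: dimvS; apply/subvP => g /memv_imgP[f /spline_spaceP /(swap_act_quotient st0)[h [sh hi hE]] ->].
have a0 : alpha != 0 by rewrite xdiff_neq0.
have hh t : y * h t \is d.+1.-homog.
  rewrite -[d.+1]add1n; apply: dhomogM; first exact: dhomog_xdiff.
  apply: (dhomog_quotient a0 (dhomog_xdiff F u v)).
  by rewrite -hE add1n -antisymE; apply: pval_homog.
apply/memv_imgP; exists (family_of hh); last first.
  by apply: pvalP => t; rewrite !antisymE hE pval_family_of -(swap_act_y _ hi) /swap_act pval_family_of.
apply/spline_spaceP; apply: (@eq_spline _ (fun t => y * h t)) => [t|]; first by rewrite pval_family_of.
move=> p q t; rewrite e01 => /orP[/orP[hpq|]|].
- by rewrite !on_diagM (sh _ _ t hpq).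
- by case/eqP => -> ->; rewrite !on_diagM on_diag_xdiff !mul0r.
- by case/eqP => -> ->; apply/on_diag_swap; rewrite !on_diagM on_diag_xdiff !mul0r.
Qed.

(** Split each space into the invariants and the image of the
    antisymmetrization: the first parts agree for e1 and e2, the second for e1 and
    e0, and for the stable graphs e0 and e2 the second part in degree d + 1 is the
    first in degree d. *)
Lemma dim_modular d :
  (\dim (spline_space e1 d.+1) + \dim (spline_space e1 d) = \dim (spline_space e2 d.+1) + \dim (spline_space e0 d))%N.
Proof.
rewrite !dim_sym_antisym !dim_sym12 !dim_antisym01 !dim_antisymS //; lia.
Qed.

Lemma dim_modular0 : \dim (spline_space e1 0) = \dim (spline_space e2 0).
Proof. by rewrite !dim_sym_antisym dim_sym12 dim_antisym01 !dim_antisym0. Qed.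
End Modular.
End Splines.

(** * Inversions satisfy the modular relation *)

(** Here c and c' say whether a word and its transform have an inversion at the
    pair uv, and a, b whether the word has one at ui, vi; the three cases are those
    of [letters], with equal, increasing or decreasing letters at u and v. *)
Lemma two_letters (G : nat -> nat) (c c' a b : bool) :
    [\/ c = false /\ c' = false /\ a = b, [/\ c = true, c' = false & a <= b] |
       [/\ c = false, c' = true & b <= a]]%N ->
  (G (c + a) + G (c' + b) + (G (c + a).+1 + G (c' + b).+1) =
   G (c + a + b) + G (c' + b + a) + (G c.+1 + G c'.+1))%N.
Proof.
by case: a; case: b; case=> [[-> [-> e]]|[-> -> h]|[-> -> h]] //=;
  rewrite ?addn0 ?add0n ?addn1 ?add1n //; lia.
Qed.

Lemma two_letters0 (c c' a b : bool) :
    [\/ c = false /\ c' = false /\ a = b, [/\ c = true, c' = false & a <= b] |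
       [/\ c = false, c' = true & b <= a]]%N ->
  ((c + a == 0) + (c' + b == 0) = (c + a + b == 0) + (c' + b + a == 0) :> nat)%N.
Proof.
by case: a; case: b; case=> [[-> [-> e]]|[-> -> h]|[-> -> h]].
Qed.

Section ModularCount.
Variables (n' : nat) (F : fieldType).
Local Notation n := n'.+1.
Variables (T : finType) (wd : T -> 'I_n -> nat) (sw : 'I_n -> 'I_n -> T -> T).
Hypothesis wd_inj : forall t t', wd t =1 wd t' -> t = t'.
Hypothesis wd_sw : forall i j t p, wd (sw i j t) p = wd t (tperm i j p).
Local Notation inv := (ninv wd).
Local Notation ucnt := (inv_dim F wd).
Local Notation tight := (tight F wd sw).
Local Notation splv := (spline_space F sw).
Implicit Types e : rel 'I_n.

(** An inversion written symmetrically in the two positions, so that a sum over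
    ordered edges counts each inversion twice. *)
Definition disc t (p q : 'I_n) : bool :=
  (p < q)%N && (wd t p < wd t q)%N || (q < p)%N && (wd t q < wd t p)%N.
Definition dsum e t := (\sum_p \sum_q (e p q && disc t p q))%N.

Lemma discC t p q : disc t p q = disc t q p.
Proof. by rewrite /disc orbC. Qed.

Lemma dsum_inv e t : ssrbool.symmetric e -> dsum e t = (inv e t).*2.
Proof.
move=> sy.
have -> : inv e t = (\sum_(p : 'I_n) \sum_(q : 'I_n) [&& (p < q)%N, e p q & (wd t p < wd t q)%N])%N.
  rewrite pair_bigA /= /inv size_filter -sum1_count big_enum_cond /=.
  by rewrite [RHS]big_mkcond_idem //= big_mkcond /=; apply: eq_bigr => -[p q] _ /=; case: ifP.
rewrite -addnn {2}exchange_big /= -big_split; apply: eq_bigr => p _ /=.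
rewrite -big_split; apply: eq_bigr => q _ /=.
rewrite (sy q p) /disc; case: (e p q); rewrite ?andbF //=.
by case: (ltngtP p q) => //= _; rewrite ?addn0 ?orbF ?add0n.
Qed.

Lemma dsum_add e e' t a b : a != b -> ~~ e a b -> ~~ e b a ->
  (forall p q, e' p q = e p q || ((p, q) == (a, b)) || ((p, q) == (b, a))) ->
  dsum e' t = (dsum e t + (disc t a b).*2)%N.
Proof.
move=> ab n1 n2 h; rewrite /dsum !pair_bigA /=.
have ne : (a, b) != (b, a) by apply: contraNneq ab => -[->].
rewrite (bigD1 (a, b)) //= [X in (_ + X)%N](bigD1 (b, a)) 1?eq_sym //=.
rewrite [in RHS](bigD1 (a, b)) //= [X in ((_ + X) + _)%N](bigD1 (b, a)) 1?eq_sym //=.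
rewrite !h (negPf n1) (negPf n2) !eqxx !orbT /= [disc t b a]discC -addnn.
rewrite (eq_bigr (fun x : 'I_n * 'I_n => (e x.1 x.2 && disc t x.1 x.2 : nat))); first by lia.
by move=> [p q] /= /andP[/negPf x1 /negPf x2]; rewrite h x1 x2 !orbF.
Qed.

Section Uv.
Variables (u v i : 'I_n).
Hypothesis ord : (i < u < v)%N || (v < u < i)%N.
Hypothesis cons : forall p : 'I_n, p != u -> p != v -> (p < u)%N = (p < v)%N.
Variables (e0 e1 e2 : rel 'I_n).
Hypotheses (st0 : stable u v e0) (st2 : stable u v e2) (sy1 : ssrbool.symmetric e1).
Hypothesis n0 : ~~ e0 u i.
Hypothesis n1 : ~~ e1 v i.
Hypothesis e01 : forall p q, e1 p q = e0 p q || ((p, q) == (u, i)) || ((p, q) == (i, u)).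
Hypothesis e12 : forall p q, e2 p q = e1 p q || ((p, q) == (v, i)) || ((p, q) == (i, v)).
Local Notation tau := (tperm u v).

Let uv : u != v. Proof. by rewrite neq_ltn; case/orP: ord => /andP[a b]; rewrite ?a ?b ?orbT. Qed.
Let iu : i != u. Proof. by rewrite neq_ltn; case/orP: ord => /andP[a b]; rewrite ?a ?b ?orbT. Qed.
Let iv : i != v. Proof. rewrite neq_ltn; case/orP: ord => /andP[a b]; by rewrite ?(ltn_trans a b) ?orbT. Qed.

Let e00 : rel 'I_n := fun p q => [&& e0 p q, (p, q) != (u, v) & (p, q) != (v, u)].

Lemma ltn_tau (p q : 'I_n) : (p, q) != (u, v) -> (p, q) != (v, u) ->
  (tau p < tau q)%N = (p < q)%N.
Proof.
have cons' (p0 : 'I_n) : p0 != u -> p0 != v -> (u < p0)%N = (v < p0)%N.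
  by move=> a b; have := cons a b; move: a b; rewrite -!(inj_eq val_inj) /=; lia.
case: (tpermP u v p) => [->|->|/eqP pu /eqP pv]; case: (tpermP u v q) => [->|->|/eqP qu /eqP qv];
  rewrite ?eqxx ?ltnn //= => _ _; by [rewrite cons | rewrite -cons | rewrite cons' | rewrite -cons'].
Qed.

Lemma dsum_tau t : dsum e00 (sw u v t) = dsum e00 t.
Proof.
have [sy _ stt] := st0.
rewrite /dsum (reindex_inj (@perm_inj _ tau)) /=; apply: eq_bigr => p _.
rewrite (reindex_inj (@perm_inj _ tau)) /=; apply: eq_bigr => q _.
have eqp (a b : 'I_n) : ((tau p, tau q) == (a, b)) = ((p, q) == (tau a, tau b)).
  by rewrite !xpair_eqE -!(inj_eq (@perm_inj _ tau) p) -!(inj_eq (@perm_inj _ tau) q) !tpermK.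
rewrite /e00 stt !eqp tpermL tpermR.
case: (e0 p q) => //=; case: (eqVneq (p, q) (v, u)) => //= x1; first by rewrite !andbF.
case: (eqVneq (p, q) (u, v)) => //= x2.
have x1' : (q, p) != (u, v) by move: x1; rewrite !xpair_eqE andbC.
have x2' : (q, p) != (v, u) by move: x2; rewrite !xpair_eqE andbC.
by rewrite /disc !wd_sw !tpermK !ltn_tau.
Qed.

Let c t := disc t u v.
Let a t := disc t u i.
Let b t := disc t v i.
Let r t := inv e00 t.

Let sy0 : ssrbool.symmetric e0. Proof. by case: st0. Qed.
Let sy2 : ssrbool.symmetric e2. Proof. by case: st2. Qed.
Let sy00 : ssrbool.symmetric e00.
Proof. by move=> p q; rewrite /e00 sy0 andbCA !xpair_eqE [(q == u) && _]andbC [(q == v) && _]andbC; case: (e0 q p) => //=; rewrite andbC. Qed.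

Lemma inv0 t : inv e0 t = (r t + c t)%N.
Proof.
apply: double_inj; rewrite doubleD -!dsum_inv //; apply: dsum_add => //.
- by rewrite /e00 eqxx /= andbF.
- by rewrite /e00 eqxx /= !andbF.
have [s0 euv _] := st0.
move=> p q; rewrite /e00; case: eqP => [[-> ->]|]; first by rewrite euv orbT.
case: eqP => [[-> ->]|]; first by rewrite s0 euv orbT.
by rewrite !andbT !orbF.
Qed.

Lemma inv1 t : inv e1 t = (r t + c t + a t)%N.
Proof.
rewrite -inv0; apply: double_inj; rewrite doubleD -!dsum_inv //; apply: dsum_add => //.
  by rewrite eq_sym.
by rewrite sy0.
Qed.

Lemma inv2 t : inv e2 t = (r t + c t + a t + b t)%N.
Proof.
rewrite -inv1; apply: double_inj; rewrite doubleD -!dsum_inv //; apply: dsum_add => //.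
  by rewrite eq_sym.
by rewrite sy1.
Qed.

Let r_sw t : r (sw u v t) = r t.
Proof. by apply: double_inj; rewrite -!dsum_inv // dsum_tau. Qed.
Let a_sw t : a (sw u v t) = b t.
Proof.
rewrite /a /b /disc !wd_sw tpermL tpermD 1?eq_sym // (cons iu iv).
by have -> : (u < i)%N = (v < i)%N by move: ord (cons iu iv); lia.
Qed.
Let b_sw t : b (sw u v t) = a t.
Proof. by rewrite -a_sw (swapK wd_inj wd_sw). Qed.

(** If w_u < w_v then, with u and v on the same side of i, an inversion with i at
    one of them forces the inversion at the other. *)
Lemma letters t : [\/ c t = false /\ c (sw u v t) = false /\ a t = b t,
   [/\ c t = true, c (sw u v t) = false & (a t <= b t)%N] |
   [/\ c t = false, c (sw u v t) = true & (b t <= a t)%N] ].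
Proof.
rewrite /a /b /c /disc !wd_sw tpermL tpermR.
have : (v < i)%N = (u < i)%N by move: ord; lia.
have : (i < v)%N = (i < u)%N by move: ord; lia.
move=> -> ->.
have le (x y z w : nat) : (x <= y)%N -> (z <= w)%N -> ((y < z)%N <= (x < w)%N)%N.
  by move=> xy zw; case: (ltnP y z) => // yz; rewrite (leq_ltn_trans xy (leq_trans yz zw)).
case/orP: ord => /andP[o1 o2].
  rewrite o1 o2 [(u < i)%N]ltnNge (ltnW o1) [(v < u)%N]ltnNge (ltnW o2) /= !orbF.
  by case: (ltngtP (wd t u) (wd t v)) => w; [constructor 2 | constructor 3 | constructor 1];
    rewrite ?w; split; rewrite ?le // ltnW.
rewrite o1 o2 [(i < u)%N]ltnNge (ltnW o2) [(u < v)%N]ltnNge (ltnW o1) /= !orbF.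
by case: (ltngtP (wd t u) (wd t v)) => w; [constructor 3 | constructor 2 | constructor 1];
  rewrite ?w; split; rewrite ?le // ltnW.
Qed.

Let g k d := if (k <= d)%N then dim_homog n' F (d - k) else 0%N.

(** Averaging over the pairs formed by a word and its transform. *)
Lemma sum_pair (f f' : T -> nat) :
  (forall t, f t + f (sw u v t) = f' t + f' (sw u v t))%N -> (\sum_t f t = \sum_t f' t)%N.
Proof.
move=> h; apply: double_inj; rewrite -!addnn.
have re (k : T -> nat) : (\sum_t k t = \sum_t k (sw u v t))%N.
  by rewrite (reindex_inj (can_inj (@swapK _ _ _ _ wd_inj wd_sw u v))).
by rewrite {2}(re f) {2}(re f') -!big_split; apply: eq_bigr => t _; apply: h.
Qed.

Lemma inv_dim_modular d :
  (\sum_t ucnt e1 d.+1 t + \sum_t ucnt e1 d t = \sum_t ucnt e2 d.+1 t + \sum_t ucnt e0 d t)%N.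
Proof.
rewrite -!big_split; apply: sum_pair => t /=.
rewrite addnACA [RHS]addnACA.
have := two_letters (fun k => g (r t + k)%N d.+1) (letters t).
have uE e x : ucnt e d.+1 x = g (inv e x) d.+1 by [].
have uS e x : ucnt e d x = g (inv e x).+1 d.+1 by [].
by rewrite !uE !uS !inv0 !inv1 !inv2 r_sw a_sw b_sw !addnS -!addnA.
Qed.

Lemma inv_dim_modular0 : (\sum_t ucnt e1 0 t = \sum_t ucnt e2 0 t)%N.
Proof.
apply: sum_pair => t /=; have := two_letters0 (letters t).
have uE e x : ucnt e 0 x = ((inv e x == 0) * dim_homog n' F 0)%N.
  by rewrite /ucnt leqn0; case: eqP => [->|]; rewrite ?mul1n ?mul0n.
rewrite !uE -!mulnDl !inv1 !inv2 r_sw a_sw b_sw !addn_eq0.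
by case: (r t == 0) => //= ->.
Qed.

(** The relation is an equality for the true dimensions and for the upper bounds.
    If e1 attains its bound, so does the sum for e0 and e2, hence each of them. *)
Lemma tight_up : tight e1 -> tight e2.
Proof.
move=> t1 d; have le2 := dim_spline_space_le F wd_sw e2; have le0 := dim_spline_space_le F wd_sw e0.
case: d => [|d].
  by rewrite -(dim_modular0 F wd_inj wd_sw uv iu iv st0 st2 sy1 e01 e12) t1 inv_dim_modular0.
have := dim_modular F wd_inj wd_sw uv iu iv st0 st2 sy1 e01 e12 d.
rewrite !t1 inv_dim_modular; move: (le2 d.+1) (le0 d); lia.
Qed.

Lemma tight_mid : tight e0 -> tight e2 -> tight e1.
Proof.
move=> t0 t2 d; have le1 := dim_spline_space_le F wd_sw e1.
case: d => [|d].
  by rewrite (dim_modular0 F wd_inj wd_sw uv iu iv st0 st2 sy1 e01 e12) t2 inv_dim_modular0.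
have := dim_modular F wd_inj wd_sw uv iu iv st0 st2 sy1 e01 e12 d.
rewrite !t0 !t2 -inv_dim_modular; move: (le1 d.+1) (le1 d); lia.
Qed.
End Uv.
End ModularCount.

(** * Dyck graphs are tight *)

Definition update (h : nat -> nat) i x j := if j == i then x else h j.
(** The height function of a Dyck path; i < j are adjacent when j < h i. *)
Definition dyck n (h : nat -> nat) :=
  (forall i, i < n -> i < h i <= n)%N /\
  (forall i j, i <= j -> j < n -> h i <= h j)%N.
Definition dyck_adj (h : nat -> nat) (p q : nat) := ((p < q < h p) || (q < p < h q))%N.
Definition dyck_rel n (h : nat -> nat) : rel 'I_n := fun p q => dyck_adj h p q.
Arguments dyck_rel : clear implicits.

Lemma dyck_rel_sym n h : ssrbool.symmetric (dyck_rel n h).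
Proof. by move=> p q; rewrite /dyck_rel /dyck_adj orbC. Qed.

Lemma dyck_adj_row (h : nat -> nat) i v p q : h i = v.+1 -> (i < v)%N ->
  dyck_adj h p q = dyck_adj (update h i v) p q || ((p == v) && (q == i)) || ((p == i) && (q == v)).
Proof.
move=> hi lt; rewrite /dyck_adj /update.
case: (eqVneq p i) => [->|pi]; case: (eqVneq q i) => [->|qi]; rewrite ?hi; lia.
Qed.

Lemma sum_update (w h : nat -> nat) n i x : (i < n)%N ->
  (\sum_(j < n) w j * update h i x j + w i * h i = \sum_(j < n) w j * h j + w i * x)%N.
Proof.
move=> lt; rewrite (bigD1 (Ordinal lt)) //= [in RHS](bigD1 (Ordinal lt)) //= {1}/update eqxx.
rewrite (eq_bigr (fun j : 'I_n => w j * h j)%N); first by lia.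
by move=> j; rewrite -val_eqE /= /update => /negPf ->.
Qed.

Section Dyck.
Variables (n' : nat) (F : fieldType).
Local Notation n := n'.+1.
Variables (T : finType) (wd : T -> 'I_n -> nat) (sw : 'I_n -> 'I_n -> T -> T).
Hypothesis wd_inj : forall t t', wd t =1 wd t' -> t = t'.
Hypothesis wd_sw : forall i j t p, wd (sw i j t) p = wd t (tperm i j p).
Local Notation tight := (tight F wd sw).
Local Notation eh := (dyck_rel n).

Lemma dyck_relE h p q : eh h p q = dyck_adj h p q. Proof. by []. Qed.

Lemma stable_twins (u v : 'I_n) (e : rel 'I_n) : ssrbool.symmetric e -> e u v ->
  e u u = e v v -> (forall p, p != u -> p != v -> e u p = e v p) -> stable u v e.
Proof.
move=> sy euv ee tw; split=> // p q.
case: (tpermP u v p) => [->|->|/eqP pu /eqP pv]; case: (tpermP u v q) => [->|->|/eqP qu /eqP qv];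
  rewrite ?ee //; try exact: sy; try by rewrite tw.
- by rewrite ![e p _]sy tw.
- by rewrite ![e p _]sy tw.
Qed.

Lemma ord_pair (p q a b : 'I_n) : ((p, q) == (a, b)) = (p == a :> nat) && (q == b :> nat).
Proof. by []. Qed.

(** Vertices u and v = u + 1 are twins in the graph of h and also after removing
    both edges to i; the graph of the path with the corner (i, v) removed lies
    between the two. *)
Lemma tight_row (h : nat -> nat) (i u v : 'I_n) : (i < u)%N -> v = u.+1 :> nat -> h i = v.+1 ->
  (forall q : 'I_n, h q <> v) -> h u = h v -> (v < h v)%N ->
  tight (eh (update h i v)) -> tight (eh h).
Proof.
move=> iu vu hi hq huv hv t1.
pose e0 : rel 'I_n := fun p q => [&& eh (update h i v) p q, (p, q) != (u, i) & (p, q) != (i, u)].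
have e12 p q : eh h p q = eh (update h i v) p q || ((p, q) == (v, i)) || ((p, q) == (i, v)).
  by rewrite !dyck_relE !ord_pair; apply: dyck_adj_row => //; lia.
have eui : eh (update h i v) u i.
  by rewrite !dyck_relE /dyck_adj /update eqxx; lia.
have sy0 : ssrbool.symmetric e0.
  by move=> p q; rewrite /e0 dyck_rel_sym !ord_pair; case: (eh _ q p) => //=; lia.
have st2 : stable u v (eh h).
  apply: stable_twins; first exact: dyck_rel_sym.
  - by rewrite !dyck_relE /dyck_adj huv; lia.
  - by rewrite !dyck_relE /dyck_adj; lia.
  move=> p; rewrite -!val_eqE /= => pu pv; rewrite !dyck_relE /dyck_adj huv.
  by have := hq p; lia.
have nu : (update h i v u) = h u by rewrite /update; case: eqP => //; lia.
have nv : (update h i v v) = h v by rewrite /update; case: eqP => //; lia.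
have st0 : stable u v e0.
  apply: stable_twins => //.
  - by rewrite /e0 !dyck_relE /dyck_adj !ord_pair nu; lia.
  - by rewrite /e0 !dyck_relE /dyck_adj !ord_pair nu nv; lia.
  move=> p; rewrite -!val_eqE /= => pu pv; rewrite /e0 !dyck_relE /dyck_adj !ord_pair nu nv.
  rewrite huv /update; have := hq p; case: eqP => [->|pi]; lia.
apply: (@tight_up _ F _ _ _ wd_inj wd_sw u v i _ _ e0 (eh (update h i v)) (eh h)) => //.
- by lia.
- by move=> p; rewrite -!val_eqE /=; lia.
- exact: dyck_rel_sym.
- by rewrite /e0 eqxx andbF.
- by rewrite !dyck_relE /dyck_adj /update eqxx; lia.
move=> p q; rewrite /e0; case: eqP => [[-> ->]|_]; first by rewrite eui orbT.
case: eqP => [[-> ->]|_]; first by rewrite dyck_rel_sym eui orbT.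
by rewrite !andbT !orbF.
Qed.

(** Here the graph of h is the middle one of the three: the path has a step between
    the rows v and u = v + 1, and filling it or cutting it makes them twins. *)
Lemma tight_col (h : nat -> nat) (k u v : 'I_n) : v.+1 = u :> nat -> h v = k -> h u = k.+1 -> (u < k)%N ->
  (forall q : 'I_n, h q <> u) ->
  tight (eh (update h u k)) -> tight (eh (update h v k.+1)) -> tight (eh h).
Proof.
move=> vu hv hu uk hq t0 t2.
have e01 p q : eh h p q = eh (update h u k) p q || ((p, q) == (u, k)) || ((p, q) == (k, u)).
  by rewrite !dyck_relE !ord_pair orbAC; apply: dyck_adj_row.
have e12 p q : eh (update h v k.+1) p q = eh h p q || ((p, q) == (v, k)) || ((p, q) == (k, v)).
  rewrite !dyck_relE !ord_pair orbAC (@dyck_adj_row (update h v k.+1) v k); first last.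
  - by lia.
  - by rewrite /update eqxx.
  congr (_ || _ || _); rewrite /dyck_adj /update.
  by case: (eqVneq (p : nat) v) => [->|_]; case: (eqVneq (q : nat) v) => [->|_]; rewrite ?hv.
have st0 : stable u v (eh (update h u k)).
  apply: stable_twins; first exact: dyck_rel_sym.
  - rewrite !dyck_relE /dyck_adj /update eqxx; have -> : (v == u :> nat) = false by lia.
    by rewrite hv; lia.
  - by rewrite !dyck_relE /dyck_adj; lia.
  move=> p; rewrite -!val_eqE /= => pu pv; rewrite !dyck_relE /dyck_adj /update (negPf pu) eqxx.
  have -> : (v == u :> nat) = false by lia.
  by have := hq p; lia.
have st2 : stable u v (eh (update h v k.+1)).
  apply: stable_twins; first exact: dyck_rel_sym.
  - by rewrite !dyck_relE /dyck_adj /update eqxx; case: eqP => [|_]; lia.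
  - by rewrite !dyck_relE /dyck_adj; lia.
  move=> p; rewrite -!val_eqE /= => pu pv; rewrite !dyck_relE /dyck_adj /update (negPf pv) eqxx.
  have -> : (u == v :> nat) = false by lia.
  by have := hq p; lia.
apply: (@tight_mid _ F _ _ _ wd_inj wd_sw u v k _ _ (eh (update h u k)) (eh h) (eh (update h v k.+1))) => //.
- by lia.
- by move=> p; rewrite -!val_eqE /=; lia.
- exact: dyck_rel_sym.
- by rewrite !dyck_relE /dyck_adj /update eqxx; case: eqP => [|_]; lia.
- by rewrite !dyck_relE /dyck_adj hv; lia.
Qed.

Section Base.
Variable h : nat -> nat.
Hypothesis hp : forall i, (i < n)%N -> (h i <= i.+2)%N.
Variable t : T.

(** Between c and c + 1 either there is no edge or t has an inversion. *)
Definition is_cut (c : 'I_n) := [forall j : 'I_n,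
  (j == c.+1 :> nat) ==> ~~ (eh h c j && (wd t j <= wd t c)%N)].
Definition pre_letters (v : T) (c : 'I_n) := [seq wd v p | p : 'I_n <- enum 'I_n & (p <= c)%N].
(** The words obtained from t by permuting letters between consecutive cuts. *)
Definition same_pieces (v : T) := [forall c : 'I_n, is_cut c ==> perm_eq (pre_letters v c) (pre_letters t c)].

Lemma count_pre_letters v c x :
  count_mem x (pre_letters v c) = #|[pred q : 'I_n | (q <= c)%N && (wd v q == x)]|.
Proof.
rewrite count_map count_filter -sum1_card -sum1_count big_enum_cond /=.
by apply: eq_bigl => q; rewrite !inE andbC.
Qed.

Lemma pre_letters_swap (i j c : 'I_n) v : j = i.+1 :> nat -> c != i ->
  perm_eq (pre_letters (sw i j v) c) (pre_letters v c).
Proof.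
rewrite -val_eqE /= => ji ci; rewrite /pre_letters (eq_map (wd_sw i j v)) map_comp; apply: perm_map.
have us : uniq [seq p : 'I_n <- enum 'I_n | (p <= c)%N] by rewrite filter_uniq ?enum_uniq.
apply: uniq_perm => // [|x]; first by rewrite map_inj_uniq //; apply: perm_inj.
have mS y : (y \in [seq p : 'I_n <- enum 'I_n | (p <= c)%N]) = (y <= c)%N.
  by rewrite mem_filter mem_enum andbT.
have tc (y : 'I_n) : (y <= c)%N -> (tperm i j y <= c)%N by case: tpermP => [->|->|]; lia.
apply/mapP/idP => [[y]|]; rewrite mS => h1; first by move=> ->; rewrite mS tc.
by exists (tperm i j x); rewrite ?tpermK ?mS ?tc.
Qed.

Lemma same_pieces_swap (i j : 'I_n) v : j = i.+1 :> nat -> ~~ is_cut i -> same_pieces (sw i j v) = same_pieces v.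
Proof.
move=> ji ci; apply: eq_forallb => c; case cc: (is_cut c) => //=.
have ne : c != i by apply: contraNneq ci => <-; rewrite cc.
by have /permPl := pre_letters_swap v ji ne; apply.
Qed.

(** If p is a maximum of a on the piece from p to c, then the larger letter of b at p
    occurs in a only before p, where a and b agree; so it is more frequent in b. *)
Lemma lt_first a b (p c : 'I_n) : (p <= c)%N ->
    (forall q : 'I_n, (q < p)%N -> wd a q = wd b q) ->
    (forall q : 'I_n, (p <= q <= c)%N -> (wd a q <= wd a p)%N) ->
    (wd a p < wd b p)%N -> ~~ perm_eq (pre_letters a c) (pre_letters b c).
Proof.
move=> pc lo hi lt; apply/negP => /seq.permP /(_ (pred1 (wd b p))).
rewrite !count_pre_letters => e; have := ltnn #|[pred q : 'I_n | (q <= c)%N && (wd a q == wd b p)]|.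
rewrite {2}e proper_card //; apply/properP; split.
  apply/subsetP => q; rewrite !inE => /andP[qc /eqP aq]; rewrite qc /=.
  have [qp|pq] := ltnP q p; first by rewrite -(lo q qp) aq.
  by have := hi q; rewrite pq qc aq => /(_ isT); rewrite leqNgt lt.
by exists p; rewrite !inE ?pc ?eqxx // ltn_eqF // andbF.
Qed.

Lemma sorted_noncut (w : 'I_n -> nat) (p c : 'I_n) :
    (forall i j : 'I_n, (p <= i < c)%N -> j = i.+1 :> nat -> (w j <= w i)%N) ->
  forall q : 'I_n, (p <= q <= c)%N -> (w q <= w p)%N.
Proof.
move=> h1 [q lq] /=; elim: q lq => [|q IH] lq /andP[pq qc].
  by suff -> : Ordinal lq = p by []; apply: val_inj => /=; lia.
have lq' : (q < n)%N by lia.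
have [e|ne] := eqVneq (q.+1) (p : nat).
  by suff -> : Ordinal lq = p by []; apply: val_inj.
apply: leq_trans (IH lq' _); last by lia.
by apply: h1 => //=; lia.
Qed.

(** Inside a piece t decreases weakly, so it is the only decreasing word with the
    same letters in each piece. *)
Lemma same_pieces_sorted v : same_pieces v ->
  (forall i j : 'I_n, j = i.+1 :> nat -> ~~ is_cut i -> (wd v j <= wd v i)%N) -> v = t.
Proof.
move=> /forall_inP hC hv; apply: wd_inj => -[p lp].
elim: p {-2}p (leqnn p) lp => [|m IH] p pm lp.
all: set P := Ordinal lp.
all: have lo : forall q : 'I_n, (q < P)%N -> wd v q = wd t q
  by move=> [q lq] /= qp; (have : (q <= p.-1)%N by lia); try (by lia); move=> qm; apply: IH; lia.
all: have [c /andP[pc cc] cmin] := @arg_minnP _ (ord_max : 'I_n)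
        (fun c : 'I_n => (p <= c)%N && is_cut c) (@nat_of_ord n) ltac:(
        rewrite /= -ltnS lp /=; apply/forall_inP => j /eqP /= jn; have := ltn_ord j; by rewrite jn ltnn).
all: have nc : forall i : 'I_n, (p <= i < c)%N -> ~~ is_cut i
  by move=> i /andP[pi ic]; apply: contraL ic => ci; rewrite -leqNgt cmin // pi ci.
all: have dv : forall i j : 'I_n, (P <= i < c)%N -> j = i.+1 :> nat -> (wd v j <= wd v i)%N
  by move=> i j /nc ci ji; apply: hv.
all: have dt : forall i j : 'I_n, (P <= i < c)%N -> j = i.+1 :> nat -> (wd t j <= wd t i)%N
  by move=> i j /nc; rewrite negb_forall_in => /exists_inP[j' /eqP e /negPn /andP[_ le]] ji;
     suff -> : j = j' by []; apply: val_inj; rewrite /= ji e.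
all: have pe := hC c cc.
all: case: (ltngtP (wd v P) (wd t P)) => // lt; exfalso.
all: try by have := @lt_first v t P c pc lo (sorted_noncut dv) lt; rewrite pe.
all: by have := @lt_first t v P c pc (fun q h => esym (lo q h)) (sorted_noncut dt) lt;
     rewrite perm_sym pe.
Qed.

(** Sorting a word of the class by undoing inversions inside the pieces lowers the
    moment until t is reached; so t comes first in its class. *)
Lemma same_pieces_moment v : same_pieces v -> (moment wd t <= moment wd v)%N /\ ((moment wd v <= moment wd t)%N -> v = t).
Proof.
have [m] := ubnP (moment wd v); elim: m v => // m IH v; rewrite ltnS => le hv.
have [ex|nex] := boolP [exists i : 'I_n, exists j : 'I_n,
   [&& j == i.+1 :> nat, ~~ is_cut i & (wd v i < wd v j)%N]].
  have [i /existsP[j /and3P[/eqP ji ci lt]]] := existsP ex.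
  have ij : (i < j)%N by rewrite ji.
  have kl := moment_swap wd_sw ij lt.
  have [|h1 _] := IH (sw i j v) (leq_trans kl le); first by rewrite same_pieces_swap.
  by split; [lia | move=> h2; exfalso; lia].
have -> : v = t; last by [].
apply: same_pieces_sorted => // i j ji ci; rewrite leqNgt; apply: contra nex => lt.
by apply/existsP; exists i; apply/existsP; exists j; rewrite ji eqxx ci lt.
Qed.

Lemma same_pieces_refl : same_pieces t.
Proof. by apply/forall_inP. Qed.

(** If h i <= i + 2 all edges join neighbours.  The family equal to [inv_prod] of
    t on the class of t and zero elsewhere is a spline: neighbours inside a piece
    stay in the class, and across a cut that is an edge the value vanishes on the
    hyperplane. *)
Lemma base_flow_up : exists f, flow_up wd sw (eh h) t (f : T -> {mpoly F[n]}).
Proof.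
pose f v : {mpoly F[n]} := if same_pieces v then inv_prod F wd (eh h) t else 0.
have step (i j : 'I_n) v : j = i.+1 :> nat -> eh h i j -> on_diag i j (f v) = on_diag i j (f (sw i j v)).
  move=> ji eij; have [ci|nci] := boolP (is_cut i); last by rewrite /f same_pieces_swap.
  have ph : on_diag i j (inv_prod F wd (eh h) t) = 0.
    have wij : (wd t i < wd t j)%N.
      by have := forall_inP ci j; rewrite ji eqxx eij /= -ltnNge; apply.
    apply/on_diag_eq0P; rewrite /inv_prod (big_rem (i, j)) /=; first by eexists.
    by rewrite mem_filter mem_enum /= eij wij ji leqnn.
  by rewrite /f; case: (same_pieces v); case: (same_pieces (sw i j v)); rewrite ?rmorph0 ?ph.
exists f; split.
- move=> i j v eij; move: (eij); rewrite !dyck_relE /dyck_adj => /orP[|] /andP[lt lt'].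
    by apply: step => //; have := hp (ltn_ord i); lia.
  apply/on_diag_swap; rewrite (swapC wd_inj wd_sw i j); apply: step; last by rewrite dyck_rel_sym.
  by have := hp (ltn_ord j); lia.
- move=> v bv; rewrite /f; case: ifP => // /same_pieces_moment[le eqv].
  case: (leqP (moment wd v) (moment wd t)) => [/eqv e|lt].
    by move: bv; rewrite e /before ltnn.
  by have := before_of_lt lt; rewrite /before => /(ltn_trans bv); rewrite ltnn.
- by rewrite /f same_pieces_refl.
- move=> v; rewrite /f; case: ifP => _; [exact: inv_prod_homog | exact: dhomog0].
Qed.
End Base.

Lemma dyck_update_dec h i : dyck n h -> (i < n)%N -> (i.+2 <= h i)%N ->
  (forall q, (q < i)%N -> (h q < h i)%N) -> dyck n (update h i (h i).-1).
Proof.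
move=> [d1 d2] ii hi hq; split=> [j jn|j k jk kn]; rewrite /update.
  by have := d1 j jn; case: eqP => [->|_]; lia.
case: (eqVneq j i) => [ej|nj]; case: (eqVneq k i) => [ek|nk] //; last exact: d2.
  by subst j; have := d2 i k jk kn; lia.
by subst k; have ji : (j < i)%N; [lia | have := hq j ji; lia].
Qed.

Lemma dyck_update_inc h i : dyck n h -> (i.+1 < n)%N -> (h i < h i.+1)%N ->
  dyck n (update h i (h i).+1).
Proof.
move=> [d1 d2] ii lt; split=> [j jn|j k jk kn]; rewrite /update.
  by have := d1 j jn; have := d1 i.+1 ii; case: eqP => [->|_]; lia.
case: (eqVneq j i) => [ej|nj]; case: (eqVneq k i) => [ek|nk] //; last exact: d2.
  by subst j; have ik : (i < k)%N; [lia | have := d2 i.+1 k ik kn; lia].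
by subst k; have := d2 j i jk kn; lia.
Qed.

Definition area (h : nat -> nat) := (\sum_(j < n) 1 * h j)%N.
Definition moment_area (h : nat -> nat) := (\sum_(j < n) j * h j)%N.
Definition area_bound := (n * (n * n))%N.
(** Lexicographic: fewer cells first, then cells moved to later rows. *)
Definition corner_measure h := (area h * area_bound.+1 + (area_bound - moment_area h))%N.

Lemma moment_area_le h : dyck n h -> (moment_area h <= area_bound)%N.
Proof.
move=> [d1 _]; rewrite /moment_area /area_bound -[X in (X * _)%N]card_ord -sum_nat_const.
by apply: leq_sum => j _; have := d1 j (ltn_ord j); have := ltn_ord j; nia.
Qed.

Lemma corner_measure_lt h h' : dyck n h -> dyck n h' ->
  (area h' < area h)%N || (area h' == area h) && (moment_area h < moment_area h')%N -> (corner_measure h' < corner_measure h)%N.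
Proof.
move=> /moment_area_le b1 /moment_area_le b2; rewrite /corner_measure => /orP[lt|/andP[/eqP -> lt]]; last by lia.
have : (area h' * area_bound.+1 + area_bound.+1 <= area h * area_bound.+1)%N by rewrite -mulSnr leq_mul2r lt orbT.
by lia.
Qed.

Lemma area_update h i x : (i < n)%N -> (area (update h i x) + h i = area h + x)%N.
Proof. by move=> lt; have := sum_update (fun=> 1%N) h x lt; rewrite !mul1n. Qed.

Lemma moment_area_update h i x : (i < n)%N -> (moment_area (update h i x) + i * h i = moment_area h + i * x)%N.
Proof. exact: sum_update id _ _ _ _. Qed.

(** Take a row i of height at least i + 3 and let b = h i - 1 be its last
    neighbour.  If the rows b - 1 and b have the same height, [tight_row] removes
    the corner (i, b).  If they differ by one, [tight_col] relates h to two paths for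
    which they have the same height.  Otherwise the row b is itself as high as
    required, and one continues from there. *)
Lemma tight_corner h : dyck n h ->
  (forall h', dyck n h' -> (corner_measure h' < corner_measure h)%N -> tight (eh h')) ->
  forall i, (i < n)%N -> (i.+3 <= h i)%N -> (forall q, (q < n)%N -> h q <> (h i).-1) ->
    (forall q, (q < i)%N -> (h q < h i)%N) -> tight (eh h).
Proof.
move=> dh IH i; have [m] := ubnP (n - i); elim: m i => // m IHm i lem ii hi hq hqi.
have [d1 d2] := dh; have [_ hin] := andP (d1 i ii).
have bn : ((h i).-1 < n)%N by lia.
have b1n : ((h i).-2 < n)%N by lia.
pose b := Ordinal bn; pose b1 := Ordinal b1n; pose I := Ordinal ii.
have hb1 : (h i <= h b1)%N.
  by have := d1 b1 b1n; have := hq b1 b1n; rewrite /=; lia.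
have hb : (h b1 <= h b)%N by apply: d2 => /=; lia.
have [_ hbn] := andP (d1 b bn).
(* equal heights: remove the corner (i, b) *)
have [e|ne] := eqVneq (h b1) (h b).
  apply: (@tight_row h I b1 b) => //=; try by lia.
  - by move=> q; apply: hq.
  - by rewrite -e; lia.
  apply: IH; first by apply: dyck_update_dec => //; lia.
  apply: corner_measure_lt => //; first by apply: dyck_update_dec => //; lia.
  by have := area_update h (h i).-1 ii; lia.
(* a jump of at least two: row b is high enough to go on *)
have [e1|ne1] := eqVneq (h b) (h b1).+1; last first.
  have hbb : (b.+3 <= h b)%N by move: ne ne1 hb hb1 => /=; lia.
  apply: (IHm b) => //; first by rewrite /=; lia.
    move=> q qn; have [qb|bq] := ltnP q b.
      have qb1 : (q <= b1)%N by move: qb => /=; lia.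
      by have := d2 q b1 qb1 b1n; lia.
    by have := d2 b q bq qn; lia.
  move=> q qb; have qb1 : (q <= b1)%N by move: qb => /=; lia.
  by have := d2 q b1 qb1 b1n; move: ne1 ne hb => /=; lia.
have kn : (h b1 < n)%N by lia.
pose k := Ordinal kn.
(* both paths of the modular relation have equal heights at b - 1 and b *)
have row h' : dyck n h' -> h' i = h i -> h' b1 = h' b -> (h i <= h' b)%N ->
    (forall q, (q < n)%N -> h' q <> (h i).-1) ->
    dyck n (update h' i (h i).-1) -> (corner_measure (update h' i (h i).-1) < corner_measure h)%N -> tight (eh h').
  move=> dh' e' eb lb hq' du lt.
  apply: (@tight_row h' I b1 b) => //=; try by lia.
  - by move=> q; apply: hq'.
  - by move: lb => /=; lia.
  - exact: IH.
have neb : (i == b :> nat) = false by apply/eqP => /=; lia.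
have neb1 : (i == b1 :> nat) = false by apply/eqP => /=; lia.
have neb1b : (b1 == b :> nat) = false by apply/eqP => /=; lia.
have nebb1 : (b == b1 :> nat) = false by apply/eqP => /=; lia.
have D0 : dyck n (update h b (h b1)).
  rewrite (_ : h b1 = (h b).-1); last by rewrite e1.
  apply: dyck_update_dec => //=; first by move: e1 hb1 => /=; lia.
  move=> q qb; have qb1 : (q <= b1)%N by rewrite /=; lia.
  by have := d2 q b1 qb1 b1n; move: e1 => /=; lia.
have D2 : dyck n (update h b1 (h b1).+1).
  have e2 : b1.+1 = b by rewrite /=; lia.
  by apply: dyck_update_inc => //; rewrite e2 // e1.
have T0 : tight (eh (update h b (h b1))).
  have u0 : update h b (h b1) i = h i by rewrite /update neb.
  apply: row => //.
  + by rewrite /update neb1b eqxx.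
  + by rewrite /update eqxx.
  + by move=> q qn; rewrite /update; case: eqP => _; [lia | apply: hq].
  + rewrite -u0; apply: dyck_update_dec => //; rewrite ?u0; try lia.
    by move=> q qi; rewrite ?u0 /update; case: eqP => [|_]; [rewrite /=; lia | apply: hqi].
  apply: corner_measure_lt => //.
    rewrite -u0; apply: dyck_update_dec => //; rewrite ?u0; try lia.
    by move=> q qi; rewrite ?u0 /update; case: eqP => [|_]; [rewrite /=; lia | apply: hqi].
  have := area_update (update h b (h b1)) (h i).-1 ii; rewrite u0.
  by have := area_update h (h b1) (ltn_ord b); lia.
have T2 : tight (eh (update h b1 (h b1).+1)).
  have u0 : update h b1 (h b1).+1 i = h i by rewrite /update neb1.
  apply: row => //.
  + by rewrite /update eqxx nebb1.
  + by rewrite /update nebb1; lia.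
  + by move=> q qn; rewrite /update; case: eqP => _; [lia | apply: hq].
  + rewrite -u0; apply: dyck_update_dec => //; rewrite ?u0; try lia.
    by move=> q qi; rewrite ?u0 /update; case: eqP => [|_]; [rewrite /=; lia | apply: hqi].
  apply: corner_measure_lt => //.
    rewrite -u0; apply: dyck_update_dec => //; rewrite ?u0; try lia.
    by move=> q qi; rewrite ?u0 /update; case: eqP => [|_]; [rewrite /=; lia | apply: hqi].
  have := area_update (update h b1 (h b1).+1) (h i).-1 ii; rewrite u0.
  have := area_update h (h b1).+1 (ltn_ord b1).
  have := moment_area_update (update h b1 (h b1).+1) (h i).-1 ii; rewrite u0.
  have := moment_area_update h (h b1).+1 (ltn_ord b1); rewrite mulnS.
  have -> : (i * h i = i + i * (h i).-1)%N by rewrite -mulnS prednK //; lia.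
  have b1E : b1 = (h i).-2 :> nat by [].
  by lia.
apply: (@tight_col h k b b1) => //.
- by rewrite /=; lia.
- by move: hb1 => /=; lia.
- by move=> q; apply: hq.
Qed.

Theorem dyck_tight h : dyck n h -> tight (eh h).
Proof.
have [m] := ubnP (corner_measure h); elim: m h => // m IH h lem dh.
have [ex|nex] := boolP [exists i : 'I_n, (i.+3 <= h i)%N]; last first.
  apply: flow_up_tight => // t; apply: base_flow_up => i ii.
  rewrite leqNgt; apply: contra nex => lt; apply/existsP; exists (Ordinal ii); exact: lt.
have [i hi imin] := arg_minnP (@nat_of_ord n) (xchooseP (existsP ex)).
have [d1 d2] := dh.
apply: (@tight_corner h dh _ i) => //.
- by move=> h' dh' lt; apply: IH => //; apply: leq_trans lt _.
- move=> q qn; have [qi|iq] := ltnP q i; last by have := d2 i q iq qn; lia.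
have := imin (Ordinal qn); rewrite /=; case: (leqP q.+3 (h q)) => [_ /(_ isT)|]; lia.
- move=> q qi; have qn : (q < n)%N := ltn_trans qi (ltn_ord i).
  have := imin (Ordinal qn); rewrite /=; case: (leqP q.+3 (h q)) => [_ /(_ isT)|]; lia.
Qed.
End Dyck.

(** * Marked corners *)

Section Marks.
Variables (n' : nat) (F : fieldType).
Local Notation n := n'.+1.
Local Notation P := {mpoly F[n]}.
Local Notation H d := (dhomog n F d).
Local Notation eh := (dyck_rel n).

(** Raising the path at a marked row i adds the single edge between i and h i. *)
Definition add_marks (h : nat -> nat) (R : pred nat) i := (h i + R i)%N.

(** For a polynomial without constant term this writes it in the ideal of the
    variables. *)
Lemma mpoly_split (q : P) : exists (c : F) (k : 'I_n -> P), q = c%:MP + \sum_i 'X_i * k i.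
Proof.
elim/mpoly_ring_ind: q => [c|i|p q [c [k ->]] [c' [k' ->]]|p q [c [k ->]] [c' [k' ->]]].
- by exists c, (fun=> 0); rewrite big1 ?addr0 // => i _; rewrite mulr0.
- exists 0, (fun j => (j == i)%:R); rewrite mpolyC0 add0r (bigD1 i) //= eqxx mulr1.
  by rewrite big1 ?addr0 // => j /negPf ->; rewrite mulr0.
- exists (c + c'), (fun i => k i + k' i); rewrite mpolyCD.
  have -> : \sum_i 'X_i * (k i + k' i) = \sum_i 'X_i * k i + \sum_i 'X_i * k' i :> P.
    by rewrite -big_split; apply: eq_bigr => i _; rewrite mulrDr.
  by ring.
exists (c * c'), (fun i => c%:MP * k' i + k i * (c'%:MP + \sum_j 'X_j * k' j)).
rewrite mpolyCM mulrDl mulrDr -addrA; congr (_ + _).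
rewrite mulr_sumr mulr_suml -big_split; apply: eq_bigr => i _ /=; ring.
Qed.

Variable h : nat -> nat.
Variable S : pred nat.
Hypothesis hS : forall R : pred nat, (forall i, R i -> S i) -> dyck n (add_marks h R).
Hypothesis Sn : forall i, S i -> (h i < n)%N.

Definition add_mark (p : nat) := add_marks h (pred1 p).

Lemma dyck_h : dyck n h.
Proof.
have [d1 d2] := @hS pred0 (fun i H => False_ind _ (notF H)).
split=> [i /d1|i j ij /(d2 _ _ ij)]; by rewrite /add_marks /= !addn0.
Qed.

Section WithT.
Variables (T : finType) (wd : T -> 'I_n -> nat) (sw : 'I_n -> 'I_n -> T -> T).
Hypothesis wd_inj : forall t t', wd t =1 wd t' -> t = t'.
Hypothesis wd_sw : forall i j t p, wd (sw i j t) p = wd t (tperm i j p).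
Local Notation inv := (ninv wd).
Local Notation splv := (spline_space F sw).
Local Notation spline := (spline sw).
Local Notation Phi := (inv_prod F wd).
Local Notation bef := (before (moment wd)).

Definition violated t : pred nat := fun i => S i &&
  [exists p : 'I_n, exists q : 'I_n, [&& p == i :> nat, q == h i :> nat & (wd t q <= wd t p)%N]].
Definition marks_strict t := [forall p : 'I_n, ~~ violated t p].

Lemma add_marks_edge (R : pred nat) (i j : 'I_n) : (forall p, R p -> S p) ->
  eh (add_marks h R) i j = [|| eh h i j, R i && (j == h i :> nat) | R j && (i == h j :> nat)].
Proof.
move=> RS; rewrite !dyck_relE /dyck_adj /add_marks; have [d1 _] := dyck_h.
have := d1 i (ltn_ord i); have := d1 j (ltn_ord j).
by case: (R i); case: (R j); lia.
Qed.

Lemma violated_marked t i : violated t i -> S i.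
Proof. by case/andP. Qed.

(** The edges of violated marks are not inversions of t, so adding them leaves the
    degree of the flow up family of t unchanged. *)
Lemma inversions_violated t : inversions wd (eh (add_marks h (violated t))) t = inversions wd (eh h) t.
Proof.
apply: eq_filter => -[i j] /=; rewrite add_marks_edge; last exact: violated_marked.
have [d1 _] := dyck_h.
case: (ltnP i j) => //= ij; case: (eh h i j) => //=.
have -> : (i == h j :> nat) = false by have := d1 j (ltn_ord j); lia.
rewrite andbF orbF; apply/negP => /andP[/andP[/andP[_ wi] /eqP jh] lt].
case/existsP: wi => p /existsP[q /and3P[/eqP/val_inj -> /eqP qh]].
suff -> : q = j by rewrite leqNgt lt.
by apply: val_inj; rewrite /= qh jh.
Qed.

(** The flow up family of each word is taken in the graph enlarged by the marks that
    the word violates, which is again a Dyck graph. *)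
Lemma exists_basis : exists fl : T -> T -> P, forall t,
  [/\ spline (eh (add_marks h (violated t))) (fl t), forall t', bef t' t -> fl t t' = 0,
      fl t t = Phi (eh h) t & forall t', fl t t' \is (inv (eh h) t).-homog].
Proof.
suff ex t : exists f : T -> P,
  [/\ spline (eh (add_marks h (violated t))) f, forall t', bef t' t -> f t' = 0,
      f t = Phi (eh h) t & forall t', f t' \is (inv (eh h) t).-homog].
  by have [fl hfl] := fin_all_exists ex; exists fl.
have /(tight_flow_up wd_sw)/(_ t)[f] := dyck_tight F wd_inj wd_sw (hS (@violated_marked t)).
by rewrite /flow_up /inv_prod /ninv inversions_violated => ?; exists f.
Qed.

Section Expansion.
Variable fl : T -> T -> P.
Hypothesis flP : forall t,
  [/\ spline (eh (add_marks h (violated t))) (fl t), forall t', bef t' t -> fl t t' = 0,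
      fl t t = Phi (eh h) t & forall t', fl t t' \is (inv (eh h) t).-homog].

(** Triangular elimination: a class Mo of families that is closed under
    subtracting multiples of [fl t], with leading coefficients in I, expands with all
    coefficients in I. *)
Lemma expansion (Mo : (T -> P) -> Prop) (I : T -> P -> Prop) :
    (forall f g q, Mo f -> Mo g -> Mo (fun t => f t - q * g t)) ->
    (forall f g, f =1 g -> Mo f -> Mo g) ->
    (forall t, I t 0) ->
    (forall f t, Mo f -> (forall t', bef t' t -> f t' = 0) ->
       exists2 q, I t q & f t = Phi (eh h) t * q) ->
    (forall t q, I t q -> Mo (fun t' => q * fl t t')) ->
  forall f, Mo f -> exists2 g, (forall t, I t (g t)) & forall t', f t' = \sum_t g t * fl t t'.
Proof.
move=> MoB Moe I0 Il Ifl.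
pose ord := scan (moment wd).
suff main k f : (k <= size ord)%N -> Mo f ->
    (forall t, (index t ord < size ord - k)%N -> f t = 0) ->
    exists2 g, (forall t, I t (g t)) & (forall t, (index t ord < size ord - k)%N -> g t = 0) /\
      forall t', f t' = \sum_t g t * fl t t'.
  move=> f Mf; have f00 t : (index t ord < size ord - size ord)%N -> f t = 0 by rewrite subnn.
  by have [g Ig [_ fE]] := main (size ord) f (leqnn _) Mf f00; exists g.
elim: k f => [|k IH] f ks Mf f0.
  exists (fun=> 0) => //; split=> // t'; rewrite big1 => [|t _]; last by rewrite mul0r.
  by rewrite f0 // subn0 index_mem mem_scan.
have lt : (size ord - k.+1 < size ord)%N by lia.
have t0 : T by move: lt; case: (ord).
pose t := nth t0 ord (size ord - k.+1).
have us : uniq ord by rewrite sort_uniq enum_uniq.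
have it : index t ord = (size ord - k.+1)%N by rewrite index_uniq.
have [|q Iq fq] := Il f t Mf; first by move=> t'; rewrite /before -/ord it; apply: f0.
have [_ fl0 flt _] := flP t.
have M1 : Mo (fun t' => f t' - 1 * (q * fl t t')) by apply: MoB (Ifl _ _ Iq).
have f1 t' : (index t' ord < size ord - k)%N -> f t' - 1 * (q * fl t t') = 0.
  move=> lt'; rewrite mul1r; have [e|ne] := eqVneq t' t.
    by rewrite e fq flt; ring.
  have lt1 : (index t' ord < size ord - k.+1)%N.
    have : index t' ord != index t ord.
      apply: contraNneq ne => e; have me : t' \in ord by exact: mem_scan.
      by rewrite -(nth_index t0 me) e it.
    by rewrite it; lia.
  by rewrite f0 // fl0 ?mulr0 ?subr0 // /before -/ord it.
have [g Ig [g0 fE]] := IH _ (ltnW ks) M1 f1.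
have gt : g t = 0 by apply: g0; rewrite it; lia.
exists (fun s => if s == t then q else g s).
  by move=> s; case: eqP => [->|].
split=> [s ls|t'].
  case: eqP => [e|_]; last by apply: g0; lia.
  by move: ls; rewrite e it ltnn.
rewrite (bigD1 t) //= eqxx.
have -> : f t' = q * fl t t' + (f t' - 1 * (q * fl t t')) by ring.
congr (_ + _); rewrite fE (bigD1 t) //= gt mul0r add0r.
by apply: eq_bigr => s /negPf ->.
Qed.

Lemma fl_spline t : spline (eh h) (fl t).
Proof.
have [sp _ _ _] := flP t; apply: sub_spline sp => i j e.
by rewrite add_marks_edge ?e //; apply: violated_marked.
Qed.

Lemma spline_sub e (f g : T -> P) q : spline e f -> spline e g -> spline e (fun t => f t - q * g t).
Proof.
by move=> sf sg i j t eij; rewrite !on_diagB !on_diagM (sf _ _ t eij) (sg _ _ t eij).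
Qed.

Lemma expand_all f : spline (eh h) f -> exists g, forall t', f t' = \sum_t g t * fl t t'.
Proof.
move=> sf; suff : exists2 g : T -> P, (forall t : T, True) &
    forall t', f t' = \sum_t g t * fl t t' by case=> g _ fE; exists g.
apply: (@expansion (spline (eh h)) (fun _ _ => True)) => //.
- by move=> *; apply: spline_sub.
- by move=> *; apply: eq_spline; eassumption.
- by move=> f' t sf' f0; have [q] := spline_lead wd_sw sf' f0; exists q.
- by move=> t q _; apply: splineM; apply: fl_spline.
Qed.

Lemma mcoeff0M (p q : P) : (p * q)@_0 = p@_0 * q@_0.
Proof. by case: (mcoeff0_is_multiplicative n F) => ->. Qed.

Lemma add_mark_edge (p i j : 'I_n) : S p ->
  eh (add_mark p) i j = [|| eh h i j, (i == p) && (j == h p :> nat) | (j == p) && (i == h p :> nat)].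
Proof.
move=> Sp; rewrite add_marks_edge /=; last by move=> ? /eqP ->.
congr [|| _, _ | _]; rewrite -val_eqE /=.
  by case: eqP => // ->.
by case: (eqVneq (j : nat) p) => // ->.
Qed.

Lemma mem_invs e t i j :
  ((i, j) \in inversions wd e t) = [&& (i < j)%N, e i j & (wd t i < wd t j)%N].
Proof. by rewrite mem_filter mem_enum andbT. Qed.

Lemma inv_prod_add_mark (p q : 'I_n) t : S p -> h p = q -> ~~ violated t p ->
  exists r, Phi (eh (add_mark p)) t = Phi (eh h) t * (xdiff F p q * r).
Proof.
move=> Sp hpq nw.
have lt : (wd t p < wd t q)%N.
  rewrite ltnNge; apply: contra nw => le; rewrite /violated Sp /=.
  by apply/existsP; exists p; apply/existsP; exists q; rewrite hpq !eqxx.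
have [d1 _] := dyck_h; have pq : (p < q)%N by have := d1 p (ltn_ord p); lia.
suff pe : perm_eq (inversions wd (eh (add_mark p)) t) ((p, q) :: inversions wd (eh h) t).
  by rewrite /inv_prod (perm_big _ pe) big_cons; exists 1; rewrite mulr1 mulrC.
have nin : (p, q) \notin inversions wd (eh h) t.
  by rewrite mem_filter /= dyck_relE /dyck_adj hpq; lia.
have u e : uniq (inversions wd e t) by rewrite filter_uniq ?enum_uniq.
apply: uniq_perm; [exact: u | by rewrite cons_uniq nin u | ].
move=> [i j]; rewrite in_cons !mem_invs add_mark_edge // hpq.
rewrite xpair_eqE; have [ip|ip] := eqVneq i p; have [jq|jq] := eqVneq j q => /=.
- by rewrite ip jq pq lt eqxx orbT.
- by rewrite -val_eqE /= in jq; rewrite (negPf jq) /=; case: eqP => //= _; rewrite ip; lia.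
- by case: eqP => [->|] //=; rewrite ?orbF //; lia.
by case: eqP => [->|] //=; rewrite ?orbF //; lia.
Qed.

(** For a spline with the edge (p, h p) and a word strict there, the leading value
    is divisible by one more difference, so the coefficient has no constant term. *)
Lemma expand_marked (p : 'I_n) f : S p -> spline (eh (add_mark p)) f ->
  exists2 g, (forall t, marks_strict t -> (g t)@_0 = 0) & forall t', f t' = \sum_t g t * fl t t'.
Proof.
move=> Sp sf; pose q := Ordinal (Sn Sp); have hpq : h p = q by [].
suff : exists2 g, (forall t, ~~ violated t p -> exists r, g t = xdiff F p q * r) &
    forall t', f t' = \sum_t g t * fl t t'.
  case=> g Ig fE; exists g => // t /forallP /(_ p) nw; have [r ->] := Ig t nw.
  by rewrite mcoeff0M /xdiff mcoeffB !mcoeffX !mnm1_eq0 subrr mul0r.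
apply: (@expansion (spline (eh (add_mark p)))
    (fun t g => ~~ violated t p -> exists r, g = xdiff F p q * r)) => //.
- by move=> *; apply: spline_sub.
- by move=> *; apply: eq_spline; eassumption.
- by move=> t _; exists 0; rewrite mulr0.
- move=> f' t sf' f0; have [r fr] := spline_lead wd_sw sf' f0.
  have [w|nw] := boolP (violated t p).
    have sfh : spline (eh h) f'.
      by apply: sub_spline sf' => i j e; rewrite add_mark_edge // e.
    by have [r' fr'] := spline_lead wd_sw sfh f0; exists r'.
  have [r' er'] := inv_prod_add_mark Sp hpq nw.
  exists (xdiff F p q * r' * r); first by exists (r' * r); rewrite mulrA.
  by rewrite fr er' !mulrA.
- move=> t g Ig; have [sp _ _ _] := flP t; have [w|nw] := boolP (violated t p).
    apply: splineM; apply: sub_spline sp => i j.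
    rewrite add_mark_edge // add_marks_edge; last exact: violated_marked.
    by case/or3P=> [->//|/andP[/eqP -> ->]|/andP[/eqP -> ->]]; rewrite w !orbT.
  have [r ->] := Ig nw; move=> i j t'; rewrite add_mark_edge // => /or3P[eij||].
  + by rewrite !on_diagM (fl_spline t t' eij).
  + case/andP=> /eqP -> /eqP jq; have -> : j = q by apply: val_inj.
    by rewrite !on_diagM on_diag_xdiff !mul0r.
  + case/andP=> /eqP -> /eqP jq; have -> : i = q by apply: val_inj.
    by apply/on_diag_swap; rewrite !on_diagM on_diag_xdiff !mul0r.
Qed.

(** The submodule generated by the splines with one more marked edge and by the
    variables times the splines. *)
Definition marked (f : T -> P) := exists (g k : 'I_n -> T -> P),
  [/\ forall p : 'I_n, S p -> spline (eh (add_mark p)) (g p), forall i, spline (eh h) (k i) &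
   forall t, f t = \sum_(p : 'I_n | S p) g p t + \sum_i 'X_i * k i t].

Lemma marked_spline f : marked f -> spline (eh h) f.
Proof.
move=> [g [k [gs ks fE]]] i j t eij; rewrite !fE !on_diagD /on_diag !rmorph_sum /=.
congr (_ + _); apply: eq_bigr => p Sp.
  by apply: (gs p Sp); rewrite add_mark_edge // eij.
by have := ks p i j t eij; rewrite /on_diag !rmorphM /= => ->.
Qed.

Lemma expand_mark f : marked f ->
  exists2 g, (forall t, marks_strict t -> (g t)@_0 = 0) & forall t', f t' = \sum_t g t * fl t t'.
Proof.
move=> [g [k [gs ks fE]]].
have exg (p : 'I_n) : exists a : T -> P, S p -> (forall t, marks_strict t -> (a t)@_0 = 0) /\
    forall t', g p t' = \sum_t a t * fl t t'.
  case Sp: (S p); last by exists (fun=> 0).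
  by have [a a0 aE] := expand_marked Sp (gs p Sp); exists a.
have [a aP] := fin_all_exists exg.
have exk i : exists b : T -> P, forall t', k i t' = \sum_t b t * fl t t' := expand_all (ks i).
have [b bP] := fin_all_exists exk.
exists (fun t => \sum_(p : 'I_n | S p) a p t + \sum_i 'X_i * b i t) => [t st|t'].
  rewrite mcoeffD !raddf_sum /= !big1 ?addr0 // => p Sp; last by case: (aP p Sp) => ->.
  by rewrite mcoeff0M mcoeffX mnm1_eq0 mul0r.
rewrite fE (eq_bigr (fun t => \sum_(p : 'I_n | S p) a p t * fl t t' +
    \sum_i 'X_i * b i t * fl t t')); last by move=> t _; rewrite mulrDl !mulr_suml.
rewrite big_split /=; congr (_ + _); rewrite exchange_big /=; apply: eq_bigr => p Sp.
  by case: (aP p Sp).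
by rewrite bP mulr_sumr; apply: eq_bigr => t _; rewrite mulrA.
Qed.

Fact marked0 d : marked (pval (0 : {ffun T -> H d})).
Proof.
exists (fun _ _ => 0), (fun _ _ => 0); split=> // t; rewrite pval0 !big1 ?addr0 // => i _.
by rewrite mulr0.
Qed.

Lemma marked_lin (a : P) f g : marked f -> marked g -> marked (fun t => a * f t + g t).
Proof.
move=> [f1 [f2 [f1s f2s fE]]] [g1 [g2 [g1s g2s gE]]].
exists (fun p t => a * f1 p t + 1 * g1 p t), (fun p t => a * f2 p t + 1 * g2 p t).
split=> [p Sp|i|t]; try by apply: spline_lin; auto.
have -> : \sum_(p : 'I_n | S p) (a * f1 p t + 1 * g1 p t) =
    a * \sum_(p : 'I_n | S p) f1 p t + \sum_(p : 'I_n | S p) g1 p t.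
  by rewrite mulr_sumr -big_split; apply: eq_bigr => p _; rewrite mul1r.
have -> : \sum_i 'X_i * (a * f2 i t + 1 * g2 i t) =
    a * \sum_i 'X_i * f2 i t + \sum_i 'X_i * g2 i t.
  by rewrite mulr_sumr -big_split; apply: eq_bigr => p _ /=; ring.
by rewrite fE gE; ring.
Qed.

Lemma eq_marked f g : f =1 g -> marked f -> marked g.
Proof. by move=> e [a [b [h1 h2 h3]]]; exists a, b; split=> // t; rewrite -e. Qed.

Fact markedD d a (f g : {ffun T -> H d}) :
  marked (pval f) -> marked (pval g) -> marked (pval (a *: f + g)).
Proof.
move=> mf mg; apply: eq_marked (marked_lin a%:MP mf mg) => t.
by rewrite pval_lin mul_mpolyC.
Qed.

Definition marked_space d : {vspace {ffun T -> H d}} := vspace_of (@marked0 d) (@markedD d).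

(** In the expansion of the family the coefficients before t vanish one after the
    other, and the coefficient of a word strict on the marks has no constant
    term. *)
Lemma marked_lead f t : marked f -> (forall t', bef t' t -> f t' = 0) ->
  exists2 q, marks_strict t -> q@_0 = 0 & f t = Phi (eh h) t * q.
Proof.
move=> /expand_mark[g g0 fE] f0.
have vanish s s' : bef s' s -> fl s s' = 0 by move=> lt; have [_ fl0 _ _] := flP s; apply: fl0.
have val s : (forall t', bef t' s -> g t' = 0) -> f s = Phi (eh h) s * g s.
  move=> gs; rewrite fE (bigD1 s) //= big1 => [|s' ne].
    by have [_ _ -> _] := flP s; rewrite addr0 mulrC.
  case: (before_total (moment wd) s s') => [/gs ->|e|/vanish ->]; rewrite ?mul0r ?mulr0 //.
  by rewrite e eqxx in ne.
have gz : forall s, bef s t -> g s = 0.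
  apply: (before_ind (moment := moment wd)) => s IH st.
  have /eqP : Phi (eh h) s * g s = 0.
    rewrite -val ?f0 // => t' lt; apply: IH => //; exact: ltn_trans lt st.
  by rewrite mulf_eq0 (negPf (inv_prod_neq0 F _ _ _)) => /eqP.
by exists (g t); [apply: g0 | apply: val].
Qed.

(** If t violates a mark then [fl t] is itself a spline with this mark added;
    otherwise q lies in the ideal of the variables. *)
Lemma marked_fl t (q : P) : (marks_strict t -> q@_0 = 0) -> marked (fun t' => q * fl t t').
Proof.
move=> q0; have [st|/forallPn[p /negPn wp]] := boolP (marks_strict t); last first.
  have Sp := violated_marked wp.
  exists (fun p' t' => if p' == p then q * fl t t' else 0), (fun _ _ => 0).
  split=> [p' Sp'|//|t'].
    case: eqP => [->|_ //]; apply: splineM; have [sp _ _ _] := flP t.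
    apply: sub_spline sp => i j; rewrite add_mark_edge // add_marks_edge; last exact: violated_marked.
    by case/or3P=> [->//|/andP[/eqP -> ->]|/andP[/eqP -> ->]]; rewrite wp !orbT.
  rewrite [X in _ + X]big1 ?addr0 => [|i _]; last by rewrite mulr0.
  by rewrite (bigD1 p) //= eqxx big1 ?addr0 // => p' /andP[_ /negPf ->].
have [c [k qE]] := mpoly_split q; have c0 : c = 0.
  have := q0 st; rewrite qE mcoeffD mcoeffC eqxx mulr1 raddf_sum /= big1 ?addr0 // => i _.
  by rewrite mcoeff0M mcoeffX mnm1_eq0 mul0r.
exists (fun _ _ => 0), (fun i t' => k i * fl t t'); split=> // [i|t'].
  by apply: splineM; apply: fl_spline.
rewrite big1 // add0r qE c0 mpolyC0 add0r mulr_suml.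
by apply: eq_bigr => i _; rewrite mulrA.
Qed.

(** Compared with all splines only one leading value is lost, the constant
    multiples of [inv_prod] for a word strict on the marks. *)
Lemma dim_lead_mark d t : (\dim (lead_space (moment wd) (marked_space d) t) +
  (marks_strict t && (inv (eh h) t == d)) = inv_dim F wd (eh h) d t)%N.
Proof.
have homq (p : H d) (q : P) : (inv (eh h) t <= d)%N -> p = Phi (eh h) t * q :> P ->
    q \is (d - inv (eh h) t).-homog.
  move=> le e; apply: (dhomog_quotient (inv_prod_neq0 F wd (eh h) t) (inv_prod_homog F wd (eh h) t)).
  by rewrite -e subnKC // dhomog_is_dhomog.
case: (boolP (marks_strict t && _)) => [/andP[st /eqP id]|nst]; last first.
  rewrite addn0 -dim_inv_prod_mul; congr (\dim _); apply/vspaceP => p; apply/idP/idP.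
    move=> /lead_spaceP[f [/vspace_ofP mf f0 <-]]; apply/vspace_ofP.
    have [|q _ fq] := marked_lead mf (t := t); last by exists q.
    by move=> t' lt; rewrite /pval f0 // linear0.
  move=> /vspace_ofP[q pq]; apply/lead_spaceP.
  have [le|lt] := leqP (inv (eh h) t) d; last first.
    have p0 : p = 0.
      apply: hom_inj; rewrite hom0 pq.
      rewrite (@dhomog_quotient0 _ _ _ _ (Phi (eh h) t) q (inv_prod_neq0 F wd _ t) (inv_prod_homog F wd _ t) lt) ?mulr0 //.
      by rewrite -pq dhomog_is_dhomog.
    by exists 0; split=> [|t' _|]; rewrite ?mem0v ?ffunE ?p0.
  have hq := homq p q le pq.
  have q0 : marks_strict t -> q@_0 = 0.
    move=> st; move: nst; rewrite st /= => ne.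
    by apply: (dhomog_nemf_coeff hq); rewrite /= mdeg0; move: ne le; lia.
  have [sp fl0 flt flh] := flP t.
  have hg t' : q * fl t t' \is d.-homog by rewrite -[in X in X.-homog](subnK le) dhomogM.
  exists (family_of hg); split.
  - by apply/vspace_ofP; apply: eq_marked (marked_fl q0) => t'; rewrite pval_family_of.
  - by move=> t' lt; apply: hom_inj; rewrite ffunE /= fl0 // mulr0.
  - by apply: hom_inj; rewrite ffunE /= flt pq mulrC.
have -> : lead_space (moment wd) (marked_space d) t = 0%VS.
  apply/eqP; rewrite -subv0; apply/subvP => p /lead_spaceP[f [/vspace_ofP mf f0 <-]].
  rewrite memv0; apply/eqP; apply: hom_inj; rewrite hom0.
  have [|q q0 fq] := marked_lead mf (t := t).
    by move=> t' lt; rewrite /pval f0 // linear0.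
  have hq : q \is (d - inv (eh h) t).-homog by apply: (homq (f t)); rewrite ?id.
  rewrite id subnn in hq; rewrite -[LHS]/(pval f t) fq.
  have -> : q = 0; last by rewrite mulr0.
  apply/mpolyP => m; rewrite mcoeff0; have [->|m0] := eqVneq m 0%MM; first exact: q0.
  by apply: (dhomog_nemf_coeff hq); rewrite mdeg_eq0.
rewrite dimv0 add0n /inv_dim id leqnn subnn /dim_homog.
by rewrite dimvf -[RHS]/('C(0 + n', 0)) bin0.
Qed.

Lemma dim_marked_space d : (\dim (splv (eh h) d) =
  \dim (marked_space d) + #|[pred t | marks_strict t & inv (eh h) t == d]|)%N.
Proof.
rewrite (dyck_tight F wd_inj wd_sw dyck_h) (dim_lead_space (moment wd)) -sum1_card.
rewrite [X in (_ + X)%N]big_mkcond -big_split.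
apply: eq_bigr => t _ /=; rewrite -(dim_lead_mark d t) inE.
by case: (marks_strict t && _).
Qed.
End Expansion.
End WithT.
End Marks.

(** * Multiplicities in a quotient of two stable subspaces *)

Import VectorInternalTheory.

Lemma idem_factor (K : fieldType) m r (A : 'M[K]_(m, r)) (B : 'M_(r, m)) C D :
  C *m A = 1%:M -> B *m D = 1%:M -> (A *m B) *m (A *m B) = A *m B -> B *m A = 1%:M.
Proof.
move=> CA BD /(congr1 (fun X => C *m X *m D)).
by rewrite !mulmxA CA mul1mx -!mulmxA BD mulmx1 => ->.
Qed.

(** A full rank factorization E = A B of an idempotent has B A = 1. *)
Lemma mxtrace_idem (K : fieldType) m (E : 'M[K]_m) : E *m E = E -> \tr E = (\rank E)%:R.
Proof.
move=> EE; rewrite -{1}(mulmx_base E) mxtrace_mulC.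
have /row_freeP[B RB] := row_base_free E; have /row_fullP[C CC] := col_base_full E.
suff -> : row_base E *m col_base E = 1%:M by rewrite mxtrace1.
by apply: (idem_factor CC RB); rewrite mulmx_base.
Qed.

Section Average.
Variables (gT : finGroupType) (m : nat) (rG : mx_representation algC [set: gT] m).
Variable H : {group gT}.

Definition avg : 'M[algC]_m := (#|H|%:R)^-1 *: \sum_(h in H) rG h.

Lemma avg_repr h : h \in H -> avg *m rG h = avg.
Proof.
move=> hH; rewrite /avg -scalemxAl mulmx_suml; congr (_ *: _).
rewrite [RHS](reindex_inj (mulIg h)) /=; apply: eq_big => [k|k kH].
  by rewrite groupMr.
by rewrite repr_mxM ?inE.
Qed.

Lemma fix_avg : (rfix_mx rG H :=: avg)%MS.
Proof.
apply/eqmxP/andP; split; last by apply/rfix_mxP => h; apply: avg_repr.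
have -> : rfix_mx rG H = rfix_mx rG H *m avg; last exact: submxMl.
rewrite /avg -scalemxAr mulmx_sumr (eq_bigr (fun=> rfix_mx rG H)); last first.
  by move=> h hH; rewrite rfix_mx_id.
rewrite sumr_const -scaler_nat scalerA mulVf ?scale1r //.
by rewrite pnatr_eq0 -lt0n cardG_gt0.
Qed.

Lemma avg_idem : avg *m avg = avg.
Proof.
rewrite {2}/avg -scalemxAr mulmx_sumr (eq_bigr (fun=> avg)); last first.
  by move=> h hH; rewrite avg_repr.
rewrite sumr_const -scaler_nat scalerA mulVf ?scale1r //.
by rewrite pnatr_eq0 -lt0n cardG_gt0.
Qed.

(** The trace of the averaging projection computes both sides. *)
Lemma cfdot_fix : '['Res[H] (cfRepr rG), 1] = (\rank (rfix_mx rG H))%:R.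
Proof.
rewrite fix_avg -mxtrace_idem ?avg_idem // /avg linearZ /= raddf_sum /=.
rewrite cfdotE; congr (_ * _); apply: eq_bigr => h hH.
by rewrite cfResE ?subsetT // cfunE inE mulr1n cfun1E hH rmorph1 mulr1.
Qed.

(** Averaging over H projects every submodule onto its fixed vectors. *)
Lemma module_fix_avg (M : 'M[algC]_m) : mxmodule rG M -> (M :&: rfix_mx rG H :=: M *m avg)%MS.
Proof.
move=> /mxmoduleP modM; apply/eqmxP/andP; split.
  have sub : (M :&: rfix_mx rG H <= M)%MS by apply: capmxSl.
  have -> : (M :&: rfix_mx rG H)%MS = (M :&: rfix_mx rG H)%MS *m avg.
    rewrite /avg -scalemxAr mulmx_sumr (eq_bigr (fun=> (M :&: rfix_mx rG H)%MS)).
      rewrite sumr_const -scaler_nat scalerA mulVf ?scale1r //.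
      by rewrite pnatr_eq0 -lt0n cardG_gt0.
    by apply/rfix_mxP; apply: capmxSr.
  exact: submxMr.
rewrite sub_capmx; apply/andP; split.
  rewrite /avg -scalemxAr scalemx_sub // mulmx_sumr summx_sub // => h _.
  by apply: modM; rewrite inE.
by rewrite fix_avg submxMl.
Qed.
End Average.

Section Quotient.
Variables (gT : finGroupType) (V : vectType algC) (rho : gT -> 'End(V)).
Hypothesis rho1 : forall v, rho 1%g v = v.
Hypothesis rhoM : forall g h v, rho (g * h)%g v = rho h (rho g v).

Lemma v2r_lfun (f : 'End(V)) v : v2r (f v) = v2r v *m f2mx f.
Proof. by rewrite unlock /= r2vK. Qed.

Let rmx g : 'M[algC]_(dim V) := f2mx (rho g).

Lemma rmx_repr : mx_repr [set: gT] rmx.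
Proof.
split=> [|g h _ _]; apply/row_matrixP => i; rewrite !rowE -[delta_mx 0 i](r2vK).
  by rewrite -v2r_lfun rho1 mulmx1.
by rewrite -v2r_lfun rhoM !v2r_lfun mulmxA.
Qed.

Let rG := MxRepresentation rmx_repr.

Fact fix0 (H : {set gT}) : forall h, h \in H -> rho h 0 = 0.
Proof. by move=> h _; rewrite linear0. Qed.
Fact fixD (H : {set gT}) a u v : (forall h, h \in H -> rho h u = u) ->
  (forall h, h \in H -> rho h v = v) -> forall h, h \in H -> rho h (a *: u + v) = a *: u + v.
Proof. by move=> hu hv h hH; rewrite linearP /= hu ?hv. Qed.
Definition fixed_space (H : {set gT}) : {vspace V} := vspace_of (@fix0 H) (@fixD H).

Lemma mem_vs2mx (X : {vspace V}) v : (v \in X) = (v2r v <= vs2mx X)%MS.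
Proof. by rewrite memvE /subsetv mx2vsK. Qed.

Lemma rank_cap_fix (X : {vspace V}) (H : {group gT}) :
  \rank (vs2mx X :&: rfix_mx rG H)%MS = \dim (X :&: fixed_space H)%VS.
Proof.
suff /andP[le1 le2] : (rfix_mx rG H == vs2mx (fixed_space H))%MS.
  by rewrite /dimv /capv mx2vsK; apply/eqmx_rank/andP; rewrite !capmxS.
apply/andP; split; apply/row_subP => i.
  rewrite -[row i _](r2vK) -mem_vs2mx; apply/vspace_ofP => h hH.
  apply: v2r_inj; rewrite v2r_lfun r2vK.
  have /rfix_mxP fx : (row i (rfix_mx rG H) <= rfix_mx rG H)%MS := row_sub _ _.
  exact: fx.
have : r2v (row i (vs2mx (fixed_space H))) \in fixed_space H by rewrite mem_vs2mx r2vK row_sub.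
move=> /vspace_ofP fx; apply/rfix_mxP => h hH.
by rewrite -[row i _](r2vK) -(v2r_lfun (rho h)) fx.
Qed.

Lemma stable_module (X : {vspace V}) : (forall g v, v \in X -> rho g v \in X) ->
  mxmodule rG (vs2mx X).
Proof.
move=> st; apply/mxmoduleP => g _; apply/row_subP => i.
rewrite row_mul -[row i _](r2vK) -(v2r_lfun (rho g)) -mem_vs2mx; apply: st.
by rewrite mem_vs2mx r2vK row_sub.
Qed.

(** By Maschke X has a stable complement W in M; chi is the character of W, and
    fixed vectors of a direct sum are direct sums of fixed vectors. *)
Theorem quotient_character (X M : {vspace V}) : (X <= M)%VS ->
    (forall g v, v \in X -> rho g v \in X) -> (forall g v, v \in M -> rho g v \in M) ->
  exists2 chi : 'CF([set: gT]), chi \is a character &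
    forall H : {group gT}, '['Res[H] chi, 1] + (\dim (X :&: fixed_space H))%:R = (\dim (M :&: fixed_space H))%:R.
Proof.
move=> sXM stX stM; have modX := stable_module stX; have modM := stable_module stM.
have ch : ([pchar algC]^'.-group [set: gT])%g by apply: algC'G_pchar.
have red := mx_reducibleS modM (submx1 _) (mx_Maschke_pchar rG ch).
have [W modW XW dXW] := red _ modX sXM.
exists (cfRepr (submod_repr modW)); first exact: cfRepr_char.
move=> H; rewrite cfdot_fix -!rank_cap_fix -natrD; congr (_%:R).
have -> : \rank (rfix_mx (submod_repr modW) H) = \rank (W :&: rfix_mx rG H).
  rewrite (rfix_submod modW (subsetT H)) mxrank_in_submod //.
  exact: capmxSl.
have -> : \rank (vs2mx M :&: rfix_mx rG H) =
    \rank ((W :&: rfix_mx rG H) + (vs2mx X :&: rfix_mx rG H))%MS.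
  apply/eqmx_rank/andP; split.
    rewrite (module_fix_avg H modM) -(eqmxMr _ XW) addsmxMr addsmx_sub.
    rewrite -(module_fix_avg H modW) -(module_fix_avg H modX).
    by rewrite addsmxSr addsmxSl.
  have /andP[_ le] : (vs2mx X + W == vs2mx M)%MS by apply/eqmxP.
  rewrite addsmx_sub !capmxS //.
    by rewrite -XW addsmxSr.
rewrite mxrank_disjoint_sum //; apply/eqP; rewrite -submx0.
move/mxdirect_addsP: dXW => <-; rewrite sub_capmx.
rewrite (submx_trans (capmxSr _ _) (capmxSl _ _)).
by rewrite (submx_trans (capmxSl _ _) (capmxSl _ _)).
Qed.
End Quotient.

(** * From splines to characters of the symmetric group *)

Section Stabilizer.
Variable n : nat.
Implicit Type u : {ffun 'I_n -> nat}.

Definition stab_set u := [set g : 'S_n | [forall p, u (g p) == u p]].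

Lemma stabP u (g : 'S_n) : reflect (forall p, u (g p) = u p) (g \in stab_set u).
Proof. by rewrite inE; apply: (iffP forallP) => h p; apply/eqP. Qed.

Lemma stab_group_set u : group_set (stab_set u).
Proof.
apply/group_setP; split=> [|g k /stabP hg /stabP hk].
  by apply/stabP => p; rewrite perm1.
by apply/stabP => p; rewrite permM hk hg.
Qed.
Canonical stab u := Group (stab_group_set u).

Definition word u (s : 'S_n) : {ffun 'I_n -> nat} := [ffun p => u (s p)].
Definition words u := [seq word u s | s <- enum 'S_n].
(** The set of words is finite although the letters are arbitrary natural
    numbers; listing the rearrangements makes it a finite type. *)
Definition orbit_of u := seq_sub (words u).

Lemma mem_words u s : word u s \in words u.
Proof. by apply: map_f; rewrite mem_enum. Qed.

Definition place u s : orbit_of u := SeqSub (mem_words u s).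
Definition letter u (t : orbit_of u) (p : 'I_n) : nat := val t p.

Lemma place_surj u (t : orbit_of u) : exists s, place u s == t.
Proof.
have /mapP[s _ e] := valP t; exists s; apply/eqP/val_inj; rewrite /= e //.
Qed.
(** Some permutation carrying u to the word t; any two differ by the stabilizer. *)
Definition perm_of u (t : orbit_of u) : 'S_n := xchoose (place_surj t).
Lemma perm_ofK u (t : orbit_of u) : place u (perm_of t) = t.
Proof. exact/eqP/(xchooseP (place_surj t)). Qed.

Definition swap_in u (i j : 'I_n) (t : orbit_of u) : orbit_of u := place u (tperm i j * perm_of t)%g.

Lemma letter_place u s p : letter (place u s) p = u (s p).
Proof. by rewrite /letter /= ffunE. Qed.

Lemma letter_inj u (t t' : orbit_of u) : letter t =1 letter t' -> t = t'.
Proof. by move=> e; apply: val_inj; apply/ffunP => p; apply: e. Qed.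

Lemma letter_swap u i j (t : orbit_of u) p : letter (swap_in i j t) p = letter t (tperm i j p).
Proof. by rewrite /swap_in letter_place permM -letter_place perm_ofK. Qed.

Lemma swap_in_place u i j s : swap_in i j (place u s) = place u (tperm i j * s)%g.
Proof. by apply: letter_inj => p; rewrite letter_swap !letter_place permM. Qed.

Lemma place_eq u s s' : place u s = place u s' -> (s^-1 * s')%g \in stab u.
Proof.
move=> e; apply/stabP => p; rewrite permM -letter_place -e letter_place.
by rewrite permKV.
Qed.

Lemma place_stab u s k : k \in stab u -> place u (s * k)%g = place u s.
Proof. by move=> /stabP hk; apply: letter_inj => p; rewrite !letter_place permM hk. Qed.
End Stabilizer.

Section Character.
Variables (n' : nat) (h : nat -> nat) (S : pred nat).
Local Notation n := n'.+1.
Local Notation P := {mpoly algC[n]}.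
Local Notation H d := (dhomog n algC d).
Local Notation eh := (dyck_rel n).
Hypothesis hS : forall R : pred nat, (forall i, R i -> S i) -> dyck n (add_marks h R).
Hypothesis Sn : forall i, S i -> (h i < n)%N.

Definition left_swap (i j : 'I_n) (s : 'S_n) : 'S_n := (tperm i j * s)%g.

Section Act.
Variable d : nat.
Local Notation U := {ffun 'S_n -> H d}.

(** The group acts on the right of the indices, whereas the exchange of two
    positions acts on their left; hence the two commute. *)
Definition ract (g : 'S_n) (f : U) : U := [ffun s => f (s * g^-1)%g].
Fact ract_linear g : linear (ract g).
Proof. by move=> a f k; apply/ffunP => s; rewrite !ffunE. Qed.
HB.instance Definition _ g := GRing.isLinear.Build algC U U *:%R (ract g) (ract_linear g).
Definition rho g : 'End(U) := linfun (ract g).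
Lemma rhoE g f s : rho g f s = f (s * g^-1)%g.
Proof. by rewrite lfunE ffunE. Qed.
Lemma rho_1 f : rho 1%g f = f.
Proof. by apply/ffunP => s; rewrite rhoE invg1 mulg1. Qed.
Lemma rho_M g k f : rho (g * k)%g f = rho k (rho g f).
Proof. by apply/ffunP => s; rewrite !rhoE invMg mulgA. Qed.

Lemma spline_shift e (f : 'S_n -> P) g : spline left_swap e f -> spline left_swap e (fun s => f (s * g)%g).
Proof. by move=> sf i j s eij; rewrite (sf _ _ _ eij) /left_swap mulgA. Qed.

Lemma pval_rho g (f : U) s : pval (rho g f) s = pval f (s * g^-1)%g.
Proof. by rewrite /pval rhoE. Qed.

Definition spline_mod := spline_space algC left_swap (eh h) d.
Definition marked_mod := marked_space algC h S left_swap d.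

Lemma rho_spline_mod g f : f \in spline_mod -> rho g f \in spline_mod.
Proof.
move=> /spline_spaceP sf; apply/spline_spaceP; apply: eq_spline (spline_shift g^-1 sf) => s.
by rewrite pval_rho.
Qed.

Lemma rho_marked_mod g f : f \in marked_mod -> rho g f \in marked_mod.
Proof.
move=> /vspace_ofP[a [b [sa sb fE]]]; apply/vspace_ofP.
exists (fun p s => a p (s * g^-1)%g), (fun i s => b i (s * g^-1)%g); split=> [p Sp|i|s].
- exact: (spline_shift g^-1 (sa p Sp)).
- exact: (spline_shift g^-1 (sb i)).
- by rewrite pval_rho fE.
Qed.

Lemma marked_mod_sub : (marked_mod <= spline_mod)%VS.
Proof.
apply/subvP => f /vspace_ofP mf; apply/spline_spaceP; exact: marked_spline mf.
Qed.

Section Orbit.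
Variable u : {ffun 'I_n -> nat}.
Local Notation K := (stab u).
Local Notation V := {ffun orbit_of u -> H d}.

(** Families indexed by the rearrangements of u are the families indexed by
    permutations that are fixed by the stabilizer of u. *)
Definition pullback (f : V) : U := [ffun s => f (place u s)].

Lemma pval_pullback f s : pval (pullback f) s = pval f (place u s).
Proof. by rewrite /pval ffunE. Qed.

Lemma pullback_linear : linear pullback.
Proof. by move=> a f g; apply/ffunP => s; rewrite !ffunE. Qed.

Lemma pullback_fixed f : pullback f \in fixed_space rho K.
Proof.
apply/vspace_ofP => k kK; apply/ffunP => s.
by rewrite rhoE !ffunE place_stab ?groupV.
Qed.

Lemma pullback_eq0 f : pullback f = 0 -> f = 0.
Proof.
move=> e; apply/ffunP => t; rewrite -(perm_ofK t).
by have := congr1 (fun g : U => g (perm_of t)) e; rewrite /= !ffunE.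
Qed.

Lemma spline_pullback e (f : orbit_of u -> P) : spline (@swap_in n u) e f -> spline left_swap e (fun s => f (place u s)).
Proof. by move=> sf i j s eij; rewrite (sf _ _ _ eij) swap_in_place. Qed.

(** A one sided inverse of the pullback that keeps all spline conditions, because
    they do not involve the right action. *)
Definition average (f : 'S_n -> P) (t : orbit_of u) : P :=
  (#|K|%:R^-1 : algC)%:MP * \sum_(k in K) f (perm_of t * k)%g.

Lemma average_place f s : average f (place u s) = (#|K|%:R^-1 : algC)%:MP * \sum_(k in K) f (s * k)%g.
Proof.
rewrite /average; congr (_ * _).
have kK : ((perm_of (place u s))^-1 * s)%g \in K by apply: place_eq; rewrite perm_ofK.
rewrite (reindex_inj (mulgI ((perm_of (place u s))^-1 * s)%g)) /=; apply: eq_big => [k|k _].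
  by rewrite groupMl.
by rewrite !mulgA mulgV mul1g.
Qed.

Lemma average_id f : (forall s k, k \in K -> f (s * k)%g = f s) -> forall s, average f (place u s) = f s.
Proof.
move=> fi s; rewrite average_place (eq_bigr (fun=> f s)) => [|k kK]; last exact: fi.
rewrite sumr_const -[f s *+ _]mulr_natl mulrA -mpolyC_nat -mpolyCM mulVf ?mpolyC1 ?mul1r //.
by rewrite pnatr_eq0 -lt0n cardG_gt0.
Qed.

Lemma spline_average e f : spline left_swap e f -> spline (@swap_in n u) e (average f).
Proof.
move=> sf i j t eij; rewrite -(perm_ofK t) swap_in_place !average_place !on_diagM; congr (_ * _).
rewrite /on_diag !rmorph_sum; apply: eq_bigr => k _.
by have := sf i j (perm_of t * k)%g eij; rewrite /on_diag /left_swap /= mulgA.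
Qed.

Lemma fixed_pval (f : U) : f \in fixed_space rho K -> forall s k, k \in K -> pval f (s * k)%g = pval f s.
Proof.
move=> /vspace_ofP fx s k kK; have := fx k^-1%g; rewrite groupV => /(_ kK) e.
by rewrite -[in RHS]e pval_rho invgK.
Qed.

Lemma dim_fixed_spline : \dim (spline_mod :&: fixed_space rho K) = \dim (spline_space algC (@swap_in n u) (eh h) d).
Proof.
apply/esym; apply: (dim_eq_map pullback_linear) => [f /spline_spaceP sf|f _|f]; last 2 first.
- exact: pullback_eq0.
- rewrite memv_cap => /andP[/spline_spaceP sf /fixed_pval fi].
  have hf t : average (pval f) t \is d.-homog by rewrite -(perm_ofK t) average_id // pval_homog.
  exists (family_of hf).
    by apply/spline_spaceP; apply: eq_spline (spline_average sf) => t; rewrite pval_family_of.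
  by apply: pvalP => s; rewrite pval_pullback pval_family_of average_id.
rewrite memv_cap pullback_fixed andbT; apply/spline_spaceP; apply: eq_spline (spline_pullback sf) => s.
by rewrite pval_pullback.
Qed.

Lemma dim_fixed_marked : \dim (marked_mod :&: fixed_space rho K) = \dim (marked_space algC h S (@swap_in n u) d).
Proof.
apply/esym; apply: (dim_eq_map pullback_linear) => [f /vspace_ofP[a [b [sa sb fE]]]|f _|f]; last 2 first.
- exact: pullback_eq0.
- rewrite memv_cap => /andP[/vspace_ofP[a [b [sa sb fE]]] /fixed_pval fi].
  have hf t : average (pval f) t \is d.-homog by rewrite -(perm_ofK t) average_id // pval_homog.
  exists (family_of hf); last by apply: pvalP => s; rewrite pval_pullback pval_family_of average_id.
  apply/vspace_ofP; exists (fun p => average (a p)), (fun i => average (b i)); split=> [p Sp|i|t].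
  + exact: spline_average (sa p Sp).
  + exact: spline_average.
  rewrite pval_family_of /average (eq_bigr _ (fun k _ => fE _)) big_split mulrDr; congr (_ + _).
    by rewrite exchange_big mulr_sumr.
  rewrite exchange_big mulr_sumr; apply: eq_bigr => i _.
  by rewrite -mulr_sumr mulrCA.
rewrite memv_cap pullback_fixed andbT; apply/vspace_ofP.
exists (fun p s => a p (place u s)), (fun i s => b i (place u s)); split=> [p Sp|i|s].
- exact: spline_pullback (sa p Sp).
- exact: spline_pullback.
- by rewrite pval_pullback fE.
Qed.
End Orbit.
End Act.

(** The character of the splines modulo the marked ones, on all permutations; its
    fixed vectors under the stabilizer of u are computed on the words in the orbit of
    u, where [dim_marked_space] applies again. *)
Theorem word_character d : exists2 chi : 'CF([set: 'S_n]), chi \is a character &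
  forall u : {ffun 'I_n -> nat}, '['Res[stab u] chi, 1] =
    #|[pred t : orbit_of u | marks_strict h S (@letter n u) t & ninv (@letter n u) (eh h) t == d]|%:R.
Proof.
have [chi cchi chiE] := quotient_character (@rho_1 d) (@rho_M d) (marked_mod_sub d)
  (@rho_marked_mod d) (@rho_spline_mod d).
exists chi => // u; have := chiE (stab u); rewrite dim_fixed_spline dim_fixed_marked.
have [fl flP] := exists_basis algC hS (@letter_inj n u) (@letter_swap n u).
rewrite (dim_marked_space hS Sn (@letter_inj n u) (@letter_swap n u) flP) natrD addrC.
by move/addrI.
Qed.
End Character.

(** * Horizontal strips and Kostka numbers *)

Local Close Scope ring_scope.

Section Kostka.
Variable n : nat.

(** Row lengths, at most n in each of n + 1 rows; that they decrease is imposed by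
    [hstrip] and [is_part].  No shape of size at most n is cut off, and the spare row
    leaves room for one more strip. *)
Definition shape := {ffun 'I_n.+1 -> 'I_n.+1}.
Implicit Types la mu ka rh : shape.

Definition rowlen la (i : nat) : nat := if insub i is Some j then la j else 0.
Definition total (f : nat -> nat) := \sum_(i < n.+1) f i.
Definition weight la := total (rowlen la).
Definition mk_shape (f : nat -> nat) : shape := [ffun i : 'I_n.+1 => inord (f i)].

Lemma rowlen_ord la (i : 'I_n.+1) : rowlen la i = la i.
Proof. by rewrite /rowlen valK. Qed.
Lemma rowlen_ge la i : n < i -> rowlen la i = 0.
Proof. by move=> h; rewrite /rowlen insubF //; lia. Qed.
Lemma rowlen_le la i : rowlen la i <= n.
Proof. by rewrite /rowlen; case: insubP => // j _ _; rewrite -ltnS. Qed.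
Lemma rowlen_inj la mu : rowlen la =1 rowlen mu -> la = mu.
Proof. by move=> e; apply/ffunP => i; apply: val_inj; rewrite /= -!rowlen_ord. Qed.

Lemma rowlen_mk_shape f : (forall i, f i <= n) -> (forall i, n < i -> f i = 0) -> rowlen (mk_shape f) =1 f.
Proof.
move=> fn f0 i; case: (ltnP n i) => hi; first by rewrite rowlen_ge ?f0.
have hi' : i < n.+1 by [].
by rewrite -[i]/(nat_of_ord (Ordinal hi')) rowlen_ord ffunE inordK ?ltnS ?fn.
Qed.

Lemma eq_total f g : f =1 g -> total f = total g.
Proof. by move=> e; apply: eq_bigr => i _. Qed.
Lemma totalD f g : total (fun i => f i + g i) = total f + total g.
Proof. exact: big_split. Qed.
Lemma total_shift f : f n.+1 = 0 -> total f = f 0 + total (fun i => f i.+1).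
Proof.
move=> f0; have := @big_ord_recr _ 0 addn n.+1 (fun i : 'I_n.+2 => f i).
by rewrite big_ord_recl /= f0 addn0 => e; apply/esym/e.
Qed.
Lemma le_total f g i : (forall j, f j <= g j) -> i <= n -> total f + g i <= total g + f i.
Proof.
move=> le hi; rewrite /total (bigD1 (Ordinal (hi : i < n.+1))) //=.
rewrite [X in _ <= X + _](bigD1 (Ordinal (hi : i < n.+1))) //=.
have := @leq_sum _ (index_enum 'I_n.+1) (fun j => j != Ordinal (hi : i < n.+1)) f g (fun j _ => le j).
set A := \sum_(_ < _ | _) _; set B := \sum_(_ < _ | _) _; lia.
Qed.
Lemma total_eq f g : (forall j, f j <= g j) -> total f = total g -> forall i, i <= n -> f i = g i.
Proof. by move=> le e i hi; have := le_total le hi; have := le i; lia. Qed.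
Lemma le_total1 f i : i <= n -> f i <= total f.
Proof. by move=> hi; rewrite /total (bigD1 (Ordinal (hi : i < n.+1))) //= leq_addr. Qed.

(** The two chains of inequalities are the interlacing of mu and la, which also
    forces both to be weakly decreasing. *)
Definition hstrip mu la b :=
  [forall i : 'I_n.+1, (rowlen mu i <= rowlen la i) && (rowlen la i.+1 <= rowlen mu i)] && (weight la == weight mu + b).

Lemma hstripP mu la b :
  reflect ((forall i, rowlen mu i <= rowlen la i /\ rowlen la i.+1 <= rowlen mu i) /\ weight la = weight mu + b) (hstrip mu la b).
Proof.
apply: (iffP andP) => [[/forallP h /eqP e]|[h e]]; split=> //; last 2 first.
- by apply/forallP => i; have [-> ->] := h i.
- exact/eqP.
move=> i; case: (ltnP n i) => hi; first by rewrite !rowlen_ge //; lia.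
exact/andP/(h (Ordinal (hi : i < n.+1))).
Qed.

Lemma rowlen_last0 la : (forall i, rowlen la i.+1 <= rowlen la i) -> weight la <= n -> rowlen la n = 0.
Proof.
move=> dec sn; apply/eqP; rewrite -leqn0 leqNgt; apply/negP => h0.
suff : n.+1 <= weight la by lia.
rewrite /weight /total -[X in X <= _]card_ord -sum1_card; apply: leq_sum => i _.
have : forall k, k <= n -> rowlen la n <= rowlen la (n - k).
  elim=> [|k IH] hk; first by rewrite subn0.
  by have := IH (ltnW hk); have := dec (n - k.+1); rewrite subnSK //; lia.
by move/(_ (n - i) (leq_subr _ _)); rewrite subKn; [lia|rewrite -ltnS].
Qed.

(** Chains of horizontal strips from the empty shape to la, the head of the list
    being the size of the last strip. *)
Fixpoint kostka (al : seq nat) la : nat :=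
  if al is b :: be then \sum_(mu | hstrip mu la b) kostka be mu else (weight la == 0).

Lemma kostka_sum al la : kostka al la != 0 -> weight la = sumn al.
Proof.
elim: al la => [|b al IH] la /=; first by rewrite eqb0 negbK => /eqP.
rewrite sum_nat_eq0 negb_forall => /existsP[mu]; rewrite negb_imply => /andP[/hstripP[_ ->]].
by move/IH ->; rewrite addnC.
Qed.

Lemma kostka_dec al la : kostka al la != 0 -> forall i, rowlen la i.+1 <= rowlen la i.
Proof.
case: al => [|b al] /=.
  rewrite eqb0 negbK => /eqP e i; suff -> : rowlen la i.+1 = 0 by [].
  case: (ltnP n i.+1) => hi; first exact: rowlen_ge.
  by have := le_total1 (rowlen la) hi; rewrite -/(weight la) e; lia.
rewrite sum_nat_eq0 negb_forall => /existsP[mu]; rewrite negb_imply => /andP[/hstripP[h _] _] i.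
by have := h i; lia.
Qed.

Definition empty_shape : shape := mk_shape (fun=> 0).
Lemma rowlen_empty i : rowlen empty_shape i = 0. Proof. exact: rowlen_mk_shape. Qed.
Lemma weight_eq0 la : (weight la == 0) = (la == empty_shape).
Proof.
apply/eqP/eqP => [e|->]; last by rewrite /weight (eq_total rowlen_empty) /total big1.
apply: rowlen_inj => i; rewrite rowlen_empty; case: (ltnP n i) => hi; first exact: rowlen_ge.
by have := le_total1 (rowlen la) hi; rewrite -/(weight la) e; lia.
Qed.

Lemma hstrip_empty a ka : hstrip ka empty_shape a = (ka == empty_shape) && (a == 0).
Proof.
have z0 : weight empty_shape = 0 by apply/eqP; rewrite weight_eq0.
apply/hstripP/andP => [[_ e]|[/eqP-> /eqP->]].
  by rewrite -weight_eq0; split; apply/eqP; lia.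
by rewrite z0; split=> // i; rewrite !rowlen_empty.
Qed.

Lemma kostka_empty al : kostka al empty_shape = (sumn al == 0).
Proof.
elim: al => [|a al IH] /=; first by rewrite weight_eq0 eqxx.
rewrite addn_eq0; case: eqP => [->|a0] /=.
  by rewrite (big_pred1 empty_shape) // => ka; rewrite hstrip_empty eqxx andbT.
by rewrite big1 // => ka; rewrite hstrip_empty => /andP[_ /eqP].
Qed.

Section LocalRule.
Variables (mu ka : shape) (a b : nat).
Hypothesis smu : weight mu + b <= n.
Hypothesis sab : weight mu + b = weight ka + a.

Local Notation mx i := (maxn (rowlen mu i) (rowlen ka i)).
Local Notation mn i := (minn (rowlen mu i) (rowlen ka i)).
Local Notation J := ('I_(minn a b).+1 * shape)%type.
(** The local rule of the Robinson-Schensted-Knuth correspondence.  Given mu and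
    ka, a shape la with both strips la / mu and la / ka is a choice of la_0 >=
    max(mu_0, ka_0) and of la_(i+1) between max(mu_(i+1), ka_(i+1)) and
    min(mu_i, ka_i).  A shape rh with mu / rh and ka / rh strips has rh_i between the
    same bounds; the intervals are reflected and the excess of la_0 becomes k. *)
Definition rule_down la : J := (inord (rowlen la 0 - mx 0), mk_shape (fun i => mx i.+1 + mn i - rowlen la i.+1)).
Definition rule_up (x : J) : shape :=
  mk_shape (fun i => if i is j.+1 then mx i + mn j - rowlen x.2 j else mx 0 + x.1).
Let P la := hstrip mu la b && hstrip ka la a.
Let Q (x : J) := hstrip x.2 mu (a - x.1) && hstrip x.2 ka (b - x.1).

Let sum_mxmn : total (fun i => mx i) + total (fun i => mn i) = weight mu + weight ka.
Proof. by rewrite -!totalD; apply: eq_total => i; lia. Qed.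

Let mx_last : mx n.+1 = 0. Proof. by rewrite !rowlen_ge. Qed.

Lemma rule_downP la : P la ->
  [/\ (rule_down la).1 = rowlen la 0 - mx 0 :> nat,
      forall i, rowlen (rule_down la).2 i = mx i.+1 + mn i - rowlen la i.+1 &
      forall i, mx i <= rowlen la i /\ rowlen la i.+1 <= mn i].
Proof.
move=> /andP[/hstripP[h1 e1] /hstripP[h2 e2]]; split=> [|i|i]; last by have := h1 i; have := h2 i; lia.
  rewrite inordK //; have : rowlen la 0 - rowlen mu 0 <= b.
    by have := le_total (fun j => proj1 (h1 j)) (leq0n n); rewrite -/(weight la) -/(weight mu); lia.
  have : rowlen la 0 - rowlen ka 0 <= a.
    by have := le_total (fun j => proj1 (h2 j)) (leq0n n); rewrite -/(weight la) -/(weight ka); lia.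
  by lia.
rewrite rowlen_mk_shape // => j; first by have := h1 j.+1; have := h2 j.+1; have := rowlen_le mu j; lia.
by move=> hj; rewrite !rowlen_ge //; lia.
Qed.

Lemma rule_down_inner la : P la -> Q (rule_down la).
Proof.
move=> Pl; have [e0 e1 e2] := rule_downP Pl; move/andP: Pl => [/hstripP[h1 s1] /hstripP[h2 s2]].
have es : weight (rule_down la).2 + weight la = weight mu + weight ka + (rowlen la 0 - mx 0).
  have e3 := @total_shift (fun i => mx i) mx_last.
  have e4 := total_shift (rowlen_ge la (leqnn n.+1)); rewrite -/(weight la) in e4.
  have e5 : weight (rule_down la).2 + total (fun i => rowlen la i.+1) = total (fun i => mx i.+1) + total (fun i => mn i).
    rewrite -!totalD; apply: eq_total => i; rewrite e1.
    by have := h1 i; have := h2 i; lia.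
  by have := e2 0; move: e3 e4 e5 sum_mxmn => /=; lia.
have lb : rowlen la 0 - mx 0 <= minn a b by rewrite -e0 -ltnS.
by apply/andP; split; apply/hstripP; (split=> [i|]; [have := e2 i; have := e2 i.+1; have := h1 i; have := h2 i; have := h1 i.+1; have := h2 i.+1; rewrite e1; lia|rewrite e0; have := e2 0; lia]).
Qed.

Lemma rule_upP x : Q x ->
  [/\ rowlen (rule_up x) 0 = mx 0 + x.1, forall i, rowlen (rule_up x) i.+1 = mx i.+1 + mn i - rowlen x.2 i &
      forall i, mx i.+1 <= rowlen x.2 i /\ rowlen x.2 i <= mn i].
Proof.
move=> /andP[/hstripP[h1 e1] /hstripP[h2 e2]].
have hx : x.1 <= minn a b by rewrite -ltnS.
have hb i : mx i.+1 <= rowlen x.2 i /\ rowlen x.2 i <= mn i by have := h1 i; have := h2 i; lia.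
have mun : rowlen mu n = 0 by apply: rowlen_last0 => [i|]; [have := h1 i; lia | lia].
have E : rowlen (rule_up x) =1 (fun i => if i is j.+1 then mx i + mn j - rowlen x.2 j else mx 0 + x.1).
  apply: rowlen_mk_shape => [[|i]|[|i] hi] //.
  - by have := le_total1 (rowlen mu) (leq0n n); have := le_total1 (rowlen ka) (leq0n n);
      rewrite -/(weight mu) -/(weight ka); lia.
  - by have := hb i; have := rowlen_le mu i; lia.
  - have := hb i; rewrite !(rowlen_ge _ hi); suff : rowlen mu i = 0 by lia.
    by case: (ltnP n i) => hi'; [exact: rowlen_ge | have -> : i = n by lia].
by split=> [|i|//]; rewrite E.
Qed.

Lemma rule_up_outer x : Q x -> P (rule_up x).
Proof.
move=> Qx; have [e0 e1 e2] := rule_upP Qx; move/andP: Qx => [/hstripP[h1 s1] /hstripP[h2 s2]].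
have hx : x.1 <= minn a b by rewrite -ltnS.
have es : weight (rule_up x) + weight x.2 = weight mu + weight ka + x.1.
  have e3 := @total_shift (fun i => mx i) mx_last.
  have e4 := total_shift (rowlen_ge (rule_up x) (leqnn n.+1)); rewrite -/(weight (rule_up x)) in e4.
  have e5 : total (fun i => rowlen (rule_up x) i.+1) + weight x.2 = total (fun i => mx i.+1) + total (fun i => mn i).
    by rewrite -!totalD; apply: eq_total => i; rewrite e1; have := e2 i; lia.
  by move: e0 e3 e4 e5 sum_mxmn => /=; lia.
by apply/andP; split; apply/hstripP; (split=> [[|i]|]; clear -e0 e1 e2 h1 h2 s1 s2 hx es sab;
  [have := e2 0; rewrite e0 e1; lia|have := e2 i; have := e2 i.+1; rewrite !e1; lia|clear -es s1 s2 hx sab; lia]).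
Qed.

(** Adding a strip of size b and then removing one of size a amounts to first
    removing a strip of size a - k and then adding one of size b - k, summed over
    k. *)
Lemma local_rule : #|P| = \sum_(k < (minn a b).+1) #|[pred rh | hstrip rh mu (a - k) && hstrip rh ka (b - k)]|.
Proof.
under [RHS]eq_bigr => k _ do rewrite -sum1_card.
rewrite pair_big_dep -sum1_card /= (reindex_onto rule_up rule_down) /=.
  apply: eq_bigl => x; apply/andP/idP => [[Px /eqP <-]|Qx]; first exact: rule_down_inner.
  have Pu := rule_up_outer Qx; split=> //; apply/eqP.
  have [e0 e1 e2] := rule_upP Qx; have [f0 f1 f2] := rule_downP Pu.
  case: x Qx Pu e0 e1 e2 f0 f1 f2 => k rh Qx Pu /= e0 e1 e2 f0 f1 f2.
  rewrite [rule_down _]surjective_pairing; congr pair; first by apply: val_inj; rewrite /= f0 e0 addKn.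
  by apply: rowlen_inj => i; rewrite f1 e1; have := e2 i; lia.
move=> la Pl; have Qd := rule_down_inner Pl; have [e0 e1 e2] := rule_upP Qd; have [f0 f1 f2] := rule_downP Pl.
apply: rowlen_inj => -[|i]; first by rewrite e0 f0; have := f2 0; lia.
by rewrite e1 f1; have := f2 i; have := f2 i.+1; lia.
Qed.
End LocalRule.

(** Sequences bounded termwise by be, with sum a. *)
Fixpoint subcontents (be : seq nat) (a : nat) : seq (seq nat) :=
  if be is b :: be' then [seq k :: r | k <- index_iota 0 (minn a b).+1, r <- subcontents be' (a - k)]
  else if a == 0 then [:: [::]] else [::].

Lemma subcontents_cons b be a :
  subcontents (b :: be) a = [seq k :: r | k <- index_iota 0 (minn a b).+1, r <- subcontents be (a - k)].
Proof. by []. Qed.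

Fixpoint cremove (be r : seq nat) :=
  if be is b :: be' then (b - head 0 r) :: cremove be' (behead r) else [::].

(** Removing a strip of size a from a chain with sizes be removes r_j from the j-th
    strip, for all r bounded by be with sum a: iterate the local rule. *)
Lemma kostka_down be a ka : sumn be <= n ->
  \sum_(la | hstrip ka la a) kostka be la = \sum_(r <- subcontents be a) kostka (cremove be r) ka.
Proof.
elim: be a ka => [|b be IH] a ka sb.
  rewrite /= (bigID (fun la => la == empty_shape)) /= [X in _ + X]big1 ?addn0; last first.
    by move=> la /andP[_ /negPf]; rewrite weight_eq0 => ->.
  rewrite (eq_bigl (fun la => (la == empty_shape) && hstrip ka empty_shape a)) => [|la]; last first.
    by case: eqP => [->|]; rewrite ?andbT ?andbF.
  rewrite hstrip_empty; case: (a == 0); rewrite ?big_nil ?big_seq1; last first.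
    by rewrite big1 // => la; rewrite !andbF.
  rewrite weight_eq0 /=; case: (ka == empty_shape); last by rewrite big1 // => la; rewrite !andbF.
  by rewrite (big_pred1 empty_shape) => [|la]; rewrite ?weight_eq0 ?eqxx ?andbT.
have {}sb : b + sumn be <= n by [].
have sb' : sumn be <= n by lia.
rewrite subcontents_cons big_allpairs_dep /= big_mkord.
under [RHS]eq_bigr => k _.
  rewrite /= exchange_big /=.
  under eq_bigr => rh _ do rewrite -(IH _ _ sb').
  over.
rewrite (exchange_big_dep predT) //=.
have red (I J : finType) (A : pred I) (B : I -> pred J) F :
  \sum_(i | A i) \sum_(j | B i j) F j = \sum_j (#|[pred i | A i && B i j]| * F j)%N :> nat.
  rewrite (exchange_big_dep predT) //=; apply: eq_bigr => j _.
  by rewrite sum_nat_const.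
under [RHS]eq_bigr => k _ do rewrite (red _ _ (fun rh => hstrip rh ka (b - k)) (fun rh mu => hstrip rh mu (a - k)) (kostka be)).
rewrite [RHS]exchange_big /=; apply: eq_bigr => mu _.
rewrite sum_nat_const -big_distrl /=.
have [->|kn0] := eqVneq (kostka be mu) 0; first by rewrite !muln0.
congr (_ * _); have smu := kostka_sum kn0.
case: (eqVneq (weight mu + b) (weight ka + a)) => e.
  have le : weight mu + b <= n by lia.
  rewrite -[LHS]/#|[pred la | hstrip ka la a && hstrip mu la b]|.
  have := local_rule le e; under [X in _ = X -> _]eq_bigr => k _.
    rewrite (@eq_card _ _ [pred rh | hstrip rh ka (b - k) && hstrip rh mu (a - k)]); last by move=> rh; rewrite !inE andbC.
    over.
  by move=> <-; apply: eq_card => la; rewrite !inE andbC.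
rewrite eq_card0 => [|la]; last first.
  by rewrite !inE; apply/negP => /andP[/hstripP[_ e1] /hstripP[_ e2]]; lia.
rewrite big1 // => k _; rewrite eq_card0 // => rh.
rewrite !inE; apply/negP => /andP[/hstripP[_ e1] /hstripP[_ e2]].
by have := ltn_ord k; lia.
Qed.

(** Rows are chosen one after the other, the rest of the column sums being passed
    on. *)
Fixpoint margin_mats (al be : seq nat) : seq (seq (seq nat)) :=
  if al is a :: al' then [seq r :: M | r <- subcontents be a, M <- margin_mats al' (cremove be r)]
  else if sumn be == 0 then [:: [::]] else [::].

Lemma sumn_cremove be r : sumn (cremove be r) <= sumn be.
Proof. by elim: be r => [|b be IH] r //=; have := IH (behead r); lia. Qed.

(** The recursion of [margin_mats] on its rows is the adjoint form of
    [kostka_down]. *)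
Lemma kostka_pairing al be : sumn be <= n -> \sum_la kostka al la * kostka be la = size (margin_mats al be).
Proof.
elim: al be => [|a al IH] be sb /=.
  rewrite (bigD1 empty_shape) //= weight_eq0 eqxx mul1n big1 ?addn0 => [|la]; last first.
    by rewrite weight_eq0 => /negPf->.
  by rewrite kostka_empty; case: eqP.
rewrite size_allpairs_dep.
under eq_bigr => la _ do rewrite big_distrl /=.
rewrite (exchange_big_dep predT) //=.
rewrite sumnE big_map; under [RHS]eq_bigr => r _ do rewrite -IH ?(leq_trans (sumn_cremove _ _)) //.
rewrite [RHS]exchange_big /=; apply: eq_bigr => mu _.
by rewrite -!big_distrr /= kostka_down.
Qed.
End Kostka.

(** * Unitriangularity of the Kostka numbers *)

Section Lst.
Variable A : Type.
(** Contents are listed from the largest letter down, since [kostka] starts with the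
    last strip. *)
Fixpoint downfrom k (c : nat -> A) : seq A := if k is k'.+1 then c k' :: downfrom k' c else [::].
Lemma eq_downfrom k c c' : (forall i, i < k -> c i = c' i) -> downfrom k c = downfrom k c'.
Proof. by elim: k => //= k IH e; rewrite e // IH // => i hi; apply: e; apply: ltnW. Qed.
Lemma downfrom_inj k c c' : downfrom k c = downfrom k c' -> forall i, i < k -> c i = c' i.
Proof.
elim: k => //= k IH [e0 /IH e] i; rewrite ltnS leq_eqVlt => /orP[/eqP->//|]; exact: e.
Qed.
End Lst.

Lemma sumn_downfrom k c : sumn (downfrom k c) = \sum_(i < k) c i.
Proof. by elim: k => [|k IH] /=; rewrite ?big_ord0 // big_ord_recr /= IH addnC. Qed.

Section Triangular.
Variable n : nat.
Local Notation shape := (shape n).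
Local Notation sm := (total n).
Implicit Types la mu : shape.

Definition partial_sum la j := \sum_(i < j) rowlen la i.
(** Any monotone function of the partial sums that is strictly monotone for the
    dominance order would do. *)
Definition rank la := \sum_(j < n.+2) partial_sum la j.
Definition content_of la := downfrom n.+1 (rowlen la).

Lemma sum_stable f k N : (forall i, k <= i -> f i = 0) -> k <= N -> \sum_(i < N) f i = \sum_(i < k) f i.
Proof.
move=> f0 /subnKC <-; elim: (N - k) => [|d IH]; first by rewrite addn0.
by rewrite addnS big_ord_recr /= IH f0 ?addn0 ?leq_addr.
Qed.

Lemma partial_sum_all la k : (forall i, k <= i -> rowlen la i = 0) -> partial_sum la k = weight la.
Proof.
move=> h; rewrite /partial_sum /weight /total -(sum_stable h (leq_maxl k n.+1)).
by apply: sum_stable (leq_maxr _ _) => i hi; rewrite rowlen_ge.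
Qed.

Lemma kostka_strip b be la : kostka (b :: be) la != 0 -> exists2 mu, hstrip mu la b & kostka be mu != 0.
Proof.
rewrite /= sum_nat_eq0 negb_forall => /existsP[mu]; rewrite negb_imply => /andP[].
by exists mu.
Qed.

Lemma kostka_rows al la : kostka al la != 0 -> forall i, size al <= i -> rowlen la i = 0.
Proof.
elim: al la => [|b al IH] la.
  by rewrite /= eqb0 negbK weight_eq0 => /eqP-> i _; rewrite rowlen_empty.
case/kostka_strip => mu /hstripP[h _] k [|i] //= hi; have := h i.
by rewrite (IH _ k) //; lia.
Qed.

(** A chain of j strips has at most j rows, so the first j rows of la contain all
    its cells with letters below j. *)
Lemma kostka_dom k c la : kostka (downfrom k c) la != 0 ->
  forall j, j <= k -> \sum_(i < j) c i <= partial_sum la j.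
Proof.
have sz K : size (downfrom K c) = K by elim: K => //= K ->.
elim: k la => [|k IH] la kn j; first by rewrite leqn0 => /eqP->; rewrite big_ord0.
rewrite leq_eqVlt => /orP[/eqP->|].
  by rewrite partial_sum_all ?(kostka_sum kn) ?sumn_downfrom // => i hi; apply: (kostka_rows kn); rewrite sz.
rewrite ltnS => hj; have [mu /hstripP[h _] kn'] := kostka_strip kn.
apply: leq_trans (IH _ kn' _ hj) _; apply: leq_sum => i _; exact: (h i).1.
Qed.

Definition first_rows k la : shape := mk_shape n (fun i => if i < k then rowlen la i else 0).
Lemma rowlen_first_rows k la i : rowlen (first_rows k la) i = if i < k then rowlen la i else 0.
Proof.
rewrite rowlen_mk_shape // => j; first by case: ifP => // _; apply: rowlen_le.
by move=> hj; rewrite rowlen_ge // if_same.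
Qed.

Lemma weight_first_rows k la : weight (first_rows k la) = partial_sum la k.
Proof.
rewrite -(@partial_sum_all _ k) => [|i hi]; last by rewrite rowlen_first_rows ltnNge hi.
by apply: eq_bigr => i _; rewrite rowlen_first_rows ltn_ord.
Qed.

Lemma kostka_first_rows k la : (forall i, rowlen la i.+1 <= rowlen la i) ->
  kostka (downfrom k (rowlen la)) (first_rows k la) = 1.
Proof.
move=> dec; elim: k => [|k IH].
  by rewrite /= weight_first_rows /partial_sum big_ord0.
rewrite /= (bigD1 (first_rows k la)) /=.
  rewrite IH big1 // => mu /andP[/hstripP[h _] ne].
  apply/eqP/negPn/negP => kn; case/eqP: ne.
  have le i : rowlen mu i <= rowlen (first_rows k la) i.
    rewrite rowlen_first_rows; case: ltnP => hi; last first.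
      rewrite (kostka_rows kn) //; suff -> : size (downfrom k (rowlen la)) = k by [].
      by elim: (k) => //= K ->.
    by have := h i; rewrite !rowlen_first_rows; case: ifP => //; lia.
  apply: rowlen_inj => i; case: (ltnP n i) => hi; first by rewrite !rowlen_ge.
  apply: (@total_eq n _ _ le) => //; rewrite -/(weight mu) -/(weight (first_rows k la)).
  by rewrite (kostka_sum kn) sumn_downfrom weight_first_rows.
apply/hstripP; split=> [i|]; last by rewrite !weight_first_rows /partial_sum big_ord_recr.
by rewrite !rowlen_first_rows; have := dec i; case: (ltnP i k); case: (ltnP i k.+1); case: (ltnP i.+1 k.+1); lia.
Qed.

Lemma kostka_self la : (forall i, rowlen la i.+1 <= rowlen la i) -> kostka (content_of la) la = 1.
Proof.
move=> dec; rewrite -(kostka_first_rows n.+1 dec); congr kostka; apply: rowlen_inj => i.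
by rewrite rowlen_first_rows; case: ltnP => // hi; rewrite rowlen_ge.
Qed.

(** Dominance with equal ranks is equality. *)
Lemma kostka_triangular la mu : kostka (content_of la) mu != 0 -> mu = la \/ rank la < rank mu.
Proof.
move=> /kostka_dom dom.
have st nu j : n.+1 <= j -> partial_sum nu j = partial_sum nu n.+1.
  by apply: (@sum_stable (rowlen nu)) => i; apply: rowlen_ge.
have le j : partial_sum la j <= partial_sum mu j.
  case: (leqP j n.+1) => hj; first exact: dom.
  by rewrite !(st _ _ (ltnW hj)) dom.
have [e|ne] := eqVneq (rank la) (rank mu); [left | right]; last first.
  rewrite ltn_neqAle ne; apply: (@leq_sum _ (index_enum 'I_n.+2) predT (partial_sum la) (partial_sum mu)) => j _.
  exact: le.
have ep := @total_eq n.+1 _ _ le e.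
apply: rowlen_inj => i; case: (ltnP n i) => hi; first by rewrite !rowlen_ge.
have := ep i.+1 hi; have := ep i (ltnW (hi : i < n.+1)); rewrite /partial_sum !big_ord_recr /=; lia.
Qed.
End Triangular.

(** * Integer matrices with given margins *)

Section Matrices.

Lemma subcontents_downfrom l b f : (forall j, j < l -> f j <= b j) ->
  downfrom l f \in subcontents (downfrom l b) (\sum_(j < l) f j).
Proof.
elim: l => [|l IH] h; first by rewrite big_ord0.
rewrite [downfrom _ b]/= subcontents_cons; apply/allpairsPdep; exists (f l), (downfrom l f); split=> //.
  rewrite mem_index_iota big_ord_recr /=; have := h l (leqnn _); lia.
by rewrite big_ord_recr /= addnK IH // => j hj; apply: h; apply: ltnW.
Qed.

Lemma cremove_downfrom l b f : cremove (downfrom l b) (downfrom l f) = downfrom l (fun j => b j - f j).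
Proof. by elim: l => //= l ->. Qed.

Lemma subcontents_inv l b a r : r \in subcontents (downfrom l b) a ->
  exists f, [/\ r = downfrom l f, forall j, j < l -> f j <= b j & \sum_(j < l) f j = a].
Proof.
elim: l a r => [|l IH] a r.
  rewrite /=; case: eqP => // -> ; rewrite inE => /eqP->.
  by exists (fun=> 0); split; rewrite ?big_ord0.
rewrite [downfrom _ b]/= subcontents_cons => /allpairsPdep[x [r' [hx /IH[f [-> fb sf]] ->]]].
exists (fun j => if j == l then x else f j); split=> /=.
- by rewrite eqxx; congr cons; apply: eq_downfrom => i hi; rewrite ltn_eqF.
- move=> j; rewrite ltnS leq_eqVlt; case: eqP => [->|_] /= hj; last exact: fb.
  by move: hx; rewrite mem_index_iota; lia.
rewrite big_ord_recr /= eqxx (eq_bigr (fun j : 'I_l => f j)) => [|j _]; last by rewrite ltn_eqF.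
by move: hx; rewrite sf mem_index_iota; lia.
Qed.

Lemma subcontents_uniq be a : uniq (subcontents be a).
Proof.
elim: be a => [|b be IH] a; first by rewrite /=; case: ifP.
rewrite subcontents_cons; apply: allpairs_uniq_dep => [|k _|]; rewrite ?iota_uniq //.
by move=> [k r] [k' r'] _ _ /= [<- <-].
Qed.

Lemma margin_mats_uniq al be : uniq (margin_mats al be).
Proof.
elim: al be => [|a al IH] be; first by rewrite /=; case: ifP.
apply: allpairs_uniq_dep => [|k _|]; rewrite ?subcontents_uniq //.
by move=> [k r] [k' r'] _ _ /= [<- <-].
Qed.

Lemma margin_mats_mem k l (F : nat -> nat -> nat) :
  downfrom k (fun i => downfrom l (F i)) \in
    margin_mats (downfrom k (fun i => \sum_(j < l) F i j)) (downfrom l (fun j => \sum_(i < k) F i j)).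
Proof.
elim: k => [|k IH].
  rewrite /= sumn_downfrom big1 ?inE // => j _; by rewrite big_ord0.
apply/allpairsPdep; exists (downfrom l (F k)), (downfrom k (fun i => downfrom l (F i))); split=> //.
  by apply: subcontents_downfrom => j _; rewrite big_ord_recr leq_addl.
rewrite cremove_downfrom (_ : downfrom l _ = downfrom l (fun j => \sum_(i < k) F i j)) //.
by apply: eq_downfrom => j _; rewrite big_ord_recr /= addnK.
Qed.

Lemma margin_mats_inv k l ca cb M : M \in margin_mats (downfrom k ca) (downfrom l cb) ->
  exists F, [/\ M = downfrom k (fun i => downfrom l (F i)),
    forall i, i < k -> ca i = \sum_(j < l) F i j &
    forall j, j < l -> cb j = \sum_(i < k) F i j].
Proof.
elim: k cb M => [|k IH] cb M.
  rewrite /= sumn_downfrom; case: eqP => // e; rewrite inE => /eqP->.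
  exists (fun _ _ => 0); split=> // j hj; rewrite big_ord0.
  by move/eqP: e; rewrite sum_nat_eq0 => /forallP/(_ (Ordinal hj)) /= /eqP.
case/allpairsPdep => r [M' [/subcontents_inv[f [-> fb sf]]]].
rewrite cremove_downfrom => /IH[F [-> Fa Fb] ->].
exists (fun i => if i == k then f else F i); split=> /=.
- by rewrite eqxx; congr cons; apply: eq_downfrom => i hi; rewrite ltn_eqF.
- by move=> i; rewrite ltnS leq_eqVlt; case: eqP => [->|_] //=; apply: Fa.
move=> j hj; rewrite big_ord_recr /= eqxx.
rewrite (eq_bigr (fun i : 'I_k => F i j)) => [|i _]; last by rewrite ltn_eqF.
by rewrite -Fb // subnK ?fb.
Qed.
End Matrices.

Section Content.
Variable n : nat.

Lemma card_codom (X : eqType) (w : 'I_n -> X) x : #|[pred p | w p == x]| = count_mem x (codom w).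
Proof. by rewrite /codom /image_mem count_map cardE size_filter enumT; apply: eq_count => p; rewrite !inE. Qed.

Lemma same_content (X : eqType) (w w' : 'I_n -> X) :
  (forall x, #|[pred p | w p == x]| = #|[pred p | w' p == x]|) ->
  exists s : 'S_n, forall p, w' p = w (s p).
Proof.
move=> e.
have : perm_eq [tuple w' p | p < n] [tuple w p | p < n].
  apply/allP => x _ /=; rewrite -/(codom w) -/(codom w').
  by rewrite -!card_codom e.
move/tuple_permP => [s es]; exists s => p.
have : [tuple w' p | p < n] = [tuple tnth [tuple w p | p < n] (s i) | i < n] by apply: val_inj.
by move/(congr1 (fun t => tnth t p)); rewrite !tnth_mktuple.
Qed.

Lemma exists_word_count (X : finType) (c : X -> nat) : \sum_x c x = n ->
  exists z : 'I_n -> X, forall x, #|[pred p | z p == x]| = c x.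
Proof.
move=> cn; pose s := flatten [seq nseq (c x) x | x <- index_enum X].
have sz : size s == n.
  rewrite size_flatten /shape sumnE !big_map -[X in _ == X]cn /=.
  by apply/eqP/eq_bigr => x _; rewrite /= size_nseq.
exists (tnth (Tuple sz)) => x.
rewrite card_codom codomE map_tnth_enum /= count_flatten sumnE !big_map /=.
rewrite (bigD1 x) //= count_nseq /= eqxx mul1n big1 ?addn0 // => y /negPf yx.
by rewrite count_nseq /= yx.
Qed.
End Content.

(** * Permutation characters on words *)

Local Open Scope ring_scope.

Section Orbits.
Variable n : nat.
Local Notation G := [set: 'S_n].
Implicit Types u v : {ffun 'I_n -> nat}.

Definition permchar u : 'CF(G) := 'Ind[G, stab u] 1.

Definition perm_act u (t : orbit_of u) (g : 'S_n) : orbit_of u := place u (g^-1 * perm_of t)%g.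

Lemma perm_act_place u s g : perm_act (place u s) g = place u (g^-1 * s)%g.
Proof. by apply: letter_inj => p; rewrite /perm_act !letter_place !permM -!letter_place perm_ofK. Qed.

Lemma letter_act u (t : orbit_of u) g p : letter (perm_act t g) p = letter t ((g^-1)%g p).
Proof. by rewrite -(perm_ofK t) perm_act_place !letter_place permM. Qed.

(** The induced character counts the fixed words, since the permutations carrying u
    to a given word form a coset of the stabilizer. *)
Lemma permchar_fix u g : permchar u g = #|[pred t : orbit_of u | perm_act t g == t]|%:R.
Proof.
have KT : stab u \subset G by apply: subsetT.
rewrite cfIndE // (eq_bigr (fun y => (perm_act (place u y) g == place u y)%:R)); last first.
  move=> y _; rewrite cfun1E perm_act_place; congr (_%:R : algC); congr nat_of_bool.
  apply/idP/eqP => [k|e].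
    rewrite -(place_stab _ k); congr (place u _).
    by rewrite conjgE !mulgA mulgK mulVg mul1g.
  by have := place_eq e; rewrite invMg invgK conjgE mulgA.
have -> : #|[pred t : orbit_of u | perm_act t g == t]|%:R = \sum_(t : orbit_of u) (perm_act t g == t)%:R :> algC.
  rewrite -sum1_card natr_sum [LHS]big_mkcond; apply: eq_bigr => t _.
  by rewrite !inE; case: (perm_act t g == t).
rewrite (partition_big (place u) predT) //= mulr_sumr.
 apply: eq_bigr => t _.
rewrite (eq_bigr (fun=> (perm_act t g == t)%:R)) => [|y /andP[_ /eqP->//]].
rewrite sumr_const.
have -> : #|[pred y | (y \in G) && (place u y == t)]| = #|stab u|.
  rewrite -(card_lcoset (stab u) (perm_of t)); apply: eq_card => y; rewrite !inE /= mem_lcoset.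
  apply/eqP/idP => [e|k]; first by apply: place_eq; rewrite perm_ofK.
  by rewrite -(mulKVg (perm_of t) y) place_stab // perm_ofK.
by rewrite -[X in _^-1 * X]mulr_natr mulrCA mulVf ?mulr1 // pnatr_eq0 -lt0n cardG_gt0.
Qed.

Section Pair.
Variables u v : {ffun 'I_n -> nat}.
Definition pair_act (t : orbit_of u * orbit_of v) (g : 'S_n) := (perm_act t.1 g, perm_act t.2 g).
Fact pair_act_action : is_action G pair_act.
Proof.
split=> [g [t1 t2] [r1 r2] e|[t1 t2] g k _ _].
  congr pair; apply: letter_inj => p.
    by have := congr1 (fun t : orbit_of u * orbit_of v => letter t.1 (g p)) e; rewrite /= !letter_act permK.
  by have := congr1 (fun t : orbit_of u * orbit_of v => letter t.2 (g p)) e; rewrite /= !letter_act permK.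
by congr pair; apply: letter_inj => p; rewrite !letter_act invMg permM.
Qed.
Canonical pair_action := Action pair_act_action.

(** Burnside's lemma for pairs of words. *)
Lemma permchar_orbits : '[permchar u, permchar v] = #|orbit pair_action G @: [set: orbit_of u * orbit_of v]|%:R.
Proof.
have := @Frobenius_Cauchy _ _ _ pair_action G [set: orbit_of u * orbit_of v].
have -> : [acts G, on [set: orbit_of u * orbit_of v] | pair_action].
  by apply/actsP => g _ t; rewrite !inE.
move=> /(_ isT) E; rewrite cfdotE.
apply: (mulfI (_ : #|G|%:R != 0)); first by rewrite pnatr_eq0 -lt0n cardG_gt0.
rewrite mulrA mulfV ?mul1r; last by rewrite pnatr_eq0 -lt0n cardG_gt0.
rewrite -natrM mulnC -E natr_sum; apply: eq_bigr => g _.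
rewrite !permchar_fix rmorph_nat -natrM -cardX; congr _%:R; apply: eq_card => -[t1 t2].
rewrite setTI inE /=; apply/andP/afix1P => [[/eqP e1 /eqP e2]|e].
  by rewrite /= /pair_act e1 e2.
by split; apply/eqP; [exact: (congr1 fst e) | exact: (congr1 snd e)].
Qed.

Lemma orbit_pair_actP (t r : orbit_of u * orbit_of v) :
  reflect (exists s : 'S_n, forall p, letter r.1 p = letter t.1 (s p) /\ letter r.2 p = letter t.2 (s p))
    (orbit pair_action G t == orbit pair_action G r).
Proof.
rewrite eq_sym; apply: (iffP eqP) => [/orbit_eqP /orbitP[g _ <-]|[s e]].
  by exists (g^-1)%g => p; rewrite /= /pair_act !letter_act.
apply/orbit_eqP/orbitP; exists (s^-1)%g => //; rewrite /= /pair_act [r]surjective_pairing.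
by congr pair; apply: letter_inj => p; rewrite letter_act invgK; have [] := e p.
Qed.
End Pair.

Definition content k (w : 'I_n -> nat) := downfrom k (fun i => #|[pred p | w p == i]|).

Lemma mem_words_content u (w : {ffun 'I_n -> nat}) :
  (forall i, #|[pred p | u p == i]| = #|[pred p | w p == i]|) -> w \in words u.
Proof.
case/same_content => s e; suff -> : w = word u s by apply: mem_words.
by apply/ffunP => p; rewrite ffunE.
Qed.

Lemma card_letter u (t : orbit_of u) i : #|[pred p | letter t p == i]| = #|[pred p | u p == i]|.
Proof.
rewrite -(perm_ofK t) -!sum1_card [RHS](reindex_inj (@perm_inj _ (perm_of t))).
by apply: eq_bigl => p; rewrite !inE letter_place.
Qed.

Lemma card_image (T U : finType) (X : eqType) (f : T -> U) (g : T -> X) :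
  (forall x y, (f x == f y) = (g x == g y)) -> #|f @: [set: T]| = size (undup [seq g x | x <- enum T]).
Proof.
move=> e; rewrite (_ : #|_| = size (undup [seq f x | x <- enum T])).
  elim: (enum T) => //= x s IH.
  suff -> : (f x \in map f s) = (g x \in map g s) by case: ifP => //= _; rewrite IH.
  by apply/mapP/mapP => -[y ys /eqP h]; exists y => //; apply/eqP; rewrite ?e -?e // e.
have /card_uniqP <- := undup_uniq [seq f x | x <- enum T].
apply: eq_card => y; rewrite mem_undup.
apply/imsetP/mapP => [[x _ ->]|[x _ ->]]; exists x => //; first by rewrite mem_enum.
Qed.

Lemma sum_card_fiber (D : pred 'I_n) (w : 'I_n -> nat) l : (forall p, w p < l)%N ->
  #|D| = (\sum_(j < l) #|[pred p | D p & w p == j]|)%N.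
Proof.
move=> wl; rewrite -sum1_card (partition_big (fun p => Ordinal (wl p)) predT) //=.
by apply: eq_bigr => j _; rewrite -sum1_card; apply: eq_bigl => p; rewrite !inE -val_eqE.
Qed.

Lemma card_letter0 (w : {ffun 'I_n -> nat}) k i : (forall p, w p < k)%N -> (k <= i)%N -> #|[pred p | w p == i]| = 0%N.
Proof. by move=> wk ki; apply: eq_card0 => p; rewrite !inE ltn_eqF // (leq_trans (wk p) ki). Qed.

Section Gram.
Variables (u v : {ffun 'I_n -> nat}) (k l : nat).
Hypothesis uk : forall p, (u p < k)%N.
Hypothesis vl : forall p, (v p < l)%N.

Definition joint_count (t : orbit_of u * orbit_of v) i j := #|[pred p | (letter t.1 p == i) && (letter t.2 p == j)]|.
(** It determines the pair of words up to simultaneous permutation. *)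
Definition joint_mat t := downfrom k (fun i => downfrom l (joint_count t i)).

Lemma letter_bound (w : {ffun 'I_n -> nat}) (t : orbit_of w) m : (forall p, w p < m)%N -> forall p, (letter t p < m)%N.
Proof. by move=> wm p; rewrite -(perm_ofK t) letter_place. Qed.

Lemma joint_mat_margins t : joint_mat t \in margin_mats (content k u) (content l v).
Proof.
have -> : content k u = downfrom k (fun i => \sum_(j < l) joint_count t i j)%N.
  apply: eq_downfrom => i _; rewrite -(card_letter t.1); exact: (sum_card_fiber _ (letter_bound t.2 vl)).
have -> : content l v = downfrom l (fun j => \sum_(i < k) joint_count t i j)%N.
  apply: eq_downfrom => j _; rewrite -(card_letter t.2) (sum_card_fiber _ (letter_bound t.1 uk)).
  by apply: eq_bigr => i _; apply: eq_card => p; rewrite !inE andbC.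
exact: margin_mats_mem.
Qed.

Lemma margins_joint_mat M : M \in margin_mats (content k u) (content l v) -> exists t, M = joint_mat t.
Proof.
move=> /margin_mats_inv[F [-> Fa Fb]].
have sn : (\sum_(x : 'I_k * 'I_l) F x.1 x.2 = n)%N.
  rewrite -(pair_bigA _ (fun (i : 'I_k) (j : 'I_l) => F i j)) /=.
  rewrite -[RHS]card_ord (sum_card_fiber _ uk); apply: eq_bigr => i _; rewrite -Fa //.
have [z zP] := exists_word_count sn.
have c1 (i : 'I_k) : #|[pred p | (z p).1 == i]| = (\sum_(j < l) F i j)%N.
  rewrite (@sum_card_fiber _ (fun p => (z p).2) l) => [|p]; last exact: ltn_ord.
  apply: eq_bigr => j _; rewrite -(zP (i, j)); apply: eq_card => p; rewrite !inE.
  by [].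
have c2 (j : 'I_l) : #|[pred p | (z p).2 == j]| = (\sum_(i < k) F i j)%N.
  rewrite (@sum_card_fiber _ (fun p => (z p).1) k) => [|p]; last exact: ltn_ord.
  apply: eq_bigr => i _; rewrite -(zP (i, j)); apply: eq_card => p; rewrite !inE andbC.
  by [].
pose w1 : {ffun 'I_n -> nat} := [ffun p => val (z p).1].
pose w2 : {ffun 'I_n -> nat} := [ffun p => val (z p).2].
have m1 : w1 \in words u.
  apply: mem_words_content => i; case: (ltnP i k) => hi.
    rewrite (Fa i hi) -(c1 (Ordinal hi)); apply: eq_card => p; rewrite !inE ffunE -val_eqE //.
  by rewrite (card_letter0 uk hi) (@card_letter0 w1 _ _ _ hi) // => p; rewrite ffunE ltn_ord.
have m2 : w2 \in words v.
  apply: mem_words_content => i; case: (ltnP i l) => hi.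
    rewrite (Fb i hi) -(c2 (Ordinal hi)); apply: eq_card => p; rewrite !inE ffunE -val_eqE //.
  by rewrite (card_letter0 vl hi) (@card_letter0 w2 _ _ _ hi) // => p; rewrite ffunE ltn_ord.
exists (SeqSub m1, SeqSub m2); apply: eq_downfrom => i hi; apply: eq_downfrom => j hj.
rewrite -(zP (Ordinal hi, Ordinal hj)); apply: eq_card => p; rewrite !inE /letter /= !ffunE.
by [].
Qed.

Lemma gram : '[permchar u, permchar v] = (\sum_(la : shape n) kostka (content k u) la * kostka (content l v) la)%:R.
Proof.
have sv : sumn (content l v) = n.
  rewrite sumn_downfrom -[RHS]card_ord (sum_card_fiber _ vl).
  by apply: eq_bigr => i _; apply: eq_card => p; rewrite !inE.
rewrite kostka_pairing ?sv // permchar_orbits; congr _%:R.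
rewrite (card_image (g := joint_mat)) => [|t r]; last first.
  apply/orbit_pair_actP/eqP => [[s e]|e].
    apply: eq_downfrom => i _; apply: eq_downfrom => j _.
    rewrite /joint_count -!sum1_card (reindex_inj (@perm_inj _ s)).
    by apply: eq_bigl => p; rewrite !inE; have [-> ->] := e p.
  have [s es] : exists s : 'S_n, forall p, (letter r.1 p, letter r.2 p) = (letter t.1 (s p), letter t.2 (s p)).
    apply: (@same_content _ _ (fun p => (letter t.1 p, letter t.2 p))) => -[i j].
    case: (ltnP i k) => hi; last first.
      by rewrite !eq_card0 // => p; rewrite !inE xpair_eqE ltn_eqF // (leq_trans (letter_bound _ uk p) hi).
    case: (ltnP j l) => hj; last first.
      by rewrite !eq_card0 // => p; rewrite !inE xpair_eqE andbC ltn_eqF // (leq_trans (letter_bound _ vl p) hj).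
    exact: (downfrom_inj (downfrom_inj e hi) hj).
  by exists s => p; case: (es p).
apply/perm_size/uniq_perm; rewrite ?undup_uniq ?margin_mats_uniq // => M; rewrite mem_undup.
apply/mapP/idP => [[t _ ->]|/margins_joint_mat[t ->]]; first exact: joint_mat_margins.
by exists t => //; rewrite mem_enum.
Qed.
End Gram.
End Orbits.

(** * Irreducible characters and Kostka numbers *)

Arguments kostka : simpl never.

Section Frobenius.
Variable n : nat.
Local Notation G := [set: 'S_n].
Local Notation shape := (shape n).
Implicit Types la mu : shape.

Definition is_part la := [forall i : 'I_n.+1, rowlen la i.+1 <= rowlen la i]%N && (weight la == n).

Lemma is_partP la : reflect ((forall i, rowlen la i.+1 <= rowlen la i)%N /\ weight la = n) (is_part la).
Proof.
apply: (iffP andP) => [[/forallP h /eqP e]|[h e]]; split=> //; [|exact/forallP|exact/eqP].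
move=> i; case: (ltnP n i) => hi; first by rewrite !rowlen_ge // ltnW.
exact: (h (Ordinal (hi : (i < n.+1)%N))).
Qed.

Lemma kostka_is_part k (w : 'I_n -> nat) la : (forall p, w p < k)%N -> kostka (content k w) la != 0%N -> is_part la.
Proof.
move=> wk kn; apply/is_partP; split; first exact: kostka_dec kn.
rewrite (kostka_sum kn) sumn_downfrom -[RHS]card_ord (sum_card_fiber _ wk).
by apply: eq_bigr => i _; apply: eq_card => p; rewrite !inE.
Qed.

Lemma is_part_word la : exists w : {ffun 'I_n -> nat}, is_part la ->
  (forall p, w p < n.+1)%N /\ content n.+1 w = content_of la.
Proof.
case: (boolP (is_part la)) => [/is_partP[_ sz]|_]; last by exists [ffun=> 0%N].
have [z zP] := @exists_word_count n 'I_n.+1 (fun i => rowlen la i) sz.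
exists [ffun p => val (z p)] => _; split=> [p|]; first by rewrite ffunE ltn_ord.
apply: eq_downfrom => i hi; rewrite -(zP (Ordinal hi)); apply: eq_card => p.
by rewrite !inE ffunE -val_eqE.
Qed.

Definition max_rank := (\max_(la : shape) rank la)%N.
Lemma rank_le_max la : (rank la <= max_rank)%N.
Proof. exact: leq_bigmax. Qed.

(** Young's rule.  Defined by descending induction on the rank, s_la is the
    induced character of content la minus the K(mu, la) s_mu of larger rank.  Then
    the inner product of s_la with any induced character is a Kostka number, the
    s_la are orthonormal, hence irreducible up to sign, and the difference of the two
    sides of the claim has norm zero. *)
Theorem schur_basis : exists s : shape -> 'CF(G),
  [/\ forall la, is_part la -> s la \in irr G &
      forall k (u : {ffun 'I_n -> nat}), (forall p, u p < k)%N ->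
        permchar u = \sum_(la | is_part la) (kostka (content k u) la)%:R *: s la].
Proof.
have [w wP] := fin_all_exists is_part_word.
pose h la := permchar (w la).
have K1 la : is_part la -> kostka (content n.+1 (w la)) la = 1%N.
  by move=> pl; have [_ ->] := wP _ pl; apply: kostka_self; have /is_partP[] := pl.
have Kt la mu : is_part la -> kostka (content n.+1 (w la)) mu != 0%N -> mu = la \/ (rank la < rank mu)%N.
  by move=> pl; have [_ ->] := wP _ pl; apply: kostka_triangular.
(* the characters of rank at least N, constructed by induction on top minus N *)
have ex N : exists s : shape -> 'CF(G), forall la, is_part la -> (N <= rank la)%N ->
   s la = h la - \sum_(mu | is_part mu && (rank la < rank mu)%N) (kostka (content n.+1 (w la)) mu)%:R *: s mu.
  have [d MN] : exists d, (max_rank < d + N)%N by exists max_rank.+1; rewrite leq_addr.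
  elim: d N MN => [|d IH] N MN.
    exists (fun=> 0) => la _ Nl; have := rank_le_max la; lia.
  have [|s sP] := IH N.+1; first by rewrite addnS -addSn.
  exists (fun la => if (N < rank la)%N then s la else
    h la - \sum_(mu | is_part mu && (rank la < rank mu)%N) (kostka (content n.+1 (w la)) mu)%:R *: s mu).
  move=> la pl Nl; case: ifP => hr; first rewrite sP //.
    congr (_ - _); apply: eq_bigr => mu /andP[_ lm]; rewrite ifT //; lia.
  congr (_ - _); apply: eq_bigr => mu /andP[_ lm]; rewrite ifT //; lia.
have [s /(_ _ _ (leq0n _)) sP] := ex 0%N.
have hstrip la : is_part la -> h la = s la + \sum_(mu | is_part mu && (rank la < rank mu)%N) (kostka (content n.+1 (w la)) mu)%:R *: s mu.
  by move=> pl; rewrite {1}sP // subrK.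
have dot k (u : {ffun 'I_n -> nat}) : (forall p, u p < k)%N -> forall la, is_part la ->
    '[permchar u, s la] = (kostka (content k u) la)%:R.
  move=> uk la; move: {2}(max_rank - rank la)%N (erefl (max_rank - rank la)%N) => d.
  elim/ltn_ind: d la => d IH la dE pl; have [wl _] := wP _ pl.
  have g := gram uk wl.
  rewrite sP // cfdotBr g cfdot_sumr.
  rewrite (bigID is_part) /= [X in (_ + X)%N]big1 ?addn0 => [|mu np]; last first.
    by apply/eqP; rewrite muln_eq0; apply/orP; left; apply/eqP/eqP; apply: contraR np; apply: kostka_is_part uk.
  rewrite (bigD1 la) //= K1 // muln1 natrD -addrA; apply/eqP; rewrite -subr_eq0 addrAC subrr add0r subr_eq0 eq_sym; apply/eqP.
  rewrite natr_sum big_mkcond [RHS]big_mkcond; apply: eq_bigr => mu _.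
  case pm: (is_part mu) => //=; case: ifP => lm; case: eqVneq => [e|ne] //; first by rewrite e ltnn in lm.
    rewrite cfdotZr rmorph_nat natrM [RHS]mulrC; congr (_ * _); apply: (IH _ _ mu (erefl _) pm).
    by have := rank_le_max mu; have := rank_le_max la; lia.
  have [->|kn] := eqVneq (kostka (content n.+1 (w la)) mu) 0%N; first by rewrite muln0.
  by have [e|] := Kt _ _ pl kn; [rewrite e eqxx in ne | rewrite lm].
(* expand the induced character of content la by the recursion for s_la *)
have orth la mu : is_part la -> is_part mu -> '[s la, s mu] = (la == mu)%:R.
  move: {2}(max_rank - rank la)%N (erefl (max_rank - rank la)%N) => d.
  elim/ltn_ind: d la => d IH la dE pl pm; have [wl _] := wP _ pl.
  have := dot _ _ wl _ pm; rewrite -/(h la) (hstrip la pl) cfdotDl cfdot_suml => /eqP.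
  rewrite eq_sym -subr_eq => /eqP <-.
  have [e|ne] := eqVneq la mu.
    rewrite e in pl wl *; rewrite K1 // big1 ?subr0 // => nu /andP[pn ln].
    rewrite cfdotZl (IH _ _ nu (erefl _) pn pm); last first.
      by have := rank_le_max nu; have := rank_le_max la; rewrite e in dE *; lia.
    by case: eqVneq => [e'|_]; [rewrite e' ltnn in ln | rewrite mulr0].
  case: (boolP (rank la < rank mu)%N) => lm.
    rewrite (bigD1 mu) /= ?pm // cfdotZl (IH _ _ mu (erefl _) pm pm) ?eqxx ?mulr1; last first.
      by have := rank_le_max mu; have := rank_le_max la; lia.
    rewrite big1 ?addr0 ?subrr // => nu /andP[/andP[pn ln] /negPf nm].
    rewrite cfdotZl (IH _ _ nu (erefl _) pn pm) ?nm ?mulr0 //.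
    by have := rank_le_max nu; have := rank_le_max la; lia.
  have -> : kostka (content n.+1 (w la)) mu = 0%N.
    apply/eqP/negPn/negP => kn; have [e|] := Kt _ _ pl kn; last exact/negP.
    by rewrite e eqxx in ne.
  rewrite big1 ?subrr // => nu /andP[pn ln].
  rewrite cfdotZl (IH _ _ nu (erefl _) pn pm); last first.
    by have := rank_le_max nu; have := rank_le_max la; lia.
  by case: eqVneq => [e|_]; [rewrite -e ln in lm | rewrite mulr0].
have hchar u : permchar u \is a character by apply: cfInd_char; apply: cfun1_char.
have sZ la : is_part la -> s la \in ('Z[irr G])%g.
  move: {2}(max_rank - rank la)%N (erefl (max_rank - rank la)%N) => d.
  elim/ltn_ind: d la => d IH la dE pl; rewrite sP // rpredB //; first exact/char_vchar/hchar.
  apply: rpred_sum => mu /andP[pm lm]; rewrite scaler_nat rpredMn //.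
  apply: (IH _ _ mu (erefl _) pm).
  by have := rank_le_max mu; have := rank_le_max la; lia.
exists s; split=> [la pl|k u uk].
  have n1 : '[s la] = 1 by rewrite orth // eqxx.
  have [b [i sE]] := vchar_norm1P (sZ _ pl) n1.
  have [wl _] := wP _ pl.
  have := dot _ _ wl _ pl; rewrite K1 // sE cfdotZr rmorph_sign.
  case: b {sE} => /=; last by rewrite expr0 scale1r mem_irr.
  (* the sign is positive, since s_la occurs once in an induced character *)
  have : 0 <= '[permchar (w la), 'chi_i] by apply/natr_ge0/Cnat_cfdot_char => //; apply: irr_char.
  by rewrite expr1 mulN1r => p e; rewrite -oppr_le0 e ler10 in p.
have gu : '[permchar u] = \sum_(la | is_part la) (kostka (content k u) la)%:R * (kostka (content k u) la)%:R.
  rewrite (gram uk uk) natr_sum (bigID is_part) /= [X in _ + X]big1 ?addr0 => [|mu np]; last first.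
    by rewrite natrM (_ : kostka _ _ = 0%N) ?mul0r //; apply/eqP; apply: contraR np; apply: kostka_is_part uk.
  by apply: eq_bigr => la _; rewrite natrM.
apply/eqP; rewrite -subr_eq0 -cfnorm_eq0 cfnormB gu.
set Q := \sum_(_ | _) _ *: _.
have -> : '[permchar u, Q] = \sum_(la | is_part la) (kostka (content k u) la)%:R * (kostka (content k u) la)%:R.
  by rewrite cfdot_sumr; apply: eq_bigr => la pl; rewrite cfdotZr rmorph_nat (dot _ _ uk).
have -> : '[Q] = \sum_(la | is_part la) (kostka (content k u) la)%:R * (kostka (content k u) la)%:R.
  rewrite {2}/Q cfdot_sumr; apply: eq_bigr => la pl; rewrite cfdotZr rmorph_nat; congr (_ * _).
  rewrite cfdot_suml (bigD1 la) //= cfdotZl orth // eqxx mulr1 big1 ?addr0 // => mu /andP[pm /negPf ne].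
  by rewrite cfdotZl orth // ne mulr0.
set x := \sum_(_ | _) _.
have -> : x^* = x by rewrite rmorph_sum; apply: eq_bigr => la _; rewrite rmorphM rmorph_nat.
by rewrite subrr.
Qed.

Corollary character_kostka (chi : 'CF(G)) : chi \is a character ->
  exists c : shape -> nat, forall k (u : {ffun 'I_n -> nat}), (forall p, u p < k)%N ->
    '['Res[stab u] chi, 1] = (\sum_(la | is_part la) c la * kostka (content k u) la)%:R.
Proof.
move=> cchi; have [s [sirr hE]] := schur_basis.
exists (fun la => Num.truncn '[chi, s la]) => k u uk.
rewrite cfdot_Res_l -/(permchar u) (hE _ _ uk) cfdot_sumr natr_sum.
apply: eq_bigr => la pl; rewrite natrM Num.Theory.truncnK; last first.
  by have /irrP[i ->] := sirr _ pl; apply: Cnat_cfdot_char => //; apply: irr_char.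
by rewrite cfdotZr rmorph_nat mulrC.
Qed.
End Frobenius.

(** * Semistandard fillings *)

Local Close Scope ring_scope.

From mathcomp Require Import finmap monalg.

Lemma kostka_cons n b be (la : shape n) : kostka (b :: be) la = \sum_(mu | hstrip mu la b) kostka be mu.
Proof. by []. Qed.

Section Filling.
Variable n : nat.
Local Notation shape := (shape n).
Local Notation L := ('I_n.+1 * 'I_n.+1)%type.
Implicit Types la mu : shape.
(** The letter k stands for the cells outside of the shape, so that fillings of
    different shapes have the same type. *)
Definition filling k := {ffun L -> 'I_k.+1}.

Definition below k (T : filling k) c la := [forall x : L, (T x < c) == (x.2 < rowlen la x.1)].
(** The exception for the letter k lets columns leave the shape. *)
Definition increasing k (T : filling k) := [forall x : L, forall y : L,
  ((x.1 == y.1) && (x.2 < y.2) ==> (T x <= T y)) &&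
  ((x.2 == y.2) && (x.1 < y.1) ==> (T x < T y) || (T y == k :> nat))].
Definition letters_used k (T : filling k) (c : nat -> nat) := [forall i : 'I_k, #|[pred x | T x == i :> nat]| == c i].
Definition tableau k la c (T : filling k) := [&& below T k la, increasing T & letters_used T c].

Lemma belowP k (T : filling k) c la : reflect (forall x : L, (T x < c) = (x.2 < rowlen la x.1)) (below T c la).
Proof. by apply: (iffP forallP) => h x; [have /eqP := h x | rewrite h]. Qed.

Lemma increasingP k (T : filling k) : reflect (forall (i j : 'I_n.+1) (i' j' : 'I_n.+1),
    (j < j' -> T (i, j) <= T (i, j')) /\ (i < i' -> T (i, j) < T (i', j) \/ T (i', j) = k :> nat))
  (increasing T).
Proof.
apply: (iffP forallP) => [h i j i' j'|h [i j]].
  split=> hl.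
    by have /forallP/(_ (i, j'))/andP[/implyP + _] := h (i, j); apply; rewrite /= eqxx hl.
  have /forallP/(_ (i', j))/andP[_ /implyP H] := h (i, j).
  by have /orP[->|/eqP->] := H (introT andP (conj (eqxx _) hl)); [left | right].
apply/forallP => -[i' j'] /=; apply/andP; split; apply/implyP => /andP[/eqP <- hl].
  exact: (h i j i j').1.
by have [_ /(_ hl)[->|->]] := h i j i' j; rewrite ?eqxx ?orbT.
Qed.

Lemma letters_usedP k (T : filling k) c : reflect (forall i, i < k -> #|[pred x | T x == i :> nat]| = c i) (letters_used T c).
Proof.
apply: (iffP forallP) => [h i hi|h i]; last exact/eqP/h.
exact/eqP/(h (Ordinal hi)).
Qed.

Lemma card_below k (T : filling k) c la : below T c la -> #|[pred x | T x < c]| = weight la.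
Proof.
move=> /belowP h; rewrite (eq_card (B := [pred x : L | x.2 < rowlen la x.1])); last by move=> x; rewrite !inE h.
rewrite -sum1_card big_mkcond -(pair_bigA _ (fun i j : 'I_n.+1 => if j < rowlen la i then 1 else 0)) /=.
apply: eq_bigr => i _; rewrite -big_mkcond /= -(big_ord_widen_cond _ predT (fun=> 1)) ?sum1_card ?card_ord //.
exact/leqW/rowlen_le.
Qed.

Lemma card_le_S k (T : filling k) c :
  #|[pred x | T x < c.+1]| = #|[pred x | T x < c]| + #|[pred x | T x == c :> nat]|.
Proof.
rewrite -cardUI [X in _ = _ + X]eq_card0 ?addn0; last first.
  by move=> x; rewrite !inE; case: ltngtP.
by apply: eq_card => x; rewrite !inE ltnS leq_eqVlt orbC.
Qed.

Section Step.
Variables (k : nat) (la mu : shape) (c : nat -> nat).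

(** Forgetting the last letter k: its cells become cells outside of the shape. *)
Definition chop (T : filling k.+1) : filling k := [ffun x => inord (minn (T x) k)].
Definition extend (T : filling k) : filling k.+1 :=
  [ffun x : L => inord (if x.2 < rowlen mu x.1 then T x : nat else if x.2 < rowlen la x.1 then k else k.+1)].

Lemma chopE T x : chop T x = minn (T x) k :> nat.
Proof. by rewrite ffunE inordK // ltnS geq_minr. Qed.

Lemma extendE T (x : L) : extend T x = (if x.2 < rowlen mu x.1 then T x : nat else if x.2 < rowlen la x.1 then k else k.+1) :> nat.
Proof. by rewrite ffunE inordK //; have := ltn_ord (T x); case: ifP => _; [|case: ifP => _]; lia. Qed.

Lemma tableau_hstrip (T : filling k.+1) : tableau la c T -> below T k mu -> hstrip mu la (c k).
Proof.
move=> /and3P[bl /increasingP inc /letters_usedP us] bm; apply/hstripP; split; last first.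
  by rewrite -(card_below bl) -(card_below bm) -us // card_le_S.
move: bl bm => /belowP bl /belowP bm i; case: (ltnP n i) => hi; first by rewrite !rowlen_ge //; lia.
have hi' : i < n.+1 by [].
split.
  have [|r] := posnP (rowlen mu i); first by move->.
  have := rowlen_le mu i => rn; have hr : (rowlen mu i).-1 < n.+1 by lia.
  have := bl (Ordinal hi', Ordinal hr); have := bm (Ordinal hi', Ordinal hr).
  by rewrite /= prednK // leqnn => h1; rewrite ltnS (ltnW h1) => /esym.
have [|r] := posnP (rowlen la i.+1); first by move->.
have hi2 : i.+1 < n.+1 by rewrite ltnNge; apply/negP => h; rewrite rowlen_ge // in r.
have := rowlen_le la i.+1 => rn; have hr : (rowlen la i.+1).-1 < n.+1 by lia.
have := bl (Ordinal hi2, Ordinal hr); have := bm (Ordinal hi', Ordinal hr).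
rewrite /= prednK // leqnn => h1 h2; rewrite -h1.
have [_ /(_ (ltnSn i))] := inc (Ordinal hi') (Ordinal hr) (Ordinal hi2) (Ordinal hr).
by move=> [h|h]; lia.
Qed.

Hypothesis Hhs : hstrip mu la (c k).
Let hsb := proj1 (elimT (hstripP mu la (c k)) Hhs).

Lemma below_hstrip i j : j < rowlen mu i -> j < rowlen la i.
Proof. by have := hsb i; lia. Qed.

Lemma rowlen_mono i i' : i < i' -> rowlen la i' <= rowlen mu i.
Proof.
move=> h; suff : forall d, rowlen la (i + d).+1 <= rowlen mu i by move/(_ (i' - i.+1)); congr (_ <= _); congr rowlen; lia.
elim=> [|d IH]; first by rewrite addn0; have := hsb i; lia.
by have := hsb (i + d.+1); have := hsb (i + d).+1; rewrite addnS; lia.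
Qed.

Lemma extend_tableau T : tableau mu c T -> tableau la c (extend T) /\ below (extend T) k mu.
Proof.
move=> /and3P[/belowP bl /increasingP inc /letters_usedP us].
have be x : (extend T x < k) = (x.2 < rowlen mu x.1).
  by rewrite extendE; case: ifP => h; [rewrite bl h | case: ifP => _; rewrite ?ltnn // ltnNge leqnSn].
have ba x : (extend T x < k.+1) = (x.2 < rowlen la x.1).
  rewrite extendE; case: ifP => h; last by case: ifP => _; rewrite ?ltnn ?ltnSn.
  by rewrite ltn_ord (below_hstrip h).
split; last exact/belowP.
apply/and3P; split; first exact/belowP.
  apply/increasingP => i j i' j'; split=> hl; rewrite !extendE /=.
    case: (ltnP j' (rowlen mu i)) => h1.
      by rewrite (ltn_trans hl h1); apply: (inc i j i j').1.
    case: (ltnP j (rowlen mu i)) => h2.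
      by have := bl (i, j); rewrite /= h2; case: ifP; lia.
    by case: (ltnP j (rowlen la i)); case: (ltnP j' (rowlen la i)); lia.
  have hm := rowlen_mono hl.
  case: (ltnP j (rowlen mu i')) => h1.
    have h2 : j < rowlen mu i by have := below_hstrip h1; lia.
    rewrite h2; have [_ /(_ hl)[h|h]] := inc i j i' j; first by left.
    by have := bl (i', j); rewrite /= h1 h ltnn.
  case: (ltnP j (rowlen la i')) => h2; last by right.
  have h3 : j < rowlen mu i by lia.
  by rewrite h3; left; have := bl (i, j); rewrite /= h3.
apply/letters_usedP => i; rewrite ltnS leq_eqVlt => /orP[/eqP->|hi].
  have := proj2 (elimT (hstripP mu la (c k)) Hhs).
  have /card_below <- : below (extend T) k.+1 la by apply/belowP.
  have /card_below <- : below (extend T) k mu by apply/belowP.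
  by rewrite card_le_S => /addnI.
rewrite -us //; apply: eq_card => x; rewrite !inE extendE.
by have := bl x; case: ifP => h; rewrite ?h //; case: ifP => _; lia.
Qed.

Lemma chop_tableau T : tableau la c T -> below T k mu -> tableau mu c (chop T).
Proof.
move=> /and3P[/belowP bl /increasingP inc /letters_usedP us] /belowP bm; apply/and3P; split.
- by apply/belowP => x; rewrite chopE -bm; lia.
- apply/increasingP => i j i' j'; split=> hl; rewrite !chopE.
    by have := (inc i j i j').1 hl; lia.
  by case: ((inc i j i' j').2 hl); lia.
apply/letters_usedP => i hi; rewrite -us ?ltnS 1?ltnW //; apply: eq_card => x; rewrite !inE chopE; lia.
Qed.

Lemma extend_chop T : tableau la c T -> below T k mu -> extend (chop T) = T.
Proof.
move=> /and3P[/belowP bl _ _] /belowP bm; apply/ffunP => x; apply: val_inj; rewrite /= extendE chopE.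
by have := bl x; have := bm x; have := ltn_ord (T x); case: ifP => h; [|case: ifP => h']; lia.
Qed.

Lemma chop_extend T : tableau mu c T -> chop (extend T) = T.
Proof.
move=> /and3P[/belowP bl _ _]; apply/ffunP => x; apply: val_inj; rewrite /= chopE extendE.
by have := bl x; have := ltn_ord (T x); case: ifP => h; [|case: ifP => h']; lia.
Qed.

Lemma card_step : #|[pred T : filling k.+1 | tableau la c T & below T k mu]| = #|[pred T : filling k | tableau mu c T]|.
Proof.
rewrite -!sum1_card (reindex_onto extend chop) => [|T /andP[t b]]; last exact: extend_chop.
apply: eq_bigl => T; rewrite !inE; apply/andP/idP => [[/andP[t b] /eqP <-]|t]; first exact: chop_tableau.
by have [t1 b1] := extend_tableau t; rewrite t1 b1 chop_extend.
Qed.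
End Step.

Lemma exists_below k la c (T : filling k.+1) : tableau la c T -> exists mu : shape, below T k mu.
Proof.
move=> /and3P[/belowP bl /increasingP inc _].
have max_rank i : k <= T (i, ord_max).
  by have := bl (i, ord_max); rewrite /= [n < _]ltnNge rowlen_le /= => /negbT; lia.
pose f (i : 'I_n.+1) := find (fun j => k <= T (i, inord j)) (iota 0 n.+1).
have fn i : f i < n.+1.
  rewrite -[X in _ < X](size_iota 0) -has_find; apply/hasP; exists n; first by rewrite mem_iota leqnn.
  by rewrite (_ : inord n = ord_max) //; apply: val_inj; rewrite /= inordK.
exists [ffun i => inord (f i)].
apply/belowP => -[i j]; rewrite rowlen_ord ffunE inordK //=.
apply/idP/idP => h.
  rewrite ltnNge; apply/negP => hj.
  have hh : has (fun j => k <= T (i, inord j)) (iota 0 n.+1) by rewrite has_find size_iota fn.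
  have := nth_find 0 hh; rewrite -/(f i) nth_iota ?fn // add0n => h1.
  move: hj; rewrite leq_eqVlt => /orP[/eqP e|hj].
    by move: h1; rewrite e inord_val leqNgt h.
  have := (inc i (inord (f i)) i j).1; rewrite inordK // => /(_ hj); lia.
have := before_find 0 h; rewrite nth_iota // add0n inord_val => /negbT; lia.
Qed.

Lemma below_uniq k (T : filling k.+1) mu mu' : below T k mu -> below T k mu' -> mu = mu'.
Proof.
move=> /belowP b /belowP b'; apply: rowlen_inj => i; case: (ltnP n i) => hi; first by rewrite !rowlen_ge.
have e (j : nat) : j <= n -> (j < rowlen mu i) = (j < rowlen mu' i).
  move=> hj; have := b (Ordinal (hi : i < n.+1), Ordinal (hj : j < n.+1)).
  by rewrite b' /= => ->.
have := e (rowlen mu i) (rowlen_le _ _); have := e (rowlen mu' i) (rowlen_le _ _); lia.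
Qed.

(** The cells with the last letter form a horizontal strip, and what remains is an
    arbitrary tableau on the smaller shape. *)
Lemma kostka_tableau k la c : kostka (downfrom k c) la = #|[pred T : filling k | tableau la c T]|.
Proof.
elim: k la => [|k IH] la.
  have t0 (T : filling 0) : tableau la c T = (weight la == 0).
    apply/idP/idP => [/and3P[b _ _]|e].
      by rewrite -(card_below b) eq_card0.
    rewrite weight_eq0 in e *.
    rewrite (eqP e); apply/and3P; split.
    - by apply/belowP => x; rewrite rowlen_empty.
    - by apply/increasingP => i j i' j'; rewrite !ord1; split=> // _; right.
    - exact/letters_usedP.
  rewrite (eq_card (B := [pred T : filling 0 | weight la == 0])) => [|T]; last by rewrite !inE t0.
  rewrite /kostka /=; case: (weight la == 0); last by rewrite eq_card0.
  by rewrite (eq_card (B := predT)) // card_ffun card_ord exp1n.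
rewrite [downfrom _ _]/= kostka_cons; under eq_bigr => mu h do rewrite IH -(card_step h).
rewrite -[RHS]sum1_card.
rewrite (eq_bigr (fun T => \sum_(mu | below T k mu) 1)) => [|T t]; last first.
  have [mu b] := exists_below t; rewrite (big_pred1 mu) // => mu'.
  by apply/idP/eqP => [b'|->//]; apply: below_uniq b' b.
rewrite (exchange_big_dep predT) //= [RHS](bigID (fun mu => hstrip mu la (c k))) /=.
rewrite [X in _ = _ + X]big1 ?addn0 => [|mu nh]; last first.
  by rewrite big1 // => T /andP[t b]; rewrite (tableau_hstrip t b) in nh.
by apply: eq_bigr => mu _; rewrite sum1_card.
Qed.
End Filling.

(** * Schur functions and Kostka numbers *)

Lemma tab_monomialE (nu : {fset cell}) (T : nu -> nat) i :
  tab_monomial T i = #|[pred x | T x == i]|.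
Proof.
rewrite /tab_monomial (big_morph (fun m : {cmonom nat} => m i) (cmM i) (cm1 i)).
rewrite -sum1_card [RHS]big_mkcond; apply: eq_bigr => x _.
by rewrite cmU inE; case: (T x == i).
Qed.

Lemma tab_monomialP (nu : {fset cell}) (T : nu -> nat) (a : {cmonom nat}) :
  reflect (forall i, #|[pred x | T x == i]| = a i) (tab_monomial T == a).
Proof.
apply: (iffP eqP) => [<- i|h]; first by rewrite tab_monomialE.
by apply/eqP/cmP => i; rewrite tab_monomialE h.
Qed.

Lemma ssytP (nu : {fset cell}) (T : nu -> nat) :
  reflect (forall x y : nu,
     ((val x).1 = (val y).1 -> (val x).2 < (val y).2 -> T x <= T y) /\
     ((val x).2 = (val y).2 -> (val x).1 < (val y).1 -> T x < T y)) (ssyt T).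
Proof.
apply: (iffP forallP) => [h x y|h x].
  have /forallP/(_ y)/andP[/implyP h1 /implyP h2] := h x.
  by split=> e l; [apply: h1 | apply: h2]; rewrite e eqxx.
apply/forallP => y; have [h1 h2] := h x y.
by apply/andP; split; apply/implyP => /andP[/eqP e l]; [apply: h1 | apply: h2].
Qed.

Lemma in_diagram s (x : cell) : (x \in diagram s) = (x.2 < nth 0 s x.1).
Proof.
rewrite /diagram in_fset /=; apply/allpairsPdep/idP => [[i [j [hi hj ->]]]|h].
  by rewrite mem_iota in hj.
exists x.1, x.2; rewrite !mem_iota /= h -surjective_pairing; split=> //.
by rewrite add0n ltnNge; apply: contraTN h => /(nth_default 0) ->.
Qed.

Section Schur.
Variables (n k : nat) (la : shape n) (s : seq nat) (a : {cmonom nat}).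
Hypothesis sla : forall i, nth 0 s i = rowlen la i.
Hypothesis dec : forall i, rowlen la i.+1 <= rowlen la i.
Hypothesis ak : forall i, k <= i -> a i = 0.
Local Notation L := ('I_n.+1 * 'I_n.+1)%type.
Local Notation nu := (diagram s).

Definition cell_of (x : L) : cell := (val x.1, val x.2).
(** Cells outside of the diagram receive the letter k, which exceeds all the letters
    that occur. *)
Definition fill (U : {ffun nu -> finsupp a}) : filling n k :=
  [ffun x : L => inord (if insub (cell_of x) is Some y then val (U y) else k)].

Lemma letter_lt (i : finsupp a) : val i < k.
Proof. by rewrite ltnNge; apply/negP => /ak e; have := valP i; rewrite -cmE_neq0 e. Qed.

Lemma cell_ofP (x : L) : (cell_of x \in nu) = (x.2 < rowlen la x.1).
Proof. by rewrite in_diagram sla. Qed.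

Lemma fill_in U x (h : cell_of x \in nu) : fill U x = val (U [` h]%fset) :> nat.
Proof. by rewrite ffunE insubT inordK ?ltnS ?(ltnW (letter_lt _)). Qed.

Lemma fill_out U x : cell_of x \notin nu -> fill U x = k :> nat.
Proof. by move=> h; rewrite ffunE insubN // inordK. Qed.

Lemma cell_of_surj (y : nu) : exists2 x : L, cell_of x = val y & x.2 < rowlen la x.1.
Proof.
have := valP y; case: (val y) => i j; rewrite in_diagram /= sla => h.
have hi : i < n.+1 by rewrite ltnNge; apply/negP => h'; rewrite rowlen_ge in h.
have hj : j < n.+1 by rewrite (leq_trans h) // leqW // rowlen_le.
by exists (Ordinal hi, Ordinal hj).
Qed.

Lemma fill_inj : injective fill.
Proof.
move=> U V e; apply/ffunP => y; have [x xy hx] := cell_of_surj y; apply: val_inj.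
have h : cell_of x \in nu by rewrite xy (valP y).
have := congr1 (fun T : filling n k => T x : nat) e; rewrite /= !(fill_in _ h).
by have -> : [` h]%fset = y by apply: val_inj.
Qed.

Lemma fill_at (U : {ffun nu -> finsupp a}) x (y : nu) : cell_of x = val y -> fill U x = val (U y) :> nat.
Proof.
move=> e; have h : cell_of x \in nu by rewrite e (valP y).
by rewrite (fill_in _ h); congr (val (U _)); apply: val_inj.
Qed.

Lemma card_fill (U : {ffun nu -> finsupp a}) i : i < k ->
  #|[pred y | val (U y) == i]| = #|[pred x : L | fill U x == i :> nat]|.
Proof.
move=> hi; have ex (y : nu) : exists x : L, cell_of x = val y.
  by have [x xy _] := cell_of_surj y; exists x.
have [g gP] := fin_all_exists ex.
have gi : injective g by move=> y y' e; apply: val_inj; rewrite -!gP e.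
rewrite -(card_imset _ gi); apply: eq_card => x; rewrite inE.
apply/imsetP/idP => [[y + ->]|fx]; first by rewrite inE (fill_at _ (gP y)).
have h : cell_of x \in nu by apply: contraTT fx => /(fill_out U) ->; rewrite gtn_eqF.
exists [` h]%fset; first by rewrite inE -(fill_in U h).
have := gP [` h]%fset; rewrite /= /cell_of; case: (x) (g _) => i1 j1 [i2 j2] /= [e1 e2].
by congr pair; apply: val_inj.
Qed.

Lemma fill_tableau U : tableau la a (fill U) =
  ssyt (fun x => val (U x)) && (tab_monomial (fun x => val (U x)) == a).
Proof.
have dec2 i i' : i <= i' -> rowlen la i' <= rowlen la i.
  by move=> /subnKC <-; elim: (i' - i) => [|d IH]; rewrite ?addn0 // addnS (leq_trans (dec _)).
apply/and3P/andP => [[b /increasingP inc /letters_usedP us]|[/ssytP st /tab_monomialP mo]]; split.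
- apply/ssytP => y y'; have [[i j] xy hx] := cell_of_surj y; have [[i' j'] xy' hx'] := cell_of_surj y'.
  rewrite -(fill_at U xy) -(fill_at U xy') -xy -xy' /=; split=> [/val_inj e|/val_inj e] hl.
    by move: hl; rewrite e; apply: (inc i' j i' j').1.
  move: hl; rewrite e => /(inc i j' i' j').2[//|ek].
  by have := letter_lt (U y'); rewrite -(fill_at U xy') ek ltnn.
- apply/tab_monomialP => i; case: (ltnP i k) => hi; first by rewrite card_fill // us.
  by rewrite ak // eq_card0 // => y; rewrite !inE ltn_eqF // (leq_trans (letter_lt _)).
- apply/belowP => x; case: (boolP (cell_of x \in nu)) => h.
    by rewrite (fill_in U h) letter_lt -cell_ofP h.
  by rewrite (fill_out U h) ltnn -cell_ofP (negPf h).
- apply/increasingP => i j i' j'; split=> hl.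
    case: (boolP (cell_of (i, j') \in nu)) => h'; last first.
      by rewrite (fill_out U h') -ltnS.
    have h : cell_of (i, j) \in nu by rewrite !cell_ofP /= in h' *; apply: ltn_trans h'.
    by rewrite (fill_in U h) (fill_in U h'); apply: (st _ _).1.
  case: (boolP (cell_of (i', j) \in nu)) => h'; last by right; rewrite (fill_out U h').
  have h : cell_of (i, j) \in nu.
    by rewrite !cell_ofP /= in h' *; apply: (leq_trans h'); apply/dec2/ltnW.
  by left; rewrite (fill_in U h) (fill_in U h'); apply: (st _ _).2.
by apply/letters_usedP => i hi; rewrite -card_fill // mo.
Qed.

Lemma card_ssyt : #|[pred U : {ffun nu -> finsupp a} | ssyt (fun x => val (U x)) && (tab_monomial (fun x => val (U x)) == a)]|
  = kostka (downfrom k a) la.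
Proof.
rewrite kostka_tableau -(card_imset _ fill_inj); apply: eq_card => T; rewrite inE.
apply/imsetP/idP => [[U + ->]|t]; first by rewrite inE -fill_tableau.
have /and3P[/belowP b _ /letters_usedP us] := t.
have in_a (y : nu) : exists i : finsupp a, forall x : L, cell_of x = val y -> val i = T x.
  have [x xy hx] := cell_of_surj y; have Txk : T x < k by rewrite b.
  have h : (T x : nat) \in finsupp a.
    by rewrite -cmE_neq0 -us // -lt0n; apply/card_gt0P; exists x; rewrite inE.
  exists [` h]%fset => x' x'y; congr (nat_of_ord (T _)).
  have : cell_of x = cell_of x' by rewrite xy x'y.
  by case: x {xy hx Txk h} x' {x'y} => i j [i' j'] [/val_inj-> /val_inj->].
have [f fP] := fin_all_exists in_a.
have e : T = fill [ffun y => f y].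
  apply/ffunP => x; apply: val_inj => /=; case: (boolP (cell_of x \in nu)) => h.
    by rewrite (fill_in _ h) ffunE (fP _ x).
  rewrite (fill_out _ h); apply/eqP; rewrite eqn_leq -ltnS ltn_ord /= leqNgt b -cell_ofP //.
by exists [ffun y => f y] => //; rewrite inE -fill_tableau -e.
Qed.
End Schur.

Lemma schur_kostka (R : nzRingType) n k (la : shape n) (mu : intpart) (a : {cmonom nat}) :
  (forall i, nth 0 (val mu) i = rowlen la i) -> (forall i, rowlen la i.+1 <= rowlen la i) ->
  (forall i, k <= i -> a i = 0) -> schur R mu a = (kostka (downfrom k a) la)%:R%R.
Proof.
move=> sla dec ak; rewrite /schur /ssyt_series sumr_const -(card_ssyt sla dec ak).
by congr (_ *+ _)%R; apply: eq_card => U; rewrite !inE.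
Qed.

Section Intpart.
Variable n : nat.
Implicit Type la : shape n.

Definition rows la := mkseq (rowlen la) (find (fun i => rowlen la i == 0) (iota 0 n.+2)).
(** The rows up to the first empty one, which form a partition when the rows of la
    decrease. *)
Definition ipart_of la : intpart := insubd (Sub [::] isT) (rows la).

Lemma nth_rows la : (forall i, rowlen la i.+1 <= rowlen la i) -> forall i, nth 0 (rows la) i = rowlen la i.
Proof.
move=> dec i; rewrite /rows; set r := find _ _.
have hh : has (fun i => rowlen la i == 0) (iota 0 n.+2).
  by apply/hasP; exists n.+1; rewrite ?mem_iota ?leqnn ?ltnSn // rowlen_ge.
have rn : r < n.+2 by rewrite /r -[X in _ < X](size_iota 0) -has_find.
have r0 : rowlen la r = 0.
  by have := nth_find 0 hh; rewrite -/r nth_iota // => /eqP.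
case: (ltnP i r) => hi; first by rewrite nth_mkseq.
rewrite nth_default ?size_mkseq //; apply/esym.
rewrite -(subnKC hi); elim: (i - r) => [|d IH]; first by rewrite addn0.
by have := dec (r + d); rewrite IH leqn0 addnS => /eqP.
Qed.

Lemma val_ipart_of la : (forall i, rowlen la i.+1 <= rowlen la i) -> val (ipart_of la) = rows la.
Proof.
move=> dec; rewrite /ipart_of insubdK //; apply/andP; split.
  apply/(sortedP 0) => i _; by rewrite !nth_rows //; apply: dec.
apply/(nthP 0) => -[i]; rewrite size_mkseq => hi; rewrite nth_mkseq // => e.
have := before_find 0 hi; rewrite nth_iota ?e //.
by rewrite -[X in _ < X](size_iota 0) (leq_trans hi (find_size _ _)).
Qed.

Lemma nth_ipart_of la : (forall i, rowlen la i.+1 <= rowlen la i) -> forall i, nth 0 (val (ipart_of la)) i = rowlen la i.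
Proof. by move=> dec i; rewrite val_ipart_of // nth_rows. Qed.
End Intpart.

(** * The cells of a vertical strip *)

Section Strip.
Variables (m n' : nat) (s : seq nat).
Local Notation n := n'.+1.
Hypothesis hm : 0 < m.
Hypothesis ps : is_partition s.
Local Notation nu := (vstrip n s).

Definition strip_cell (i : nat) : cell := (i, nth 0 s i).
(** The order opposite to [dlt] on the cells of the strip, named by their rows. *)
Definition cell_before (i j : nat) := dlt m (strip_cell j) (strip_cell i).
(** The cell j comes before the cell below i, in the same column as i. *)
Definition cell_adj (j i : nat) := dlt m (i.+1, nth 0 s i) (strip_cell j).

Lemma nth_dec i j : i <= j -> nth 0 s j <= nth 0 s i.
Proof.
move=> ij; case: (ltnP j (size s)) => hj; last by rewrite [X in X <= _]nth_default.
have tr : transitive geq by move=> a b c /= h1 h2; apply: leq_trans h1.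
have := sorted_leq_nth tr (leqnn : reflexive geq) 0 ps => /(_ i j).
by rewrite !inE hj (leq_ltn_trans ij hj) => /(_ isT isT ij).
Qed.

Lemma cell_beforeE i j : cell_before i j = (m * i + nth 0 s i < m * j + nth 0 s j) ||
   (m * i + nth 0 s i == m * j + nth 0 s j) && (nth 0 s j < nth 0 s i).
Proof. by rewrite /cell_before /dlt /dstat /= [X in _ || X && _]eq_sym. Qed.
Lemma cell_adjE j i : cell_adj j i = (m * j + nth 0 s j < m * i.+1 + nth 0 s i) ||
   (m * j + nth 0 s j == m * i.+1 + nth 0 s i) && (nth 0 s i < nth 0 s j).
Proof. by rewrite /cell_adj /dlt /dstat /= [X in _ || X && _]eq_sym. Qed.

Lemma cell_before_irr i : cell_before i i = false.
Proof. by rewrite cell_beforeE !ltnn andbF. Qed.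
Lemma cell_before_trans j i k : cell_before i j -> cell_before j k -> cell_before i k.
Proof. by rewrite !cell_beforeE; lia. Qed.
Lemma cell_before_total i j : i != j -> cell_before i j || cell_before j i.
Proof.
rewrite !cell_beforeE => ij.
have [e|ne] := eqVneq (nth 0 s i) (nth 0 s j); last by lia.
have : m * i != m * j by rewrite eqn_pmul2l.
by lia.
Qed.
Lemma cell_adj_down k j i : cell_before k j -> cell_adj j i -> cell_adj k i.
Proof. by rewrite cell_beforeE !cell_adjE; lia. Qed.
Lemma cell_adj_up j i k : cell_adj j i -> cell_before i k -> cell_adj j k.
Proof. by rewrite cell_beforeE !cell_adjE !mulnS; lia. Qed.
Lemma cell_adj_refl i : cell_adj i i.
Proof. by rewrite cell_adjE mulnS; lia. Qed.
Lemma cell_adj_mark i j : nth 0 s i.+1 = nth 0 s i -> cell_adj j i = cell_before j i.+1.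
Proof. by move=> e; rewrite cell_adjE cell_beforeE e. Qed.

Definition pos (i : 'I_n) := #|[pred j : 'I_n | cell_before j i]|.

(** A cell outside of the initial segment A comes after all of A; the predecessors
    of a cell inside lie in A. *)
Lemma pos_lt (A : {pred 'I_n}) (i : 'I_n) : (forall j k : 'I_n, cell_before k j -> j \in A -> k \in A) ->
  (pos i < #|A|) = (i \in A).
Proof.
move=> dA; apply/idP/idP => [|iA].
  apply: contraTT => iA; rewrite -leqNgt; apply: subset_leq_card; apply/subsetP => j jA.
  rewrite inE; have ne : (j : nat) != i by apply: contraNneq iA => /val_inj <-.
  by case/orP: (cell_before_total ne) => // p; rewrite (dA _ _ p jA) in iA.
rewrite [X in _ < X](cardD1 i) iA ltnS; apply: subset_leq_card; apply/subsetP => j.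
rewrite !inE => ji; apply/andP; split; last exact: dA ji iA.
by apply: contraTneq ji => ->; rewrite cell_before_irr.
Qed.

Lemma pos_before (i j : 'I_n) : (pos i < pos j) = cell_before i j.
Proof. by rewrite [X in _ < X]/pos pos_lt // => k l; rewrite !inE; apply: cell_before_trans. Qed.

Lemma pos_ltn i : pos i < n.
Proof. by rewrite -[X in _ < X]card_ord pos_lt. Qed.
Definition opos i : 'I_n := Ordinal (pos_ltn i).
Lemma opos_inj : injective opos.
Proof.
move=> i j [e]; apply/val_inj/eqP; apply: contraT => /cell_before_total.
by rewrite -!pos_before e ltnn.
Qed.
Definition row_rank := perm opos_inj.
Definition row_at (p : 'I_n) : 'I_n := (row_rank^-1)%g p.
Lemma row_atK p : pos (row_at p) = p.
Proof. by have := permKV row_rank p; rewrite permE => /(congr1 val). Qed.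
Lemma oposK i : row_at (opos i) = i.
Proof. by rewrite /row_at -[opos i](permE opos_inj) permK. Qed.
Lemma row_at_before (p q : 'I_n) : cell_before (row_at p) (row_at q) = (p < q).
Proof. by rewrite -pos_before !row_atK. Qed.

(** For p < q this makes q < h p the adjacency of the two cells. *)
Definition hess (p : nat) := if insub p is Some q then #|[pred j : 'I_n | cell_adj j (row_at q)]| else 0.
(** At a marked position [hess] is the position of the cell below. *)
Definition mark (p : nat) := if insub p is Some q then
  ((row_at q).+1 < n) && (nth 0 s (row_at q).+1 == nth 0 s (row_at q)) else false.

Lemma hessE (p : 'I_n) : hess p = #|[pred j : 'I_n | cell_adj j (row_at p)]|.
Proof. by rewrite /hess valK. Qed.
Lemma markE (p : 'I_n) : mark p = ((row_at p).+1 < n) && (nth 0 s (row_at p).+1 == nth 0 s (row_at p)).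
Proof. by rewrite /mark valK. Qed.
Lemma mark_lt p : mark p -> p < n.
Proof. by rewrite /mark; case: insubP. Qed.

Lemma hess_edge (p q : 'I_n) : (q < hess p) = cell_adj (row_at q) (row_at p).
Proof. by rewrite hessE -(row_atK q) pos_lt ?row_atK // => j k; rewrite !inE; apply: cell_adj_down. Qed.

Lemma hess_mark (p : 'I_n) (hp : (row_at p).+1 < n) : mark p -> hess p = pos (Ordinal hp).
Proof.
rewrite markE hp => /eqP e; rewrite hessE; apply: eq_card => j; rewrite !inE.
exact: cell_adj_mark.
Qed.

Lemma mark_hess i : mark i -> hess i < n.
Proof.
move=> Si; have := mark_lt Si => hi; move: Si; rewrite -[i]/(val (Ordinal hi)) => Si.
by have := Si; rewrite markE => /andP[hp _]; rewrite (hess_mark hp Si) pos_ltn.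
Qed.

(** The cell below a marked cell is before the cell below any later one, but not
    before itself, so raising the path at marked positions keeps it monotone. *)
Lemma hess_lt_mark (p q : 'I_n) : p < q -> mark p -> hess p < hess q.
Proof.
move=> pq Sp; have := Sp; rewrite markE => /andP[hp /eqP e].
rewrite (hess_mark hp Sp) hessE pos_lt => [|j k]; last by rewrite !inE; apply: cell_adj_down.
rewrite inE /=; move: pq; rewrite -row_at_before.
by rewrite cell_beforeE cell_adjE e !mulnS; lia.
Qed.

Lemma hess_dyck (R : pred nat) : (forall i, R i -> mark i) -> dyck n (add_marks hess R).
Proof.
move=> RS; split=> [i hi|i j].
  have := hess_edge (Ordinal hi) (Ordinal hi); rewrite cell_adj_refl /= /add_marks.
  have : hess i <= n by rewrite -[i]/(val (Ordinal hi)) hessE -[X in _ <= X]card_ord max_card.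
  case Ri: (R i) => /=; last by lia.
  by have := mark_hess (RS _ Ri); lia.
rewrite leq_eqVlt => /orP[/eqP->//|ij] hj; have hi := ltn_trans ij hj.
rewrite /add_marks; case Ri: (R i) => /=.
  by have := @hess_lt_mark (Ordinal hi) (Ordinal hj) ij (RS _ Ri) => /=; lia.
rewrite addn0 (leq_trans _ (leq_addr _ _)) //.
rewrite -[i]/(val (Ordinal hi)) -[j in X in _ <= X]/(val (Ordinal hj)) !hessE.
apply: subset_leq_card; apply/subsetP => k; rewrite !inE => lk.
by apply: cell_adj_up lk _; rewrite row_at_before.
Qed.

Lemma in_vstrip (x : cell) : (x \in nu) = (x.1 < n) && (x == strip_cell x.1).
Proof.
rewrite /vstrip in_fset; apply/mapP/andP => [[i + ->]|[h /eqP e]].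
  by rewrite mem_iota.
by exists x.1; rewrite ?mem_iota.
Qed.

Lemma strip_cell_in (i : 'I_n) : strip_cell i \in nu.
Proof. by rewrite in_vstrip ltn_ord eqxx. Qed.
Definition cell_at (p : 'I_n) : nu := [` strip_cell_in (row_at p)]%fset.
Lemma cell_row_lt (y : nu) : (val y).1 < n.
Proof. by have := valP y; rewrite in_vstrip => /andP[]. Qed.
Definition cell_pos (y : nu) : 'I_n := opos (Ordinal (cell_row_lt y)).
Lemma cell_atK : cancel cell_at cell_pos.
Proof.
move=> p; apply: val_inj; rewrite /= -[RHS]row_atK; congr pos; exact: val_inj.
Qed.
Lemma cell_posK : cancel cell_pos cell_at.
Proof.
move=> y; apply: val_inj; rewrite /= oposK /=.
by have := valP y; rewrite in_vstrip => /andP[_ /eqP <-].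
Qed.

(** Rows have one cell, and the cells of a column lie in consecutive rows because
    the parts decrease; so the marked pairs generate all conditions. *)
Lemma ssyt_strict (T : finType) (wd : T -> 'I_n -> nat) (t : T) (U : nu -> nat) :
  (forall p, U (cell_at p) = wd t p) -> ssyt U = marks_strict hess mark wd t.
Proof.
move=> Uw; have U' y : U y = wd t (cell_pos y) by rewrite -Uw cell_posK.
apply/ssytP/forallP => [h p|h x y].
  apply/negP => /andP[Sp /existsP[p' /existsP[q /and3P[/eqP/val_inj -> /eqP eqh]]]].
  have := Sp; rewrite markE => /andP[hp /eqP e].
  rewrite (hess_mark hp Sp) -(row_atK q) in eqh; rewrite -!Uw leqNgt; apply/negP; rewrite negbK.
  have eq2 : row_at q = (row_at p).+1 :> nat.
    by have := @opos_inj (row_at q) (Ordinal hp) (@val_inj _ _ _ (opos (row_at q)) (opos (Ordinal hp)) eqh) => ->.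
  by apply: (h _ _).2; rewrite /= ?eq2.
split; have := valP x; have := valP y; rewrite !in_vstrip.
  by move=> /andP[_ /eqP->] /andP[_ /eqP->] /= -> ; rewrite ltnn.
move=> /andP[hy /eqP ey] /andP[hx /eqP ex] e2 lt.
rewrite !U' /cell_pos.
have step (i : nat) (hi : i < n) (hi' : i.+1 < n) : nth 0 s i.+1 = nth 0 s i ->
   wd t (opos (Ordinal hi)) < wd t (opos (Ordinal hi')).
  move=> e; have := h (opos (Ordinal hi)); rewrite /violated; set p := opos (Ordinal hi).
  have Sp : mark p by rewrite markE /p oposK /= hi' e eqxx.
  rewrite Sp /= negb_exists => /forallP/(_ p); rewrite negb_exists => /forallP/(_ (opos (Ordinal hi'))).
  have hp : (row_at p).+1 < n by rewrite /p oposK.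
  have dyck_rel : hess p = pos (Ordinal hi').
    by rewrite (hess_mark hp Sp); congr pos; apply: val_inj; rewrite /= /p oposK.
  by rewrite -[pos (Ordinal hi)]/(val p) dyck_rel !eqxx /= -ltnNge.
have gen d i (hi : i < n) : i = (val x).1 + d.+1 -> nth 0 s i = nth 0 s (val x).1 ->
   wd t (opos (Ordinal (cell_row_lt x))) < wd t (opos (Ordinal hi)).
  elim: d i hi => [|d IH] i hi; rewrite ?addn1 1?addnS => ie; move: hi; rewrite {}ie => hi e.
    exact: step.
  have hi2 := ltnW hi.
  have e' : nth 0 s ((val x).1 + d.+1) = nth 0 s (val x).1.
    by apply/eqP; rewrite eqn_leq nth_dec ?leq_addr //= -e nth_dec.
  by apply: ltn_trans (IH _ hi2 erefl e') _; apply: step; rewrite e e'.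
apply: (gen ((val y).1 - (val x).1).-1); first by rewrite prednK ?subn_gt0 // subnKC // ltnW.
by move: e2; rewrite ex ey.
Qed.

Definition dinv_base := \sum_(p < n) \sum_(q < n | p < q) dinv_pair m (strip_cell (row_at q)) (strip_cell (row_at p)).

Lemma sum_pairs (g : 'I_n -> 'I_n -> nat) : (forall p, g p p = 0) ->
  \sum_p \sum_q g p q = \sum_(p < n) \sum_(q < n | p < q) (g p q + g q p).
Proof.
move=> g0; under [RHS]eq_bigr => p _ do rewrite big_split /=.
rewrite big_split /= [X in _ = _ + X](exchange_big_dep predT) //= -big_split /=.
apply: eq_bigr => p _; rewrite (bigID (fun q : 'I_n => p < q)) /=; congr (_ + _).
rewrite big_mkcond [RHS]big_mkcond; apply: eq_bigr => q _.
by case: (ltngtP p q) => [||/val_inj ->] //=.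
Qed.

(** For cells in different columns, with d the difference of their values of [dstat],
    one of the counts is m - d and the other m - (d - 1) or m - (d + 1), truncated at
    zero; they differ by one until the larger one vanishes.  Within a column both
    are zero, and the cells are too far apart to be adjacent. *)
Lemma dinv_pair_adj i j : cell_before i j ->
  dinv_pair m (strip_cell i) (strip_cell j) = dinv_pair m (strip_cell j) (strip_cell i) + cell_adj j i.
Proof.
rewrite cell_beforeE cell_adjE /dinv_pair /dstat /= mulnS.
set x := m * i; set y := m * j; have hx : x = m * i by []; have hy : y = m * j by [].
case: (ltngtP (nth 0 s i) (nth 0 s j)) => c h; try lia.
rewrite ?andbF ?orbF c ltn_add2r in h *.
suff : (y < m + x) = false by lia.
rewrite /x /y in h *; rewrite -mulnS ltn_pmul2l // ltnS; apply/negbTE; rewrite -ltnNge.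
by move: h; rewrite ltn_pmul2l.
Qed.

(** Each pair of positions p < q contributes what it would with the smaller entry at
    q, plus one if the cells are adjacent and the smaller entry is at p. *)
Lemma dinv_ninv (T : finType) (wd : T -> 'I_n -> nat) (t : T) (U : nu -> nat) :
  (forall p, U (cell_at p) = wd t p) -> dinv m U = dinv_base + ninv wd (dyck_rel n hess) t.
Proof.
move=> Uw; rewrite /dinv (reindex cell_at); last by exists cell_pos => x _; [apply: cell_atK | apply: cell_posK].
pose g p q := if (wd t p < wd t q) || (wd t p == wd t q) && (q < p)
  then dinv_pair m (strip_cell (row_at p)) (strip_cell (row_at q)) else 0.
rewrite (eq_bigr (fun p => \sum_q g p q)) => [|p _]; last first.
  rewrite (reindex cell_at) /=; last by exists cell_pos => x _; [apply: cell_atK | apply: cell_posK].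
  rewrite [LHS]big_mkcond; apply: eq_bigr => q _; rewrite /g !Uw -/(cell_before (row_at q) (row_at p)) row_at_before.
  by [].
rewrite sum_pairs => [|p]; last by rewrite /g !ltnn andbF.
have -> : ninv wd (dyck_rel n hess) t = \sum_(p < n) \sum_(q < n | p < q) (cell_adj (row_at q) (row_at p) && (wd t p < wd t q)).
  rewrite /ninv /inversions size_filter -sum1_count /= big_enum_cond /=.
  rewrite big_mkcond -(pair_bigA _ (fun p q : 'I_n => if [&& p < q, dyck_rel n hess p q & wd t p < wd t q] then 1 else 0)) /=.
  apply: eq_bigr => p _; rewrite [RHS]big_mkcond; apply: eq_bigr => q _.
  case: ltnP => //= pq; rewrite /dyck_rel /dyck_adj pq hess_edge /= ltnNge (ltnW pq) /= orbF.
  by case: (cell_adj _ _ && _).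
rewrite -big_split; apply: eq_bigr => p _; rewrite -big_split; apply: eq_bigr => q pq /=.
have pr : cell_before (row_at p) (row_at q) by rewrite row_at_before.
rewrite /g (dinv_pair_adj pr) pq [q < p]ltnNge (ltnW pq) /= andbF andbT orbF.
by case: (ltngtP (wd t p) (wd t q)) => _ /=; rewrite ?andbT ?andbF; lia.
Qed.
End Strip.

(** * Schur expansion of the series *)

Local Open Scope ring_scope.

Definition has_content n (u : 'I_n -> nat) (a : {cmonom nat}) := forall i, #|[pred p | u p == i]| = a i.

Lemma exists_word n (a : {cmonom nat}) : monalg.mdeg a = n -> exists u : {ffun 'I_n -> nat}, has_content u a.
Proof.
rewrite mdegE big_seq_fsetE /= => an; have [z zP] := exists_word_count an.
exists [ffun p => val (z p)] => i; case: (boolP (i \in finsupp a)) => hi.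
  rewrite -[RHS](zP [` hi]%fset); apply: eq_card => p; rewrite !inE ffunE.
  by rewrite -val_eqE.
rewrite memNfinsupp in hi; rewrite (eqP hi) eq_card0 // => p; rewrite !inE ffunE.
by apply/eqP => e; have := valP (z p); rewrite e -cmE_neq0 hi.
Qed.

Lemma word_mdeg n (u : 'I_n -> nat) (a : {cmonom nat}) : has_content u a -> monalg.mdeg a = n.
Proof.
move=> ua; rewrite mdegE big_seq_fsetE /= -[RHS]card_ord.
have ha p : u p \in finsupp a by rewrite -cmE_neq0 -ua -lt0n; apply/card_gt0P; exists p; rewrite inE.
rewrite -sum1_card (partition_big (fun p => [` ha p]%fset) predT) //=.
by apply: eq_bigr => i _; rewrite -ua -sum1_card; apply: eq_bigl => p; rewrite !inE -val_eqE.
Qed.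

Lemma sum_mdeg (a : {cmonom nat}) k : (forall i, (k <= i)%N -> a i = 0%N) -> (\sum_(i < k) a i)%N = monalg.mdeg a.
Proof.
move=> ak; have [u ua] := exists_word (erefl (monalg.mdeg a)).
have uk p : (u p < k)%N.
  by rewrite ltnNge; apply/negP => /ak; rewrite -ua => /card0_eq/(_ p); rewrite !inE eqxx.
rewrite -[RHS]card_ord (sum_card_fiber _ uk); apply: eq_bigr => i _; rewrite -ua.
by apply: eq_card => p; rewrite !inE.
Qed.

Section Expansion.
Variables (m n' : nat) (s : seq nat).
Local Notation n := n'.+1.
Hypothesis hm : (0 < m)%N.
Hypothesis ps : is_partition s.
Local Notation nu := (vstrip n s).
Local Notation hf := (hess n' hm ps).
Local Notation mk := (mark n' hm ps).
Local Notation yc := (@cell_at m n' s hm ps).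

Lemma Dterm_degree a : Dterm m n s a != 0 -> monalg.mdeg a = n.
Proof.
move=> nz; have [T /andP[_ /eqP e]] : exists T : {ffun nu -> finsupp a},
    ssyt (fun x => val (T x)) && (tab_monomial (fun x => val (T x)) == a).
  apply/existsP; apply: contraNT nz; rewrite negb_exists => /forallP h.
  by rewrite /Dterm /ssyt_series big_pred0 // => T; apply/negbTE.
rewrite -e /tab_monomial mdeg_prod (eq_bigr (fun=> 1%N)) => [|x _]; last exact: mdegU.
rewrite sum1_card -[RHS]card_ord; apply: bij_eq_card; exists yc; [exact: cell_posK|exact: cell_atK].
Qed.

Section Words.
Variables (u : {ffun 'I_n -> nat}) (a : {cmonom nat}).
Hypothesis ua : has_content u a.

Lemma letter_finsupp (t : orbit_of u) p : letter t p \in finsupp a.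
Proof.
rewrite -cmE_neq0 -ua -(card_letter t) -lt0n; apply/card_gt0P; exists p; by rewrite inE.
Qed.

Definition tab_of (t : orbit_of u) : {ffun nu -> finsupp a} :=
  [ffun y => [` letter_finsupp t (cell_pos hm ps y)]%fset].
Definition word_of (T : {ffun nu -> finsupp a}) : {ffun 'I_n -> nat} := [ffun p => val (T (yc p))].
Definition orb_of (T : {ffun nu -> finsupp a}) : orbit_of u := insubd (place u 1%g) (word_of T).

Lemma tab_ofE t p : val (tab_of t (yc p)) = letter t p.
Proof. by rewrite ffunE /= cell_atK. Qed.

Lemma orb_of_tab t : orb_of (tab_of t) = t.
Proof.
rewrite /orb_of; have -> : word_of (tab_of t) = val t by apply/ffunP => p; rewrite ffunE tab_ofE.
exact: valKd.
Qed.

Lemma word_content (T : {ffun nu -> finsupp a}) i :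
  #|[pred y | val (T y) == i]| = #|[pred p | word_of T p == i]|.
Proof.
have yi : injective yc by apply: can_inj (@cell_atK m n' s hm ps).
rewrite -(card_imset _ yi); apply: eq_card => y; rewrite inE.
apply/idP/imsetP => [Ty|[p + ->]]; last by rewrite inE ffunE.
by exists (cell_pos hm ps y); rewrite ?inE ?ffunE cell_posK.
Qed.

Lemma tab_of_orb (T : {ffun nu -> finsupp a}) : tab_monomial (fun x => val (T x)) == a -> tab_of (orb_of T) = T.
Proof.
move=> /tab_monomialP mo; apply/ffunP => y; apply: val_inj; rewrite ffunE /=.
rewrite /letter /orb_of insubdK; first by rewrite ffunE cell_posK.
by apply: mem_words_content => i; rewrite ua -mo word_content.
Qed.

Lemma tab_of_monomial t : tab_monomial (fun x => val (tab_of t x)) == a.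
Proof.
apply/tab_monomialP => i; rewrite word_content -ua -(card_letter t).
by apply: eq_card => p; rewrite !inE ffunE tab_ofE.
Qed.

Lemma Dterm_words : Dterm m n s a =
  \sum_(t : orbit_of u | marks_strict hf mk (@letter n u) t) 'X^(dinv_base n' hm ps + ninv (@letter n u) (dyck_rel n hf) t).
Proof.
rewrite /Dterm /ssyt_series (reindex_onto tab_of orb_of) => [|T /andP[_ mo]]; last exact: tab_of_orb.
apply: eq_big => [t|t _]; last by congr 'X^_; apply: dinv_ninv => p; apply: tab_ofE.
rewrite orb_of_tab eqxx andbT tab_of_monomial andbT.
by apply: ssyt_strict => p; apply: tab_ofE.
Qed.

Definition wcount d := #|[pred t : orbit_of u | marks_strict hf mk (@letter n u) t & ninv (@letter n u) (dyck_rel n hf) t == d]|.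

Lemma Dterm_count : Dterm m n s a = \sum_(d < (n * n).+1) (wcount d)%:R * 'X^(dinv_base n' hm ps + d).
Proof.
have invb t : (ninv (@letter n u) (dyck_rel n hf) t < (n * n).+1)%N.
  rewrite ltnS /ninv /inversions size_filter (leq_trans (count_size _ _)) //.
  by rewrite -cardE card_prod card_ord.
rewrite Dterm_words (partition_big (fun t => Ordinal (invb t)) predT) //=.
apply: eq_bigr => d _; rewrite /wcount -sum1_card natr_sum mulr_suml.
apply: eq_big => [t|t]; first by rewrite !inE -val_eqE.
by rewrite -val_eqE /= => /andP[_ /eqP <-]; rewrite mul1r.
Qed.
End Words.

Lemma wcount_character : exists chi : 'I_(n * n).+1 -> 'CF([set: 'S_n]), forall d,
  chi d \is a character /\ forall u : {ffun 'I_n -> nat}, '['Res[stab u] (chi d), 1] = (wcount u d)%:R.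
Proof.
have ex (d : 'I_(n * n).+1) : exists chi : 'CF([set: 'S_n]), chi \is a character /\
    forall u : {ffun 'I_n -> nat}, '['Res[stab u] chi, 1] = (wcount u d)%:R; last exact: fin_all_exists ex.
have [chi c1 c2] := word_character (@hess_dyck m n' s hm ps) (@mark_hess m n' s hm ps) d.
by exists chi.
Qed.

(** Renaming the letters of a word by a bijection does not change its stabilizer,
    and the characters only see the stabilizer. *)
Lemma Dterm_symmetric (f : nat -> nat) (a b : {cmonom nat}) : bijective f ->
  (forall i, b i = a (f i)) -> Dterm m n s b = Dterm m n s a.
Proof.
case=> g fK gK ba.
have [an|an] := eqVneq (monalg.mdeg a) n; last first.
  have -> : Dterm m n s a = 0 by apply/eqP; apply: contraNT an => /Dterm_degree ->.
  apply/eqP; apply: contraNT an => /Dterm_degree/exists_word[u ub].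
  apply/eqP; apply: (@word_mdeg _ (f \o u)) => i; rewrite -[i]gK -ba -ub.
  by apply: eq_card => p; rewrite !inE /= (can_eq fK).
have [u ua] := exists_word an.
have ub : has_content [ffun p => g (u p)] b.
  by move=> i; rewrite ba -ua; apply: eq_card => p; rewrite !inE ffunE -(can_eq fK) gK.
have [chi chiP] := wcount_character.
rewrite (Dterm_count ua) (Dterm_count ub); apply: eq_bigr => d _; congr (_ * _).
have [_ c] := chiP d; congr _%:R; apply/eqP; rewrite -(eqr_nat algC) -!c.
suff -> : stab [ffun p => g (u p)] = stab u by [].
apply: val_inj => /=; apply/setP => k; rewrite !inE.
by apply: eq_forallb => p; rewrite !ffunE (can_eq gK).
Qed.

(** The coefficient of q^d, shifted by [dinv_base], in the coefficient of s_la is the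
    multiplicity of s_la in the d-th character. *)
Lemma Dterm_schur : exists C : shape n -> {poly int}, (forall la, Nq (C la)) /\
  forall a, Dterm m n s a = \sum_(la | is_part la) C la * schur {poly int} (ipart_of la) a.
Proof.
have [chi chiP] := wcount_character.
have ex (d : 'I_(n * n).+1) : exists c : shape n -> nat, forall k (u : {ffun 'I_n -> nat}), (forall p, u p < k)%N ->
    wcount u d = (\sum_(la | is_part la) c la * kostka (content k u) la)%N.
  have [cchi c1] := chiP d; have [c cP] := character_kostka cchi.
  exists c => k u uk; apply/eqP; rewrite -(eqr_nat algC) -c1; exact/eqP/cP.
have [c cP] := fin_all_exists ex.
exists (fun la => \sum_(d < (n * n).+1) (c d la)%:R * 'X^(dinv_base n' hm ps + d)); split=> [la i|a].
  rewrite coef_sum sumr_ge0 // => d _; rewrite mulr_natl coefMn coefXn.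
  by rewrite mulrn_wge0 ?ler0n.
have [k ak] : exists k, forall i, (k <= i)%N -> a i = 0%N.
  exists (\max_(x : finsupp a) val x).+1 => i hi; apply/eqP; rewrite cmE_eq0; apply/negP => h.
  by have := @leq_bigmax _ (fun x : finsupp a => val x) [` h]%fset; rewrite /= leqNgt hi.
have sE la : is_part la -> schur {poly int} (ipart_of la) a = (kostka (downfrom k a) la)%:R.
  move=> /is_partP[dec _]; apply: schur_kostka => //; exact: nth_ipart_of.
have [an|an] := eqVneq (monalg.mdeg a) n; last first.
  have -> : Dterm m n s a = 0 by apply/eqP; apply: contraNT an => /Dterm_degree ->.
  rewrite big1 // => la pl; rewrite sE // (_ : kostka _ _ = 0%N) ?mulr0 //.
  apply/eqP; apply: contraNT an => /kostka_sum; have /is_partP[_ ->] := pl; rewrite sumn_downfrom => ->.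
  by rewrite sum_mdeg.
have [u ua] := exists_word an.
have uk p : (u p < k)%N.
  rewrite ltnNge; apply/negP => /ak; rewrite -ua => /card0_eq/(_ p).
  by rewrite !inE eqxx.
have ck : content k u = downfrom k a by apply: eq_downfrom => i _; apply: ua.
rewrite (Dterm_count ua); under eq_bigr => d _ do rewrite (cP d _ _ uk) ck natr_sum mulr_suml.
rewrite exchange_big; apply: eq_bigr => la pl; rewrite sE // mulr_suml.
by apply: eq_bigr => d _; rewrite natrM mulrAC.
Qed.
End Expansion.

Section Assembly.
Variables (R : nzRingType) (P : R -> Prop).
Hypothesis P0 : P 0.
Hypothesis PD : forall x y, P x -> P y -> P (x + y).

Lemma P_sum (I : Type) (r : seq I) (Q : pred I) (F : I -> R) : (forall i, P (F i)) -> P (\sum_(i <- r | Q i) F i).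
Proof. by move=> h; elim/big_ind: _. Qed.

(** The coefficient of a partition is the sum of those of the shapes that give it. *)
Lemma schur_coefs n (C : shape n -> R) (F : fseries R) :
  (forall la, P (C la)) ->
  (forall a, F a = \sum_(la | is_part la) C la * schur R (ipart_of la) a) -> schur_coefs_in P F.
Proof.
move=> PC FE; pose S := [fset ipart_of la | la in [pred la : shape n | is_part la]]%fset.
pose f mu := \sum_(la : shape n | is_part la && (ipart_of la == mu)) C la.
pose c : {fsfun intpart -> R with 0} := [fsfun mu in S => f mu | 0].
exists c => [mu|a]; first by rewrite fsfun_fun; case: ifP => // _; apply: P_sum.
have sub : (finsupp c `<=` S)%fset.
  by apply/fsubsetP => mu; rewrite mem_finsupp fsfun_fun; case: ifP => //; rewrite eqxx.
rewrite (big_fset_incl _ sub) => [|mu _ /fsfun_dflt ->]; last by rewrite mul0r.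
rewrite FE big_seq_fsetE /=.
have inS (la : shape n) : is_part la -> ipart_of la \in S by move=> pl; apply/imfsetP; exists la.
under [RHS]eq_bigr => mu _ do rewrite fsfun_fun (valP mu) mulr_suml.
rewrite (exchange_big_dep (fun la : shape n => is_part la)) /= => [|mu la _ /andP[]//].
apply: eq_bigr => la pl; rewrite (big_pred1 [` inS _ pl]%fset) // => mu.
by rewrite pl -val_eqE eq_sym.
Qed.
End Assembly.

Lemma Nq0 : Nq 0. Proof. by move=> i; rewrite coef0. Qed.
Lemma NqD p q : Nq p -> Nq q -> Nq (p + q).
Proof. by move=> hp hq i; rewrite coefD addr_ge0. Qed.
Lemma Nqt0 : Nqt 0. Proof. by move=> i; rewrite coef0; apply: Nq0. Qed.
Lemma NqtD p q : Nqt p -> Nqt q -> Nqt (p + q).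
Proof. by move=> hp hq i; rewrite coefD; apply: NqD. Qed.
Lemma NqtXC e p : Nq p -> Nqt ('X^e * p%:P).
Proof.
move=> hp i; rewrite coefXnM; case: ifP => _; first exact: Nq0.
by rewrite coefC; case: ifP => _ //; apply: Nq0.
Qed.

Lemma Dseries_terms m n a : Dseries m n a =
  \sum_(l : n.-tuple 'I_(m * n.-1).+1 | is_partition (map val l) &&
        (diagram (map val l) `<=` diagram (mdelta m n))%fset)
    'X^(m * 'C(n, 2) - sumn (map val l)) * (Dterm m n (map val l) a)%:P.
Proof.
apply: eq_bigr => l _; rewrite /Dterm /ssyt_series rmorph_sum mulr_sumr.
by apply: eq_bigr => T _; rewrite rmorphXn.
Qed.

Lemma schur_polyC (R : nzRingType) mu a : schur {poly R} mu a = (schur R mu a)%:P.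
Proof. by rewrite /schur /ssyt_series rmorph_sum; apply: eq_bigr => T _; rewrite rmorph1. Qed.

Theorem theorem6p2p3 (m n : nat) (hm : (1 <= m)%N) (hn : (1 <= n)%N) :
  (symmetric_function (Dseries m n) /\ schur_coefs_in Nqt (Dseries m n)) /\
  (forall s : seq nat,
     is_partition s -> (diagram s `<=` diagram (mdelta m n))%fset ->
     symmetric_function (Dterm m n s) /\ schur_coefs_in Nq (Dterm m n s)).
Proof.
case: n hn => // n' _; set n := n'.+1; split; last first.
  move=> s ps _; split.
    split; last by move=> f a b fb ba; apply: (Dterm_symmetric _ hm ps fb ba).
    by exists n => a /eqP nz; rewrite (Dterm_degree hm ps nz).
  have [C [CN CE]] := Dterm_schur n' hm ps.
  exact: (schur_coefs Nq0 NqD CN CE).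
split; first split.
- exists n => a /eqP; apply: contra_neqT; rewrite -ltnNge => an.
  rewrite Dseries_terms big1 // => l /andP[ps _].
  have [->|nz] := eqVneq (Dterm m n (map val l) a) 0; first by rewrite polyC0 mulr0.
  by rewrite (Dterm_degree hm ps nz) ltnn in an.
- move=> f a b fb ba; rewrite !Dseries_terms; apply: eq_bigr => l /andP[ps _].
  by rewrite (Dterm_symmetric _ hm ps fb ba).
have ex (l : n.-tuple 'I_(m * n.-1).+1) : exists C : shape n -> {poly int}, (forall la, Nq (C la)) /\
    (is_partition (map val l) -> forall a, Dterm m n (map val l) a = \sum_(la | is_part la) C la * schur {poly int} (ipart_of la) a).
  case: (boolP (is_partition (map val l))) => ps; last by exists (fun=> 0); split=> // la; apply: Nq0.
  by have [C [CN CE]] := Dterm_schur n' hm ps; exists C.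
have [C CP] := fin_all_exists ex.
apply: (schur_coefs Nqt0 NqtD (C := fun la => \sum_(l : n.-tuple 'I_(m * n.-1).+1 | is_partition (map val l) &&
        (diagram (map val l) `<=` diagram (mdelta m n))%fset)
    'X^(m * 'C(n, 2) - sumn (map val l)) * (C l la)%:P)) => [la|a].
  by apply: (P_sum Nqt0 NqtD) => l; apply: NqtXC; have [] := CP l.
rewrite Dseries_terms; under [RHS]eq_bigr => la _ do rewrite mulr_suml.
rewrite [RHS]exchange_big /=; apply: eq_bigr => l /andP[ps _].
have [_ /(_ ps) ->] := CP l; rewrite rmorph_sum mulr_sumr; apply: eq_bigr => la _.
by rewrite (@schur_polyC {poly int}) /= polyCM mulrA.
Qed.
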